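(* Let $x_1,x_2$ be two distinct points of $\mathbb{S}^2$. Then $$(B_3(\mathbb{S}^2\setminus\{x_1,x_2\}))^{(1)}\cong L\rtimes\mathbb{F}_2(u,v),$$ where $\mathbb{F}_2(u,v)$ is the free group on $u,v$, and $L$ is the subgroup of infinite rank of the free group $\mathbb{F}_5(z_1,\ldots,z_5)$ freely generated by $\{\alpha_{i,j}\}_{i\in\{2,3,4,5\},\,j\in\mathbb{Z}}$, with $$\alpha_{i,j}=\begin{cases}z_1^jz_iz_1^{-(j+1)}&\text{if }i=2,3\\ z_1^jz_iz_1^{-(j-1)}&\text{if }i=4,5,\end{cases}$$ the action being given, for all $j\in\mathbb{Z}$, by $$u\alpha_{i,j}u^{-1}=\begin{cases}R_j^{-1}\,z_1^jt_it_1^{-1}z_1^{-j}\,R_j&\text{if }i=2,3\\ R_j^{-1}\,z_1^jt_it_1z_1^{-j}\,R_j&\text{if }i=4,5,\end{cases}\qquad v\alpha_{i,j}v^{-1}=\begin{cases}S_j^{-1}\,z_1^jw_iw_1^{-1}z_1^{-j}\,S_j&\text{if }i=2,3\\ S_j^{-1}\,z_1^jw_iw_1z_1^{-j}\,S_j&\text{if }i=4,5,\end{cases}$$ where $t_i,w_i\in\mathbb{F}_5(z_1,\ldots,z_5)$ and $R_j,S_j\in L$ are the elements defined in the context.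
   Context: For a surface $M$, $F_m(M)=\{(y_1,\ldots,y_m)\in M^m: y_i\neq y_j\text{ if }i\neq j\}$, and $B_m(M)=\pi_1(F_m(M)/S_m)$ is the $m$-string braid group of $M$. $G^{(1)}=[G,G]$. In $N\rtimes Q$ the normal subgroup is $N$, and $qnq^{-1}$ denotes the image of $n\in N$ under the action of $q\in Q$. In the free group $\mathbb{F}_5(z_1,\ldots,z_5)$ put $t_1=z_2$, $t_2=z_2z_1^{-1}z_5z_3z_2^{-1}z_4^{-1}z_2$, $t_3=z_2^2z_3^{-1}z_5^2z_3z_2^{-1}z_4^{-1}z_2$, $t_4=z_2z_1^{-1}z_5z_1z_2^{-1}$, $t_5=z_2^2z_3^{-1}z_5^2$; $w_1=z_1^{-1}z_3z_2^{-1}z_4^{-1}z_2$, $w_2=w_1^2z_3^{-1}z_5z_2z_3^{-1}z_5z_4^{-1}z_2$, $w_3=w_1^2z_1^{-1}(z_2z_3^{-1}z_5)^2z_4^{-1}z_2$, $w_4=w_1^2z_3^{-1}z_5z_2w_1^{-2}$, $w_5=w_1^2z_1^{-1}(z_2z_3^{-1}z_5)^2$. (The assignments $uz_iu^{-1}=t_i$, $vz_iv^{-1}=w_i$ define an action of $\mathbb{F}_2(u,v)$ on $\mathbb{F}_5(z_1,\ldots,z_5)$.) Put $R_0=S_0=1$ and $$R_j=\begin{cases}(z_1^{j-1}t_1z_1^{-j})^{-1}(z_1^{j-2}t_1z_1^{-j+1})^{-1}\cdots(t_1z_1^{-1})^{-1}&\text{if }j>0\\(z_1^jt_1z_1^{-(j+1)})(z_1^{j+1}t_1z_1^{-(j+2)})\cdots(z_1^{-1}t_1)&\text{if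 }j<0,\end{cases}$$ and let $S_j$ be defined by the same formulas with $t_1$ replaced by $w_1$. *)

(* Defs.v *)
From HB Require Import structures.
From mathcomp Require Import all_boot all_order perm all_algebra.
From mathcomp Require Import all_classical all_reals all_analysis homotopy lra.

Set Implicit Arguments.
Unset Strict Implicit.
Unset Printing Implicit Defensive.

Import Order.TTheory GRing.Theory Num.Theory numFieldNormedType.Exports.

Local Open Scope classical_set_scope.
Local Open Scope group_scope.

Definition group_iso (G H : groupType) : Prop :=
  exists f : {multiplicative G -> H}, bijective f.

Definition expgz (G : groupType) (x : G) (k : int) : G :=
  match k with Posz n => x ^+ n | Negz n => x ^- n.+1 end.

Section GeneratedSubgroup.
Context (G : groupType).
Implicit Types S H : set G.

Definition subgroup H : Prop :=
  [/\ H 1, forall x y, H x -> H y -> H (x * y) & forall x, H x -> H x^-1].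

Definition gen_set S : set G := [set x | forall H, subgroup H -> S `<=` H -> H x].

Definition gen_group S : Type := set_type (gen_set S).

HB.instance Definition _ S := SubChoice.on (gen_group S).

Lemma sub_gen S : S `<=` gen_set S.
Proof. by move=> x Sx H _; apply. Qed.

Lemma gen_group_closed S : group_closed (fun x => x \in gen_set S).
Proof.
split; first by apply/mem_set => H [H1 _ _].
move=> x y /set_mem Sx /set_mem Sy; apply/mem_set => H HG SH.
by have [_ HM HV] := HG; apply: HM; [exact: Sx | apply: HV; exact: Sy].
Qed.

HB.instance Definition _ S :=
  SubChoice_isSubGroup.Build G _ (gen_group S) (gen_group_closed S).

Definition gen_in S x (Sx : S x) : gen_group S := exist _ x (mem_set (sub_gen Sx)).

Definition commutators : set G := [set z | exists x y : G, z = [~ x, y]].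

End GeneratedSubgroup.

Definition derived_group (G : groupType) : groupType :=
  gen_group (@commutators G).

Record group_action (Q N : groupType) := GroupAction {
  gact :> Q -> N -> N;
  gact1 : forall n, gact 1 n = n;
  gactM : forall q r n, gact (q * r) n = gact q (gact r n);
  gactMr : forall q n m, gact q (n * m) = gact q n * gact q m }.

(* N ><| Q, where q n q^-1 = phi q n. *)
Definition sdprod_group (Q N : groupType) (phi : group_action Q N) : Type :=
  (N * Q)%type.

Section SemidirectProduct.
Context (Q N : groupType) (phi : group_action Q N).
Local Notation T := (sdprod_group phi).

HB.instance Definition _ := Choice.copy T (N * Q)%type.

Definition sd_one : T := (1, 1).
Definition sd_mul (x y : T) : T := (x.1 * phi x.2 y.1, x.2 * y.2).
Definition sd_inv (x : T) : T := (phi x.2^-1 x.1^-1, x.2^-1).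

Lemma gact_1r q : phi q 1 = 1.
Proof. by apply: (@mulgI _ (phi q 1)); rewrite -gactMr !mulg1. Qed.

Lemma sd_mulA : associative sd_mul.
Proof. by move=> x y z; rewrite /sd_mul /= gactM gactMr !mulgA. Qed.
Lemma sd_mul1g : left_id sd_one sd_mul.
Proof. by case=> n q; rewrite /sd_mul /= gact1 !mul1g. Qed.
Lemma sd_mulg1 : right_id sd_one sd_mul.
Proof. by case=> n q; rewrite /sd_mul /= gact_1r !mulg1. Qed.
Lemma sd_mulVg : left_inverse sd_one sd_inv sd_mul.
Proof. by case=> n q; rewrite /sd_mul /= -gactMr !mulVg gact_1r. Qed.
Lemma sd_mulgV : right_inverse sd_one sd_inv sd_mul.
Proof. by case=> n q; rewrite /sd_mul /= -gactM !mulgV gact1 mulgV. Qed.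

HB.instance Definition _ := isGroup.Build T
  sd_mulA sd_mul1g sd_mulg1 sd_mulVg sd_mulgV.

End SemidirectProduct.

Section FreeGroup.
Context (T : choiceType).

(* A letter (x, b) stands for x if b = false and for x^-1 if b = true. *)
Definition letter_inv (a : T * bool) : T * bool := (a.1, ~~ a.2).

Definition reduced (w : seq (T * bool)) : bool :=
  sorted (fun a b => b != letter_inv a) w.

Record free_group : Type := FreeGroup {
  word :> seq (T * bool); _ : reduced word }.

HB.instance Definition _ := [isSub for word].
HB.instance Definition _ := [Choice of free_group by <:].

Definition push (a : T * bool) (w : seq (T * bool)) : seq (T * bool) :=
  if w is b :: w' then if b == letter_inv a then w' else a :: w else [:: a].

(* the reduced form of the concatenation of w1 and w2, when w2 is reduced *)
Definition word_mul (w1 w2 : seq (T * bool)) : seq (T * bool) :=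
  foldr push w2 w1.

Definition word_inv (w : seq (T * bool)) : seq (T * bool) :=
  rev (map letter_inv w).

Lemma letter_invK : involutive letter_inv.
Proof. by case=> x b; rewrite /letter_inv /= negbK. Qed.

Lemma letter_inv_neq a : (letter_inv a == a) = false.
Proof. by case: a => x [] /=; rewrite /letter_inv xpair_eqE /= andbF. Qed.

Lemma push_reduced a w : reduced w -> reduced (push a w).
Proof.
case: w => //= b w; case: ifPn => [_ /path_sorted //|ba rw].
by rewrite /reduced /= ba.
Qed.

Lemma pushK a w : reduced w -> push (letter_inv a) (push a w) = w.
Proof.
case: w => [|b w] /=; first by rewrite letter_invK eqxx.
have [->|ba] := eqVneq; last by rewrite /= letter_invK eqxx.
by case: w => //= c w; rewrite letter_invK => /andP[/negbTE-> _].
Qed.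

Lemma pushVK a w : reduced w -> push a (push (letter_inv a) w) = w.
Proof. by move=> /(pushK (letter_inv a)); rewrite letter_invK. Qed.

Lemma word_mul_reduced w1 w2 : reduced w2 -> reduced (word_mul w1 w2).
Proof. by move=> rw2; elim: w1 => //= a w1; exact: push_reduced. Qed.

Lemma word_mul_push a w x : reduced x ->
  word_mul (push a w) x = push a (word_mul w x).
Proof.
move=> rx; case: w => //= b w; case: eqP => //= ->.
by rewrite pushVK //; exact: word_mul_reduced.
Qed.

Lemma word_mulA w1 w2 x : reduced x ->
  word_mul w1 (word_mul w2 x) = word_mul (word_mul w1 w2) x.
Proof. by move=> rx; elim: w1 => //= a w1 ->; rewrite word_mul_push. Qed.

Lemma word_mul0 w : reduced w -> word_mul w [::] = w.
Proof.
elim: w => //= a w IH raw; rewrite IH; last exact: path_sorted raw.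
by case: w raw {IH} => //= b w /andP[/negbTE->].
Qed.

Lemma word_mulVK w x : reduced x -> word_mul (word_inv w) (word_mul w x) = x.
Proof.
elim: w x => //= a w IH x rx; rewrite /word_inv /= rev_cons -cats1.
rewrite {1}/word_mul foldr_cat /= pushK; last exact: word_mul_reduced.
exact: IH.
Qed.

Lemma word_invK : involutive word_inv.
Proof.
move=> w; rewrite /word_inv map_rev revK -map_comp map_id_in // => a _.
exact: letter_invK.
Qed.

Lemma word_inv_reduced w : reduced w -> reduced (word_inv w).
Proof.
rewrite /reduced /word_inv rev_sorted sorted_map.
apply: sub_sorted => a b /=.
by rewrite letter_invK eq_sym.
Qed.

Lemma word_reduced (w : free_group) : reduced w. Proof. by case: w. Qed.

Definition fg_one : free_group := @FreeGroup [::] isT.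
Definition fg_mul (x y : free_group) : free_group :=
  FreeGroup (word_mul_reduced x (word_reduced y)).
Definition fg_inv (x : free_group) : free_group :=
  FreeGroup (word_inv_reduced (word_reduced x)).

Lemma fg_mulA : associative fg_mul.
Proof. by move=> x y z; apply/val_inj/word_mulA/word_reduced. Qed.
Lemma fg_mul1g : left_id fg_one fg_mul.
Proof. by move=> x; apply/val_inj. Qed.
Lemma fg_mulg1 : right_id fg_one fg_mul.
Proof. by move=> x; apply/val_inj/word_mul0/word_reduced. Qed.
Lemma fg_mulVg : left_inverse fg_one fg_inv fg_mul.
Proof.
move=> x; apply/val_inj => /=.
by rewrite -[in X in word_mul _ X](word_mul0 (word_reduced x)) word_mulVK.
Qed.
Lemma fg_mulgV : right_inverse fg_one fg_inv fg_mul.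
Proof.
move=> x; rewrite -[x in fg_mul x _](_ : fg_inv (fg_inv x) = x) ?fg_mulVg //.
exact/val_inj/word_invK.
Qed.

HB.instance Definition _ := isGroup.Build free_group
  fg_mulA fg_mul1g fg_mulg1 fg_mulVg fg_mulgV.

Definition free_gen (x : T) : free_group := @FreeGroup [:: (x, false)] isT.

Definition free_lift (G : groupType) (f : T -> G) (w : free_group) : G :=
  \prod_(a <- word w) (if a.2 then (f a.1)^-1 else f a.1).

End FreeGroup.

Definition freely_generates (I : choiceType) (G : groupType) (f : I -> G) : Prop :=
  bijective (free_lift f).

Definition free_basis (G : groupType) (S : set G) : Prop :=
  freely_generates (fun s : S => val s).

(* The rank of a free group is the cardinality of any of its free bases. *)
Definition free_of_infinite_rank (G : groupType) : Prop :=
  (exists S : set G, free_basis S) /\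
  (forall S : set G, free_basis S -> infinite_set S).

Definition unit_interval (R : realType) : Type := set_type `[0%R : R, 1%R].

Section RealContinuity.
Local Open Scope ring_scope.
Context (R : realType) (Y : topologicalType).
Implicit Types f g : Y -> R.

Lemma id_continuous : continuous (fun y : Y => y).
Proof. by move=> y; exact: cvg_id. Qed.
Lemma cont_add f g : continuous f -> continuous g -> continuous (fun y => f y + g y).
Proof. by move=> cf cg y; apply: continuousD; [exact: cf | exact: cg]. Qed.
Lemma cont_sub f g : continuous f -> continuous g -> continuous (fun y => f y - g y).
Proof. by move=> cf cg y; apply: continuousB; [exact: cf | exact: cg]. Qed.
Lemma cont_mul f g : continuous f -> continuous g -> continuous (fun y => f y * g y).
Proof. by move=> cf cg y; apply: continuousM; [exact: cf | exact: cg]. Qed.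
Lemma cont_min f g : continuous f -> continuous g -> continuous (fun y => Num.min (f y) (g y)).
Proof. by move=> cf cg y; apply: continuous_min; [exact: cf | exact: cg]. Qed.
Lemma cont_max f g : continuous f -> continuous g -> continuous (fun y => Num.max (f y) (g y)).
Proof. by move=> cf cg y; apply: continuous_max; [exact: cf | exact: cg]. Qed.

End RealContinuity.

Lemma cont_comp (X Y Z : topologicalType) (f : X -> Y) (g : Y -> Z) :
  continuous f -> continuous g -> continuous (fun x => g (f x)).
Proof. by move=> cf cg x; apply: continuous_comp; [exact: cf | exact: cg]. Qed.

Lemma cont_pair (X Y Z : topologicalType) (f : X -> Y) (g : X -> Z) :
  continuous f -> continuous g -> continuous (fun x => (f x, g x)).
Proof. by move=> cf cg x; apply: cvg_pair; [exact: cf | exact: cg]. Qed.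

Lemma cont_fst (X Y : topologicalType) : continuous (fun z : X * Y => z.1).
Proof. by move=> z; exact: cvg_fst. Qed.

Lemma cont_snd (X Y : topologicalType) : continuous (fun z : X * Y => z.2).
Proof. by move=> z; exact: cvg_snd. Qed.

Section UnitInterval.
Local Open Scope ring_scope.
Context (R : realType).
Local Notation I := (unit_interval R).

HB.instance Definition _ := Topological.on I.

Definition clamp01 (t : R) : R := Num.max 0 (Num.min t 1).

Lemma clamp01_in t : clamp01 t \in (`[0, 1]%classic : set R).
Proof.
rewrite inE /= in_itv /= /clamp01 le_max lexx /=.
by rewrite ge_max ler01 ge_min lexx orbT.
Qed.

Definition clampI (t : R) : I := exist _ (clamp01 t) (clamp01_in t).
Definition valI (t : I) : R := \val t.

Lemma valI_bounds (t : I) : 0 <= valI t <= 1.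
Proof. by case: t => t ti; move: (set_mem ti); rewrite /= in_itv. Qed.

Lemma valI_inj : injective valI. Proof. exact: val_inj. Qed.

Lemma clampIE t : 0 <= t <= 1 -> valI (clampI t) = t.
Proof. by case/andP=> t0 t1; rewrite /valI /= /clamp01 min_l // max_r. Qed.

Lemma clampI_val (t : I) : clampI (valI t) = t.
Proof. by apply/valI_inj/clampIE/valI_bounds. Qed.

Lemma valI_continuous : continuous valI.
Proof. exact: initial_continuous. Qed.

Lemma to_I_continuous (Y : topologicalType) (f : Y -> I) :
  continuous (valI \o f) -> continuous f.
Proof. by move=> cf; apply: continuous_comp_initial. Qed.

Lemma clampI_continuous : continuous clampI.
Proof.
apply: to_I_continuous; rewrite /comp /=.
by apply: cont_max; [exact: cst_continuous | apply: cont_min; [exact: id_continuous | exact: cst_continuous]].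
Qed.

Let zI : I := clampI 0.
Let oI : I := clampI 1.
Lemma zI_neq_oI : zI != oI.
Proof.
apply/eqP => /(congr1 valI); rewrite !clampIE ?lexx ?ler01 //.
by move/esym/eqP; rewrite oner_eq0.
Qed.

HB.instance Definition _ := @isBiPointed.Build I zI oI zI_neq_oI.

Lemma valI0 : valI (zero : I) = 0. Proof. by rewrite clampIE ?lexx ?ler01. Qed.
Lemma valI1 : valI (one : I) = 1. Proof. by rewrite clampIE ?lexx ?ler01. Qed.

End UnitInterval.

Section Gluing.
Local Open Scope ring_scope.
Context (R : realType) (X Y : topologicalType).

Lemma glue_continuous (h : Y -> R) (c : R) (f g : Y -> X) :
  continuous h -> continuous f -> continuous g ->
  (forall y, h y = c -> f y = g y) ->
  continuous (fun y => if h y <= c then f y else g y).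
Proof.
move=> ch cf cg fg y; have [hy|hy|hy] := ltgtP (h y) c.
- move=> U /=; rewrite (ltW hy) => Uf.
  apply: (@filterS2 _ (nbhs y) _ (f @^-1` U) (fun z => h z < c) _ _
    (cf y U Uf) (ch y _ (lt_nbhsl hy))) => z Uz hz /=.
  by rewrite (ltW hz).
- move=> U /=; rewrite leNgt hy /= => Ug.
  apply: (@filterS2 _ (nbhs y) _ (g @^-1` U) (fun z => c < h z) _ _
    (cg y U Ug) (ch y _ (lt_nbhsr hy))) => z Uz hz /=.
  by rewrite leNgt hz.
- move=> U /=; rewrite hy lexx => Uy.
  have Ug : nbhs (g y) U by rewrite -fg.
  apply: (@filterS2 _ (nbhs y) _ (f @^-1` U) (g @^-1` U) _ _
    (cf y U Uy) (cg y U Ug)) => z Uf Ug' /=.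
  by case: ifP.
Qed.

End Gluing.

Section Homotopy.
Local Open Scope ring_scope.
Context (R : realType) (X : topologicalType).
Local Notation I := (unit_interval R).
Implicit Types f g : I -> X.

(* homotopy relative to the endpoints *)
Definition homotopic f g : Prop := exists H : I * I -> X,
  [/\ continuous H,
      forall t, H (zero, t) = f t, forall t, H (one, t) = g t,
      forall s, H (s, zero) = f zero & forall s, H (s, one) = f one].

Lemma homotopic_refl f : continuous f -> homotopic f f.
Proof.
move=> cf; exists (fun z => f z.2); split=> //.
by apply: cont_comp cf; exact: cont_snd.
Qed.

Lemma homotopic_ends f g : homotopic f g -> f zero = g zero /\ f one = g one.
Proof. by case=> H [_ H0 H1 Hz Ho]; rewrite -!H1 Hz Ho. Qed.

Lemma homotopic_sym f g : homotopic f g -> homotopic g f.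
Proof.
move=> fg; have [e0 e1] := homotopic_ends fg; case: fg => H [cH H0 H1 Hz Ho].
pose op (s : I) : I := clampI (1 - valI s).
have opz : op zero = one by apply: valI_inj; rewrite /op valI0 subr0.
have opo : op one = zero by apply: valI_inj; rewrite /op valI1 subrr.
exists (fun z => H (op z.1, z.2)); split=> //=.
- apply: cont_comp cH; apply: cont_pair; last exact: cont_snd.
  rewrite /op; apply: (@cont_comp _ _ _ (fun z : I * I => 1 - valI z.1) (@clampI R));
    last exact: clampI_continuous.
  apply: cont_sub; first exact: cst_continuous.
  by apply: cont_comp; [exact: cont_fst | exact: valI_continuous].
- by move=> t; rewrite opz.
- by move=> t; rewrite opo.
- by move=> s; rewrite Hz.
- by move=> s; rewrite Ho.
Qed.

(* f on [0, 1/2] followed by g on [1/2, 1], both at double speed *)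
Definition concat f g (t : I) : X :=
  if valI t <= 2^-1 then f (clampI (2 * valI t)) else g (clampI (2 * valI t - 1)).

Lemma clampI0 : clampI 0 = zero :> I. Proof. by []. Qed.
Lemma clampI1 : clampI 1 = one :> I. Proof. by []. Qed.

Lemma dbl_continuous (Y : topologicalType) (h : Y -> I) : continuous h ->
  continuous (fun y => clampI (2 * valI (h y)) : I) /\
  continuous (fun y => clampI (2 * valI (h y) - 1) : I).
Proof.
move=> ch; have cv : continuous (fun y => 2 * valI (h y)).
  apply: cont_mul; first exact: cst_continuous.
  by apply: cont_comp; [exact: ch | exact: valI_continuous].
split.
  by apply: (@cont_comp _ _ _ _ (@clampI R) cv); exact: clampI_continuous.
apply: (@cont_comp _ _ _ (fun y => 2 * valI (h y) - 1) (@clampI R)); last exact: clampI_continuous.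
by apply: cont_sub; [exact: cv | exact: cst_continuous].
Qed.

Lemma concat_glue (Y : topologicalType) (h : Y -> I) (F G : Y * I -> X) :
  continuous h -> continuous F -> continuous G ->
  (forall y, F (y, one) = G (y, zero)) ->
  continuous (fun y => if valI (h y) <= 2^-1
     then F (y, clampI (2 * valI (h y))) else G (y, clampI (2 * valI (h y) - 1))).
Proof.
move=> ch cF cG FG; have [c1 c2] := dbl_continuous ch.
apply: (@glue_continuous R X Y (fun y => valI (h y)) (2^-1)
  (fun y => F (y, clampI (2 * valI (h y))))
  (fun y => G (y, clampI (2 * valI (h y) - 1)))).
- by apply: cont_comp; [exact: ch | exact: valI_continuous].
- by apply: cont_comp cF; apply: cont_pair => //; exact: id_continuous.
- by apply: cont_comp cG; apply: cont_pair => //; exact: id_continuous.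
- by move=> y ->; rewrite divff ?pnatr_eq0 // subrr clampI0 clampI1.
Qed.

Lemma concat_continuous f g :
  continuous f -> continuous g -> f one = g zero -> continuous (concat f g).
Proof.
move=> cf cg fg.
apply: (@concat_glue I id (fun z => f z.2) (fun z => g z.2)) => //.
- exact: id_continuous.
- by apply: cont_comp cf; exact: cont_snd.
- by apply: cont_comp cg; exact: cont_snd.
Qed.

Lemma concat0 f g : concat f g zero = f zero.
Proof. by rewrite /concat valI0 invr_ge0 ler0n mulr0. Qed.

Lemma concat1 f g : concat f g one = g one.
Proof.
rewrite /concat valI1 mulr1 ifF; last by apply/negbTE; lra.
by congr g; rewrite (_ : 2 - 1 = 1 :> R); last lra.
Qed.

Lemma homotopic_trans f g h : homotopic f g -> homotopic g h -> homotopic f h.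
Proof.
move=> fg [K [cK K0 K1 Kz Ko]]; have [e0 e1] := homotopic_ends fg.
case: fg => H [cH H0 H1 Hz Ho].
exists (fun z => if valI z.1 <= 2^-1 then H (clampI (2 * valI z.1), z.2)
                 else K (clampI (2 * valI z.1 - 1), z.2)); split=> /=.
- apply: (@concat_glue (I * I)%type (fun z => z.1)
    (fun z => H (z.2, z.1.2)) (fun z => K (z.2, z.1.2))).
  + exact: cont_fst.
  + apply: cont_comp cH; apply: cont_pair; first exact: cont_snd.
    by apply: cont_comp; [exact: cont_fst | exact: cont_snd].
  + apply: cont_comp cK; apply: cont_pair; first exact: cont_snd.
    by apply: cont_comp; [exact: cont_fst | exact: cont_snd].
  + by move=> y /=; rewrite H1 K0.
- by move=> t; rewrite valI0 invr_ge0 ler0n mulr0 clampI0.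
- move=> t; rewrite valI1 mulr1 ifF; last by apply/negbTE; lra.
  by rewrite (_ : 2 - 1 = 1 :> R) ?clampI1 //; lra.
- by move=> s; case: ifP => _; rewrite ?Hz ?Kz.
- by move=> s; case: ifP => _; rewrite ?Ho ?Ko.
Qed.

Lemma homotopic_concat f f' g g' : f one = g zero ->
  homotopic f f' -> homotopic g g' -> homotopic (concat f g) (concat f' g').
Proof.
move=> e [H [cH H0 H1 Hz Ho]] [K [cK K0 K1 Kz Ko]].
exists (fun z => if valI z.2 <= 2^-1 then H (z.1, clampI (2 * valI z.2))
                 else K (z.1, clampI (2 * valI z.2 - 1))); split=> /=.
- apply: (@concat_glue (I * I)%type (fun z => z.2)
    (fun z => H (z.1.1, z.2)) (fun z => K (z.1.1, z.2))).
  + exact: cont_snd.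
  + apply: cont_comp cH; apply: cont_pair; last exact: cont_snd.
    by apply: cont_comp; [exact: cont_fst | exact: cont_fst].
  + apply: cont_comp cK; apply: cont_pair; last exact: cont_snd.
    by apply: cont_comp; [exact: cont_fst | exact: cont_fst].
  + by move=> y /=; rewrite Ho Kz.
- by move=> t; rewrite H0 K0.
- by move=> t; rewrite H1 K1.
- by move=> s; rewrite concat0 valI0 invr_ge0 ler0n mulr0 clampI0 Hz.
- move=> s; rewrite concat1 valI1 mulr1 ifF; last by apply/negbTE; lra.
  by rewrite (_ : 2 - 1 = 1 :> R) ?clampI1 ?Ko //; lra.
Qed.

Lemma homotopic_reparam f (a b : R -> R) : continuous f ->
  continuous a -> continuous b -> a 0 = b 0 -> a 1 = b 1 ->
  homotopic (fun t => f (clampI (a (valI t)))) (fun t => f (clampI (b (valI t)))).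
Proof.
move=> cf ca cb e0 e1.
exists (fun z => f (clampI ((1 - valI z.1) * a (valI z.2) + valI z.1 * b (valI z.2)))).
have cv1 : continuous (fun z : I * I => valI z.1).
  by apply: cont_comp; [exact: cont_fst | exact: valI_continuous].
have cv2 : continuous (fun z : I * I => valI z.2).
  by apply: cont_comp; [exact: cont_snd | exact: valI_continuous].
split=> /=.
- apply: cont_comp cf; apply: (@cont_comp _ _ _
    (fun z : I * I => (1 - valI z.1) * a (valI z.2) + valI z.1 * b (valI z.2))
    (@clampI R)); last exact: clampI_continuous.
  apply: cont_add; apply: cont_mul => //.
  + by apply: cont_sub => //; exact: cst_continuous.
  + by apply: cont_comp; [exact: cv2 | exact: ca].
  + by apply: cont_comp; [exact: cv2 | exact: cb].
- by move=> t; rewrite valI0 subr0 mul1r mul0r addr0.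
- by move=> t; rewrite valI1 subrr mul1r mul0r add0r.
- by move=> s; rewrite valI0 e0 -mulrDl subrK mul1r.
- by move=> s; rewrite valI1 e1 -mulrDl subrK mul1r.
Qed.

End Homotopy.

Section FundamentalGroup.
Local Open Scope ring_scope.
Local Open Scope quotient_scope.
Context (R : realType) (X : topologicalType) (x : X).
Local Notation I := (unit_interval R).
Local Notation loop := {path I from x to x in X}.

Lemma loop_continuous (p : loop) : continuous p. Proof. exact: cts_fun. Qed.

Lemma loop_concat_cont (p q : loop) : continuous (concat p q).
Proof.
apply: concat_continuous; try exact: loop_continuous.
by rewrite path_zero path_one.
Qed.
Lemma loop_concat0 (p q : loop) : concat p q zero = x.
Proof. by rewrite concat0 path_zero. Qed.
Lemma loop_concat1 (p q : loop) : concat p q one = x.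
Proof. by rewrite concat1 path_one. Qed.

Definition loop_concat (p q : loop) : loop :=
  mk_path (@loop_concat_cont p q) (loop_concat0 p q) (loop_concat1 p q).

Definition loop_cst : loop := cst x.

Definition reverse (p : I -> X) (t : I) : X := p (clampI (1 - valI t)).

Lemma loop_reverse_cont (p : loop) : continuous (reverse p).
Proof.
apply: cont_comp; last exact: loop_continuous.
apply: (@cont_comp _ _ _ (fun t : I => 1 - valI t) (@clampI R));
  last exact: clampI_continuous.
by apply: cont_sub; [exact: cst_continuous | exact: valI_continuous].
Qed.
Lemma loop_reverse0 (p : loop) : reverse p zero = x.
Proof. by rewrite /reverse valI0 subr0 clampI1 path_one. Qed.
Lemma loop_reverse1 (p : loop) : reverse p one = x.
Proof. by rewrite /reverse valI1 subrr clampI0 path_zero. Qed.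

Definition loop_reverse (p : loop) : loop :=
  mk_path (@loop_reverse_cont p) (loop_reverse0 p) (loop_reverse1 p).

Definition loop_homotopic (p q : loop) : bool := `[< homotopic p q >].

Lemma loop_homotopic_refl : reflexive loop_homotopic.
Proof. by move=> p; apply/asboolP/homotopic_refl/loop_continuous. Qed.
Lemma loop_homotopic_sym : symmetric loop_homotopic.
Proof. by move=> p q; apply/asboolP/asboolP => /homotopic_sym. Qed.
Lemma loop_homotopic_trans : transitive loop_homotopic.
Proof.
by move=> q p r /asboolP pq /asboolP qr; apply/asboolP/(homotopic_trans pq qr).
Qed.

Canonical loop_homotopic_equiv := EquivRel loop_homotopic
  loop_homotopic_refl loop_homotopic_sym loop_homotopic_trans.

Definition fundamental_group : Type := {eq_quot loop_homotopic}.

HB.instance Definition _ := Choice.on fundamental_group.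
HB.instance Definition _ := EqQuotient.on fundamental_group.

Local Notation pi1 := fundamental_group.

Lemma pi1_eqP (p q : loop) : \pi_pi1 p = \pi_pi1 q <-> homotopic p q.
Proof.
split=> [/eqmodP/asboolP //|pq].
by apply/eqmodP/asboolP.
Qed.

Lemma repr_homotopic (p : loop) : homotopic (repr (\pi_pi1 p)) p.
Proof. by apply/pi1_eqP; rewrite reprK. Qed.

Definition pi1_one : pi1 := \pi_pi1 loop_cst.
Definition pi1_mul (a b : pi1) : pi1 := \pi_pi1 (loop_concat (repr a) (repr b)).
Definition pi1_inv (a : pi1) : pi1 := \pi_pi1 (loop_reverse (repr a)).

Lemma loop_ends (p q : loop) : p one = q zero.
Proof. by rewrite path_one path_zero. Qed.

Lemma pi1_mulE (p q : loop) :
  pi1_mul (\pi_pi1 p) (\pi_pi1 q) = \pi_pi1 (loop_concat p q).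
Proof.
by apply/pi1_eqP/homotopic_concat; [exact: loop_ends | exact: repr_homotopic..].
Qed.

Lemma reparamP (p : loop) (a b : R -> R) (f g : I -> X) :
  continuous a -> continuous b -> a 0 = b 0 -> a 1 = b 1 ->
  (forall t, f t = p (clampI (a (valI t)))) ->
  (forall t, g t = p (clampI (b (valI t)))) -> homotopic f g.
Proof.
move=> ca cb e0 e1 /funext -> /funext ->.
exact: homotopic_reparam (@loop_continuous p) ca cb e0 e1.
Qed.

Lemma loop_concat_assoc (p q r : loop) :
  homotopic (concat p (concat q r)) (concat (concat p q) r).
Proof.
pose a (t : R) := Num.max (t / 2) (Num.max (t - 4^-1) (2 * t - 1)).
apply: (@reparamP (loop_concat (loop_concat p q) r) a id).
- apply: cont_max.
    by apply: cont_mul; [exact: id_continuous | exact: cst_continuous].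
  apply: cont_max.
    by apply: cont_sub; [exact: id_continuous | exact: cst_continuous].
  apply: cont_sub; last exact: cst_continuous.
  by apply: cont_mul; [exact: cst_continuous | exact: id_continuous].
- exact: id_continuous.
- by rewrite /a mul0r max_l // ge_max; apply/andP; split; lra.
- by rewrite /a [X in Num.max _ X]max_r ?max_r; lra.
- move=> t; have t01 := valI_bounds t; rewrite /= /mk_path /concat.
  have [t1|t1] := leP (valI t) 2^-1.
    have -> : a (valI t) = valI t / 2.
      by rewrite /a max_l // ge_max; apply/andP; split; lra.
    rewrite (_ : valI (clampI _) = valI t / 2); last by rewrite clampIE //; lra.
    rewrite ifT; last lra.
    rewrite (_ : valI (clampI _) = valI t); last by rewrite clampIE //; lra.
    by rewrite t1.
  rewrite (_ : valI (clampI (2 * valI t - 1)) = 2 * valI t - 1);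
    last by rewrite clampIE //; lra.
  have [t2|t2] := leP (2 * valI t - 1) 2^-1.
    have -> : a (valI t) = valI t - 4^-1.
      by rewrite /a [X in Num.max _ X]max_l ?max_r; lra.
    rewrite (_ : valI (clampI (valI t - _)) = valI t - 4^-1);
      last by rewrite clampIE //; lra.
    rewrite ifT; last lra.
    rewrite (_ : valI (clampI _) = 2 * valI t - 2^-1);
      last by rewrite clampIE //; lra.
    rewrite ifF; last by apply/negbTE; lra.
    by congr (q (clampI _)); lra.
  have -> : a (valI t) = 2 * valI t - 1.
    by rewrite /a [X in Num.max _ X]max_r ?max_r; lra.
  rewrite (_ : valI (clampI _) = 2 * valI t - 1);
    last by rewrite clampIE //; lra.
  by rewrite leNgt t2.
- by move=> t; rewrite clampI_val.
Qed.

Lemma affine_cont (a b : R) : continuous (fun t : R => a * t + b).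
Proof.
apply: cont_add; last exact: cst_continuous.
by apply: cont_mul; [exact: cst_continuous | exact: id_continuous].
Qed.

Lemma loop_concat_1l (p : loop) : homotopic (concat (cst x) p) p.
Proof.
apply: (@reparamP p (fun t => Num.max 0 (2 * t - 1)) id).
- by apply: cont_max; [exact: cst_continuous | exact: affine_cont].
- exact: id_continuous.
- by rewrite max_l //; lra.
- by rewrite max_r; lra.
- move=> t; rewrite /concat; case: leP => t1; last by rewrite max_r //; lra.
  by rewrite max_l ?clampI0 ?path_zero //; lra.
- by move=> t; rewrite clampI_val.
Qed.

Lemma loop_concat_1r (p : loop) : homotopic (concat p (cst x)) p.
Proof.
apply: (@reparamP p (fun t => Num.min (2 * t) 1) id).
- apply: cont_min; last exact: cst_continuous.
  by apply: cont_mul; [exact: cst_continuous | exact: id_continuous].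
- exact: id_continuous.
- by rewrite min_l //; lra.
- by rewrite min_r; lra.
- move=> t; rewrite /concat; case: leP => t1; first by rewrite min_l //; lra.
  by rewrite min_r ?clampI1 ?path_one //; lra.
- by move=> t; rewrite clampI_val.
Qed.

Lemma loop_concat_Vl (p : loop) : homotopic (concat (reverse p) p) (cst x).
Proof.
apply: (@reparamP p (fun t => Num.max (1 - 2 * t) (2 * t - 1)) (cst 1)).
- apply: cont_max; last exact: affine_cont.
  apply: cont_sub; first exact: cst_continuous.
  by apply: cont_mul; [exact: cst_continuous | exact: id_continuous].
- exact: cst_continuous.
- by rewrite max_l //=; lra.
- by rewrite max_r /=; lra.
- move=> t; have t01 := valI_bounds t; rewrite /concat /reverse.
  case: leP => t1; last by rewrite max_r //; lra.
  by rewrite max_l ?clampIE //; lra.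
- by move=> t; rewrite /= clampI1 path_one.
Qed.

Lemma loop_concat_Vr (p : loop) : homotopic (concat p (reverse p)) (cst x).
Proof.
apply: (@reparamP p (fun t => Num.min (2 * t) (2 - 2 * t)) (cst 0)).
- apply: cont_min.
    by apply: cont_mul; [exact: cst_continuous | exact: id_continuous].
  apply: cont_sub; first exact: cst_continuous.
  by apply: cont_mul; [exact: cst_continuous | exact: id_continuous].
- exact: cst_continuous.
- by rewrite min_l //=; lra.
- by rewrite min_r /=; lra.
- move=> t; have t01 := valI_bounds t; rewrite /concat /reverse.
  case: leP => t1; first by rewrite min_l //; lra.
  rewrite min_r; last lra.
  by rewrite clampIE; [congr (p (clampI _)); lra | lra].
- by move=> t; rewrite /= clampI0 path_zero.
Qed.

Lemma pi1_mulA : associative pi1_mul.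
Proof.
elim/quotW=> p; elim/quotW=> q; elim/quotW=> r.
rewrite (pi1_mulE q r) (pi1_mulE p q) !pi1_mulE.
apply/pi1_eqP; exact: loop_concat_assoc.
Qed.
Lemma pi1_mul1g : left_id pi1_one pi1_mul.
Proof. by elim/quotW=> p; rewrite pi1_mulE; apply/pi1_eqP; exact: loop_concat_1l. Qed.
Lemma pi1_mulg1 : right_id pi1_one pi1_mul.
Proof. by elim/quotW=> p; rewrite pi1_mulE; apply/pi1_eqP; exact: loop_concat_1r. Qed.
Lemma pi1_mulVg : left_inverse pi1_one pi1_inv pi1_mul.
Proof.
move=> a; rewrite /pi1_inv -[in X in pi1_mul _ X](reprK a) pi1_mulE.
apply/pi1_eqP; exact: loop_concat_Vl.
Qed.
Lemma pi1_mulgV : right_inverse pi1_one pi1_inv pi1_mul.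
Proof.
move=> a; rewrite /pi1_inv -[in X in pi1_mul X _](reprK a) pi1_mulE.
apply/pi1_eqP; exact: loop_concat_Vr.
Qed.

HB.instance Definition _ := isGroup.Build fundamental_group
  pi1_mulA pi1_mul1g pi1_mulg1 pi1_mulVg pi1_mulgV.

End FundamentalGroup.

Section Configurations.
Local Open Scope quotient_scope.
Context (m : nat) (M : topologicalType).

(* F_m(M), with the subspace topology of M^m *)
Definition config : Type :=
  set_type [set y : {ptws 'I_m -> M} | forall i j, i != j -> y i != y j].

HB.instance Definition _ := Topological.on config.

Definition same_orbit (y y' : config) : bool :=
  [exists s : {perm 'I_m}, [forall i, \val y' i == \val y (s i)]].

Lemma same_orbitP y y' :
  reflect (exists s : {perm 'I_m}, forall i, \val y' i = \val y (s i))
          (same_orbit y y').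
Proof.
apply: (iffP existsP) => -[s H]; exists s; last by apply/forallP => i; apply/eqP.
by move=> i; apply/eqP; move: i; apply/forallP.
Qed.

Lemma same_orbit_refl : reflexive same_orbit.
Proof. by move=> y; apply/same_orbitP; exists 1 => i; rewrite perm1. Qed.
Lemma same_orbit_sym : symmetric same_orbit.
Proof.
move=> y y'; apply/same_orbitP/same_orbitP => -[s H]; exists s^-1 => i;
  by rewrite H permKV.
Qed.
Lemma same_orbit_trans : transitive same_orbit.
Proof.
move=> y2 y1 y3 /same_orbitP[s H] /same_orbitP[r K]; apply/same_orbitP.
by exists (r * s) => i; rewrite K H permM.
Qed.

Canonical same_orbit_equiv := EquivRel same_orbit
  same_orbit_refl same_orbit_sym same_orbit_trans.

(* F_m(M) / S_m, with the quotient topology *)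
Definition unordered_config : topologicalType :=
  quotient_topology {eq_quot same_orbit}.

End Configurations.

(* b is the base point. The real field R only provides the unit interval that
   parametrizes loops. *)
Definition braid_group (R : realType) (m : nat) (M : topologicalType)
    (b : unordered_config m M) : groupType := @fundamental_group R _ b.

Definition sphere2 (R : realType) : topologicalType :=
  set_type [set v : 'rV[R]_3 | (\sum_i v ord0 i ^+ 2 = 1)%R].

Definition punctured_sphere2 (R : realType) (x1 x2 : sphere2 R) : topologicalType :=
  set_type (~` [set x1; x2]).

Definition F5 : groupType := free_group 'I_5.

(* z_ 1, ..., z_ 5 are the five free generators *)
Definition z_ (i : nat) : F5 := free_gen (inord i.-1 : 'I_5).

(* The functions t_ and w_ are only used at the indices 1, ..., 5. *)
Definition t_ (i : nat) : F5 :=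
  match i with
  | 1%N => z_ 2
  | 2%N => z_ 2 * (z_ 1)^-1 * z_ 5 * z_ 3 * (z_ 2)^-1 * (z_ 4)^-1 * z_ 2
  | 3%N => z_ 2 ^+ 2 * (z_ 3)^-1 * z_ 5 ^+ 2 * z_ 3 * (z_ 2)^-1 * (z_ 4)^-1 * z_ 2
  | 4%N => z_ 2 * (z_ 1)^-1 * z_ 5 * z_ 1 * (z_ 2)^-1
  | 5%N => z_ 2 ^+ 2 * (z_ 3)^-1 * z_ 5 ^+ 2
  | _ => 1
  end.

Definition w1 : F5 := (z_ 1)^-1 * z_ 3 * (z_ 2)^-1 * (z_ 4)^-1 * z_ 2.

Definition w_ (i : nat) : F5 :=
  match i with
  | 1%N => w1
  | 2%N => w1 ^+ 2 * (z_ 3)^-1 * z_ 5 * z_ 2 * (z_ 3)^-1 * z_ 5 * (z_ 4)^-1 * z_ 2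
  | 3%N => w1 ^+ 2 * (z_ 1)^-1 * (z_ 2 * (z_ 3)^-1 * z_ 5) ^+ 2 * (z_ 4)^-1 * z_ 2
  | 4%N => w1 ^+ 2 * (z_ 3)^-1 * z_ 5 * z_ 2 * w1 ^- 2
  | 5%N => w1 ^+ 2 * (z_ 1)^-1 * (z_ 2 * (z_ 3)^-1 * z_ 5) ^+ 2
  | _ => 1
  end.

Definition z1X (k : int) : F5 := expgz (z_ 1) k.

Definition tele_factor (a : F5) (k : int) : F5 :=
  z1X k * a * z1X (- (k + 1))%R.

(* R_j is the value at a = t_1 and S_j the value at a = w_1. The factors are
   those of k = j - 1, ..., 0 (inverted) if j > 0, and of k = j, ..., -1 if
   j < 0. *)
Definition tele_prod (a : F5) (j : int) : F5 :=
  match j with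
  | Posz n => \prod_(i < n) (tele_factor a (n%:Z - 1 - i%:Z)%R)^-1
  | Negz n => \prod_(i < n.+1) tele_factor a (j + i%:Z)%R
  end.

Definition R_ (j : int) : F5 := tele_prod (t_ 1) j.
Definition S_ (j : int) : F5 := tele_prod (w_ 1) j.

Definition alpha (i : nat) (j : int) : F5 :=
  if (i <= 3)%N then z1X j * z_ i * z1X (- (j + 1))%R
  else z1X j * z_ i * z1X (- (j - 1))%R.

(* The index (i, j) with i : 'I_4 stands for alpha_{i+2, j}. *)
Definition alpha_ix (ij : 'I_4 * int) : F5 := alpha ij.1.+2 ij.2.

Definition L : groupType := gen_group (range alpha_ix).

Definition alphaL (ij : 'I_4 * int) : L := gen_in (imageT alpha_ix ij).

Definition F2 : groupType := free_group bool.
Definition gen_u : F2 := free_gen true.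
Definition gen_v : F2 := free_gen false.

(* The prescribed value of u alpha_{i,j} u^-1 if s = t_ and rho = R_, and that of
   v alpha_{i,j} v^-1 if s = w_ and rho = S_. *)
Definition alpha_conj (s : nat -> F5) (rho : int -> F5) (i : nat) (j : int) : F5 :=
  if (i <= 3)%N then (rho j)^-1 * z1X j * s i * (s 1%N)^-1 * z1X (- j)%R * rho j
  else (rho j)^-1 * z1X j * s i * s 1%N * z1X (- j)%R * rho j.

(* Main.v *)
(* Stereographic projection from x_1, followed by the translation sending the
   image of x_2 to the origin, turns a configuration into four distinct points
   of the plane, one of which, the origin, is marked. The braid group in
   question is therefore the stabilizer of a position under B_4 -> S_4.

   B_4 is modelled by F_2(c, w) >< (F_2(u, v) >< Z), and this is related to the
   fundamental group as follows. For each order C of the four points, the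
   configurations such that b - a is not in ]-oo, 0] whenever a precedes b in C
   form a chart, star-shaped around a configuration on the real line. Sorting C
   according to imaginary parts gives an element of B_4; these elements define a
   holonomy pi_1 -> B_4. Conversely the loops changing from one chart to another
   satisfy the braid relations, hence a homomorphism from B_4 to the wreath
   product of pi_1 with S_4; it inverts the holonomy up to conjugation.

   In the model, the stabilizer of the last position is F_5 >< (F_2(u, v) >< Z),
   where F_5 is a subgroup of index 4 of F_2(c, w). Its derived subgroup is cut
   out by the vanishing of the degree on F_5 and of the exponent in Z, which
   leaves L >< F_2(u, v). *)
Require Import Defs.
From HB Require Import structures.
From mathcomp Require Import all_boot all_order perm all_algebra.
From mathcomp Require Import all_classical all_reals all_analysis homotopy.
From mathcomp Require Import zify ring lra.
Import Order.TTheory GRing.Theory Num.Theory numFieldNormedType.Exports.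
Local Open Scope classical_set_scope.
Local Open Scope group_scope.

Set Implicit Arguments.
Unset Strict Implicit.
Unset Printing Implicit Defensive.

(** * Free groups and semidirect products *)

(** No presentation of the fundamental group is derived and no covering space is lifted: the
    holonomy and the map back to loops are played against each other, [ev_mono] giving injectivity
    and [mono_ev] the image. The obstacle is that the order by imaginary parts jumps. The braid
    [rho C J] of a bubble sort is multiplicative only along triples in which no pair is exchanged
    and then exchanged back. Inside a chart C, a pair that the order by imaginary parts exchanges
    has distinct imaginary parts, hence stays exchanged nearby, so that near any configuration the
    transition [tau] is the coboundary of [rho C]. Multiplicativity itself is a finite check,
    because equality in the model is equality of reduced words. In the model, F_2(c, w) is the
    kernel of B_4 -> B_3, s_3 |-> s_1, and F_2(u, v) is the derived subgroup of B_3. The images of c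
    and w in S_4 generate the Klein four-group, simply transitive on the positions, while u, v and s
    fix the last one: this is why the stabilizer meets F_2(c, w) in a subgroup of index 4, of rank 5
    by Schreier's formula. *)

Section Homs.
Context (G H : groupType) (f : G -> H).
Hypothesis fM : {morph f : x y / x * y}.

Lemma hom1 : f 1 = 1.
Proof. by apply: (@mulgI _ (f 1)); rewrite -fM !mulg1. Qed.

Lemma homV x : f x^-1 = (f x)^-1.
Proof. by apply: (@mulgI _ (f x)); rewrite -fM !mulgV hom1. Qed.

End Homs.

Section FreeGroups.
Context (T : choiceType).
Local Notation F := (free_group T).

Definition letter (a : T * bool) : F :=
  if a.2 then (free_gen a.1)^-1 else free_gen a.1.

Lemma letter_mulE a (x : F) : word (letter a * x) = push a (word x).
Proof. by case: a => y []. Qed.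

Lemma push_eq a (w : seq (T * bool)) : reduced (a :: w) -> push a w = a :: w.
Proof. by case: w => //= b w /andP[/negbTE->]. Qed.

Lemma free_ind (P : F -> Prop) :
  P 1 -> (forall a x, P x -> P (letter a * x)) -> forall x, P x.
Proof.
move=> P1 PM [w rw]; elim: w rw => [|a w IH] raw.
  by have -> : FreeGroup raw = 1 by apply/val_inj.
have rw : reduced w by exact: path_sorted raw.
have -> : FreeGroup raw = letter a * FreeGroup rw.
  by apply/val_inj; rewrite -[RHS]/(word (letter a * FreeGroup rw)) letter_mulE push_eq.
exact/PM/IH.
Qed.

Section Lift.
Context (G : groupType) (f : T -> G).

Definition letter_lift (a : T * bool) : G := if a.2 then (f a.1)^-1 else f a.1.

(** The product as a fold, in which form [vm_compute] evaluates it. *)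
Definition fold_lift (x : F) : G :=
  foldr (fun a g => letter_lift a * g) 1 (word x).

Lemma free_liftE x : free_lift f x = fold_lift x.
Proof.
rewrite /free_lift /fold_lift; elim: (word x) => [|a w IH]; first by rewrite big_nil.
by rewrite big_cons IH.
Qed.

Lemma letter_liftV a : letter_lift (letter_inv a) = (letter_lift a)^-1.
Proof. by case: a => x []; rewrite /letter_lift //= invgK. Qed.

Lemma free_lift_letterM a x : free_lift f (letter a * x) = letter_lift a * free_lift f x.
Proof.
rewrite !free_liftE /fold_lift letter_mulE; case: (word x) => //= b w.
by case: eqP => //= ->; rewrite letter_liftV mulVKg.
Qed.

Lemma free_lift1 : free_lift f 1 = 1.
Proof. by rewrite free_liftE. Qed.

Lemma free_lift_morph : {morph free_lift f : x y / x * y}.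
Proof.
move=> x y; elim/free_ind: x => [|a x IH]; first by rewrite mul1g free_lift1 mul1g.
by rewrite -mulgA !free_lift_letterM IH mulgA.
Qed.

Lemma free_lift_letter a : free_lift f (letter a) = letter_lift a.
Proof. by rewrite -[letter a]mulg1 free_lift_letterM free_lift1 mulg1. Qed.

Lemma free_lift_gen t : free_lift f (free_gen t) = f t.
Proof. exact: (free_lift_letter (t, false)). Qed.

End Lift.

Lemma hom_letter (G : groupType) (g : F -> G) : {morph g : x y / x * y} ->
  forall a, g (letter a) = letter_lift (fun t => g (free_gen t)) a.
Proof. by move=> gM [t []]; rewrite /letter /letter_lift //= homV. Qed.

Lemma hom_free_lift (G : groupType) (g : F -> G) : {morph g : x y / x * y} ->
  forall x, g x = free_lift (fun t => g (free_gen t)) x.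
Proof.
move=> gM; elim/free_ind=> [|a x IH]; first by rewrite free_lift1 hom1.
by rewrite gM IH free_lift_letterM hom_letter.
Qed.

Lemma free_hom_ext (G : groupType) (g h : F -> G) :
  {morph g : x y / x * y} -> {morph h : x y / x * y} ->
  (forall t, g (free_gen t) = h (free_gen t)) -> forall x, g x = h x.
Proof.
move=> gM hM gh x; rewrite (hom_free_lift gM) (hom_free_lift hM).
by congr (free_lift _ x); apply/funext.
Qed.

Section FreeAction.
Context (N : groupType) (e : T * bool -> N -> N).
Hypothesis eM : forall a, {morph e a : x y / x * y}.
Hypothesis eK : forall a n, e (letter_inv a) (e a n) = n.

Definition free_act_fun (q : F) (n : N) : N := foldr e n (word q).

Lemma free_act_letterM a q n : free_act_fun (letter a * q) n = e a (free_act_fun q n).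
Proof.
rewrite /free_act_fun letter_mulE; case: (word q) => //= b w.
by case: eqP => //= ->; rewrite -{1}(letter_invK a) eK.
Qed.

Lemma free_act1 n : free_act_fun 1 n = n. Proof. by []. Qed.

Lemma free_actM q r n :
  free_act_fun (q * r) n = free_act_fun q (free_act_fun r n).
Proof.
elim/free_ind: q => [|a q IH]; first by rewrite mul1g free_act1.
by rewrite -mulgA !free_act_letterM IH.
Qed.

Lemma free_actMr q n m :
  free_act_fun q (n * m) = free_act_fun q n * free_act_fun q m.
Proof.
elim/free_ind: q => [|a q IH]; first by rewrite !free_act1.
by rewrite !free_act_letterM IH eM.
Qed.

Definition free_action : group_action F N :=
  GroupAction free_act1 free_actM free_actMr.

Lemma free_action_letter a n : free_action (letter a) n = e a n.
Proof. by rewrite /= -[letter a]mulg1 free_act_letterM free_act1. Qed.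

End FreeAction.

(* Reading a letter in a state outputs an element of G and changes the state. *)
Section Transducer.
Context (St : Type) (G : groupType).
Context (next : T * bool -> St -> St) (out : T * bool -> St -> G).
Hypothesis nextK : forall a s, next (letter_inv a) (next a s) = s.
Hypothesis outV : forall a s, out (letter_inv a) (next a s) = (out a s)^-1.

Fixpoint run_word (w : seq (T * bool)) (s : St) : G :=
  if w is a :: w' then out a s * run_word w' (next a s) else 1.

Definition run (x : F) (s : St) : G := run_word (word x) s.
Definition final (x : F) (s : St) : St := foldl (fun s a => next a s) s (word x).

Lemma final_letterM a x s : final (letter a * x) s = final x (next a s).
Proof.
rewrite /final letter_mulE; case: (word x) => //= b w.
by case: eqP => //= ->; rewrite nextK.
Qed.

Lemma run_letterM a x s : run (letter a * x) s = out a s * run x (next a s).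
Proof.
rewrite /run letter_mulE; case: (word x) => //= b w.
by case: eqP => //= ->; rewrite nextK outV mulVKg.
Qed.

Lemma finalM x y s : final (x * y) s = final y (final x s).
Proof.
elim/free_ind: x s => [|a x IH] s; first by rewrite mul1g.
by rewrite -mulgA !final_letterM IH.
Qed.

Lemma runM x y s : run (x * y) s = run x s * run y (final x s).
Proof.
elim/free_ind: x s => [|a x IH] s; first by rewrite !mul1g.
by rewrite -mulgA !run_letterM final_letterM IH mulgA.
Qed.

End Transducer.

End FreeGroups.

Section SemidirectLift.
Context (Q N W : groupType) (phi : group_action Q N).
Context (f : N -> W) (g : Q -> W).
Hypothesis fM : {morph f : x y / x * y}.
Hypothesis gM : {morph g : x y / x * y}.
Hypothesis compat : forall q n, f (phi q n) = g q * f n * (g q)^-1.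

Definition sd_lift (x : sdprod_group phi) : W := f x.1 * g x.2.

Lemma sd_lift_morph : {morph sd_lift : x y / x * y}.
Proof.
by case=> n q [m r]; rewrite /sd_lift /= fM gM compat !mulgA mulgVK.
Qed.

End SemidirectLift.

Lemma sd_mulE (Q N : groupType) (phi : group_action Q N) (x y : sdprod_group phi) :
  x * y = (x.1 * phi x.2 y.1, x.2 * y.2).
Proof. by []. Qed.

Lemma sd_invE (Q N : groupType) (phi : group_action Q N) (x : sdprod_group phi) :
  x^-1 = (phi x.2^-1 x.1^-1, x.2^-1).
Proof. by []. Qed.

Section SemidirectInjections.
Context (Q N : groupType) (phi : group_action Q N).

Definition sd_inl (n : N) : sdprod_group phi := (n, 1).
Definition sd_inr (q : Q) : sdprod_group phi := (1, q).

Lemma sd_inl_morph : {morph sd_inl : x y / x * y}.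
Proof. by move=> x y; rewrite sd_mulE /= gact1 mulg1. Qed.

Lemma sd_inr_morph : {morph sd_inr : x y / x * y}.
Proof. by move=> x y; rewrite sd_mulE /= gact_1r mulg1. Qed.

Lemma sd_inE (x : sdprod_group phi) : x = sd_inl x.1 * sd_inr x.2.
Proof. by case: x => n q; rewrite sd_mulE /= gact1 mulg1 mul1g. Qed.

Lemma sd_in_conj q n : sd_inr q * sd_inl n * (sd_inr q)^-1 = sd_inl (phi q n).
Proof.
apply: (mulIg (sd_inr q)); rewrite mulgVK !sd_mulE /=.
by rewrite gact_1r !mulg1 !mul1g.
Qed.

End SemidirectInjections.

(** Equivariance passes from a generator to its inverse by conjugating the equation back, hence to
    all words. *)
Lemma conj_free (T : choiceType) (N W : groupType)
    (phi : group_action (free_group T) N) (f : N -> W) (g : free_group T -> W) :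
  {morph g : x y / x * y} ->
  (forall t n, f (phi (free_gen t) n) = g (free_gen t) * f n * (g (free_gen t))^-1) ->
  forall q n, f (phi q n) = g q * f n * (g q)^-1.
Proof.
move=> gM H q; elim/free_ind: q => [|a q IH] n.
  by rewrite gact1 (hom1 gM) invg1 mul1g mulg1.
rewrite gactM gM; have HL m : f (phi (letter a) m) = g (letter a) * f m * (g (letter a))^-1.
  case: a => t []; last exact: H.
  rewrite -[letter _]/((free_gen t)^-1) (homV gM) invgK.
  apply: (@mulgI _ (g (free_gen t))); apply: (@mulIg _ (g (free_gen t))^-1).
  by rewrite -H -gactM mulgV gact1 !mulgA mulgV mul1g mulgK.
by rewrite HL IH invgM !mulgA.
Qed.

Section SemidirectAction.
Context (M P N : groupType) (phi : group_action M P).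
Context (aM : group_action M N) (aP : group_action P N).
Hypothesis compat : forall m p n, aM m (aP p n) = aP (phi m p) (aM m n).
Local Notation G := (sdprod_group phi).

Definition sd_action_fun (x : G) (n : N) : N := aP x.1 (aM x.2 n).

Lemma sd_action1 n : sd_action_fun 1 n = n.
Proof. by rewrite /sd_action_fun /= !gact1. Qed.

Lemma sd_actionM x y n : sd_action_fun (x * y) n = sd_action_fun x (sd_action_fun y n).
Proof. by rewrite /sd_action_fun sd_mulE /= !gactM compat. Qed.

Lemma sd_actionMr x n m : sd_action_fun x (n * m) = sd_action_fun x n * sd_action_fun x m.
Proof. by rewrite /sd_action_fun !gactMr. Qed.

Definition sd_action : group_action G N :=
  GroupAction sd_action1 sd_actionM sd_actionMr.

End SemidirectAction.

Lemma action_inj (Q N : groupType) (a : group_action Q N) q : injective (a q).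
Proof.
move=> n m /(congr1 (a q^-1)).
by rewrite -!gactM mulVg !gact1.
Qed.

(** Reduces the hypothesis of [sd_action] to pairs of generators; the inverse generators follow
    because each element acts injectively. *)
Lemma compat_free (S T : choiceType) (N : groupType)
    (phi : group_action (free_group S) (free_group T))
    (aM : group_action (free_group S) N) (aP : group_action (free_group T) N) :
  (forall s t n, aM (free_gen s) (aP (free_gen t) n) =
     aP (phi (free_gen s) (free_gen t)) (aM (free_gen s) n)) ->
  forall m p n, aM m (aP p n) = aP (phi m p) (aM m n).
Proof.
move=> H.
have Hgen s p n : aM (free_gen s) (aP p n) = aP (phi (free_gen s) p) (aM (free_gen s) n).
  elim/free_ind: p n => [|a p IH] n; first by rewrite gact_1r !gact1.
  rewrite gactM gactMr gactM -IH; move: (aP p n) => {IH p} {}n.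
  case: a => t []; last exact: H.
  rewrite -[letter _]/((free_gen t)^-1) (homV (gactMr _ _)).
  by apply: (@action_inj _ _ aP (phi (free_gen s) (free_gen t)));
    rewrite -H -!gactM !mulgV !gact1.
move=> m; elim/free_ind: m => [|a m IH] p n; first by rewrite !gact1.
rewrite !gactM IH; move: (aM m n) (phi m p) => {IH m p} {}n p.
case: a => s []; last exact: Hgen.
rewrite -[letter _]/((free_gen s)^-1).
by apply: (@action_inj _ _ aM (free_gen s)); rewrite Hgen -!gactM !mulgV !gact1.
Qed.

Section EndoAction.
Context (S T : choiceType) (im : S * bool -> T -> free_group T).
Hypothesis imK : forall a t,
  free_lift (im (letter_inv a)) (im a t) = free_gen t.

Lemma endo_actionK a n :
  free_lift (im (letter_inv a)) (free_lift (im a) n) = n.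
Proof.
apply: (@free_hom_ext _ _ (fun n => free_lift (im (letter_inv a)) (free_lift (im a) n)) id) => //.
  by move=> x y; rewrite !free_lift_morph.
by move=> t; rewrite free_lift_gen imK.
Qed.

Definition endo_action : group_action (free_group S) (free_group T) :=
  free_action (fun a => @free_lift_morph _ _ (im a)) endo_actionK.

Lemma endo_action_letter a n : endo_action (letter a) n = free_lift (im a) n.
Proof. exact: free_action_letter. Qed.

Lemma endo_action_gen s n : endo_action (free_gen s) n = free_lift (im (s, false)) n.
Proof. exact: (endo_action_letter (s, false)). Qed.

Definition fold_action (q : free_group S) (n : free_group T) : free_group T :=
  foldr (fun a m => fold_lift (im a) m) n (word q).

Lemma endo_actionE q n : endo_action q n = fold_action q n.
Proof.
rewrite /= /free_act_fun /fold_action.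
by elim: (word q) => //= a w ->; rewrite free_liftE.
Qed.

End EndoAction.

Ltac fg_compute := rewrite ?free_liftE; apply/val_inj; vm_compute; reflexivity.

(* The model of the braid group on four strings with generators s_1, s_2, s_3:
   s = s_1, u = s_2 s_1^-1, v = s_1 s_2 s_1^-2, c = s_3 s_1^-1 and
   w = s_2 s_3 s_1^-1 s_2^-1. *)
Definition FZ : groupType := free_group unit.
Definition Fcw : groupType := free_group bool.
Definition gen_s : FZ := free_gen tt.
Definition gen_c : Fcw := free_gen true.
Definition gen_w : Fcw := free_gen false.

(** This and the next two families of formulas are conjugations in B_4, written in the letters u, v,
    c, w. The flag of the letter [a] selects conjugation by s, u or v, or by its inverse. *)
Definition im_s_uv (a : unit * bool) (t : bool) : F2 :=
  if a.2 then (if t then gen_u * gen_v^-1 else gen_u)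
  else (if t then gen_v else gen_u^-1 * gen_v).

Definition im_s_cw (a : unit * bool) (t : bool) : Fcw :=
  if t then gen_c else if a.2 then gen_c * gen_w else gen_c^-1 * gen_w.

Definition im_uv_cw (a : bool * bool) (t : bool) : Fcw :=
  match a with
  | (true, false) => if t then gen_w else gen_w * gen_w * gen_c^-1 * gen_w
  | (true, true) => if t then gen_c * gen_w^-1 * gen_c * gen_c else gen_c
  | (false, false) => if t then gen_c^-1 * gen_w
     else (gen_c^-1 * gen_w) ^+ 3 * gen_c ^- 2 * gen_w
  | (false, true) => gen_c * gen_w^-1 * gen_c ^+ (if t then 3 else 4)
  end.

Lemma im_s_uvK a t : free_lift (im_s_uv (letter_inv a)) (im_s_uv a t) = free_gen t.
Proof. by case: a t => [[] []] []; fg_compute. Qed.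

Lemma im_s_cwK a t : free_lift (im_s_cw (letter_inv a)) (im_s_cw a t) = free_gen t.
Proof. by case: a t => [[] []] []; fg_compute. Qed.

Lemma im_uv_cwK a t : free_lift (im_uv_cw (letter_inv a)) (im_uv_cw a t) = free_gen t.
Proof. by case: a t => [[] []] []; fg_compute. Qed.

Definition act_s_uv : group_action FZ F2 := endo_action im_s_uvK.
Definition act_s_cw : group_action FZ Fcw := endo_action im_s_cwK.
Definition act_uv_cw : group_action F2 Fcw := endo_action im_uv_cwK.

Definition B3 : groupType := sdprod_group act_s_uv.

Lemma act_compat m p n : act_s_cw m (act_uv_cw p n) = act_uv_cw (act_s_uv m p) (act_s_cw m n).
Proof.
apply: compat_free => -[] t; apply: free_hom_ext => [x y|x y|r].
- by rewrite !gactMr.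
- by rewrite !gactMr.
- rewrite !endo_action_gen !free_lift_gen (endo_actionE im_uv_cwK) free_liftE.
  by case: t; case: r; fg_compute.
Qed.

Definition act_B3_cw : group_action B3 Fcw := sd_action act_compat.

Definition BB : groupType := sdprod_group act_B3_cw.

Definition sigma1 : BB := (1, (1, gen_s)).
Definition sigma2 : BB := (1, (gen_u, gen_s)).
Definition sigma3 : BB := (gen_c, (1, gen_s)).

(** * The universal property of the braid group *)

Section Universal.
Context (W : groupType) (s1 s2 s3 : W).
Hypothesis br12 : s1 * s2 * s1 = s2 * s1 * s2.
Hypothesis br23 : s2 * s3 * s2 = s3 * s2 * s3.
Hypothesis br13 : s1 * s3 = s3 * s1.

Let c := s3 * s1^-1.
Let w := s2 * c * s2^-1.
Let u := s2 * s1^-1.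
Let v := s1 * u * s1^-1.

Let br12V : s2^-1 * s1 * s2 = s1 * s2 * s1^-1.
Proof. by apply: (mulgI s2); apply: (mulIg s1); rewrite !gnorm br12. Qed.
Let br21V : s1^-1 * s2^-1 * s1 = s2 * s1^-1 * s2^-1.
Proof.
by apply: invg_inj; apply: (mulgI s1); apply: (mulIg s2); rewrite !gnorm br12.
Qed.
Let br23V : s3^-1 * s2 * s3 = s2 * s3 * s2^-1.
Proof. by apply: (mulgI s3); apply: (mulIg s2); rewrite !gnorm br23. Qed.
Let br13V : s1^-1 * s3 = s3 * s1^-1.
Proof. by apply: (mulgI s1); apply: (mulIg s1); rewrite !gnorm br13. Qed.
Lemma braid_conj_sv : s1 * v * s1^-1 = u^-1 * v.
Proof.
rewrite /v /u; apply: (mulIg (s1 * s1)); apply: (mulgI s1^-1); rewrite !gnorm.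
by rewrite -?br12V ?gnorm.
Qed.

Lemma braid_conj_sc : s1 * c * s1^-1 = c.
Proof. by rewrite /c !mulgA br13 !gnorm. Qed.

Lemma braid_conj_uc : u * c * u^-1 = w.
Proof. by rewrite /w /u /c !gnorm -(mulgA s2 s1^-1 s3) br13V !mulgA. Qed.

Lemma braid_conj_sw : s1 * w * s1^-1 = c^-1 * w.
Proof.
rewrite /w /c invgM invgK !mulgA.
have -> : s1 * s3^-1 * s2 * s3 * s1^-1 * s2^-1 =
          s1 * (s3^-1 * s2 * s3) * s1^-1 * s2^-1 by rewrite !mulgA.
rewrite br23V; apply: (mulgI s1^-1); rewrite !gnorm; apply: (mulgI (s2 * s3)^-1).
rewrite !gnorm; apply: invg_inj; rewrite !gnorm.
by rewrite br12.
Qed.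

Lemma braid_conj_uw : u * w * u^-1 = w * w * c^-1 * w.
Proof.
(* By [braid_conj_sw] the tail c^-1 w is a conjugate of w, which leaves a shorter identity between
   words in s_1, s_2, s_3. *)
have -> : w * w * c^-1 * w = w * w * (s1 * w * s1^-1) by rewrite braid_conj_sw !mulgA.
rewrite /w /u; apply: (mulgI s2^-1); rewrite !gnorm.
have -> : s1^-1 * s2 * s3 * s1^-1 * s2^-1 * s1 * s2^-1 =
    s1^-1 * s2 * s3 * (s1^-1 * s2^-1 * s1) * s2^-1 by rewrite !mulgA.
have -> : s3 * s1^-1 * s3 * s1^-1 * s2^-1 * s1 * s2 * s3 * s1^-1 * s2^-1 * s1^-1 =
    s3 * (s1^-1 * s3) * s1^-1 * (s2^-1 * s1 * s2) * s3 * s1^-1 * s2^-1 * s1^-1.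
  by rewrite !mulgA.
rewrite br21V br12V br13V !gnorm.
rewrite -(mulgA _ s1^-1 s3) br13V !mulgA.
have -> : s3 * s3 * s1^-1 = s1^-1 * s3 * s3 by rewrite br13V -(mulgA s3 s1^-1) br13V !mulgA.
have -> : s1^-1 * s2 * s3 * s2 = s1^-1 * s3 * s2 * s3.
  by rewrite -(mulgA _ s2 s3) -mulgA br23 !mulgA.
have -> : s1^-1 * s3 * s3 * s2 * s3 = s1^-1 * s3 * s2 * s3 * s2.
  by rewrite -(mulgA _ s3 s2) -(mulgA _ (s3 * s2)) -br23 !mulgA.
rewrite -!(mulgA (s1^-1 * s3 * s2 * s3)); congr (_ * _).
apply: invg_inj; rewrite !gnorm; apply: (mulIg s2); rewrite !gnorm.
by rewrite -(mulgA s2 s2) -(mulgA s2 (s2 * s1)) -br12 !mulgA -br12.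
Qed.

Definition braid_uv (q : F2) : W := free_lift (fun t => if t then u else v) q.
Definition braid_cw (n : Fcw) : W := free_lift (fun t => if t then c else w) n.
Definition braid_s (m : FZ) : W := free_lift (fun=> s1) m.

Let sE : braid_s gen_s = s1. Proof. exact: free_lift_gen. Qed.
Let uE : braid_uv gen_u = u. Proof. exact: free_lift_gen. Qed.
Let vE : braid_uv gen_v = v. Proof. exact: free_lift_gen. Qed.
Let cE : braid_cw gen_c = c. Proof. exact: free_lift_gen. Qed.
Let wE : braid_cw gen_w = w. Proof. exact: free_lift_gen. Qed.
Let uvM : {morph braid_uv : x y / x * y}. Proof. exact: free_lift_morph. Qed.
Let cwM : {morph braid_cw : x y / x * y}. Proof. exact: free_lift_morph. Qed.
Let sM : {morph braid_s : x y / x * y}. Proof. exact: free_lift_morph. Qed.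

Let conjM (x : W) : {morph (fun y => x * y * x^-1) : y z / y * z}.
Proof. by move=> y z; rewrite !mulgA mulgVK. Qed.

Lemma braid_s_uv m q : braid_uv (act_s_uv m q) = braid_s m * braid_uv q * (braid_s m)^-1.
Proof.
move: m q; apply: (conj_free sM) => -[] n.
apply: (@free_hom_ext _ _ (fun n => braid_uv (act_s_uv (free_gen tt) n))
  (fun n => braid_s (free_gen tt) * braid_uv n * (braid_s (free_gen tt))^-1)).
- by move=> x y; rewrite gactMr uvM.
- by move=> x y; rewrite uvM conjM.
- move=> t; rewrite endo_action_gen free_lift_gen.
  rewrite -/gen_s sE; case: t.
    by rewrite -/gen_u uE vE.
  by rewrite -/gen_v vE uvM (homV uvM) uE vE braid_conj_sv.
Qed.

Lemma braid_s_cw m n : braid_cw (act_s_cw m n) = braid_s m * braid_cw n * (braid_s m)^-1.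
Proof.
move: m n; apply: (conj_free sM) => -[] n.
apply: (@free_hom_ext _ _ (fun n => braid_cw (act_s_cw (free_gen tt) n))
  (fun n => braid_s (free_gen tt) * braid_cw n * (braid_s (free_gen tt))^-1)).
- by move=> x y; rewrite gactMr cwM.
- by move=> x y; rewrite cwM conjM.
- move=> t; rewrite endo_action_gen free_lift_gen.
  rewrite -/gen_s sE; case: t.
    by rewrite -/gen_c cE braid_conj_sc.
  by rewrite -/gen_w wE cwM (homV cwM) cE wE braid_conj_sw.
Qed.

Lemma braid_uv_cw q n : braid_cw (act_uv_cw q n) = braid_uv q * braid_cw n * (braid_uv q)^-1.
Proof.
have Hu m : braid_cw (act_uv_cw gen_u m) = u * braid_cw m * u^-1.
  apply: (@free_hom_ext _ _ (fun n => braid_cw (act_uv_cw gen_u n))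
    (fun n => u * braid_cw n * u^-1)).
  - by move=> x y; rewrite gactMr cwM.
  - by move=> x y; rewrite cwM conjM.
  - move=> t; rewrite endo_action_gen free_lift_gen.
    case: t; first by rewrite -/gen_c cE wE braid_conj_uc.
    by rewrite -/gen_w wE !cwM (homV cwM) cE wE braid_conj_uw.
move: q n; apply: (conj_free uvM) => t n.
case: t; first by rewrite -/gen_u uE Hu.
rewrite -/gen_v vE.
(* As v is the image of u under s, the compatibility of the actions reduces v to u and spares the
   long words of its own action. *)
have -> : n = act_s_cw gen_s (act_s_cw gen_s^-1 n) by rewrite -gactM mulgV gact1.
have -> : gen_v = act_s_uv gen_s gen_u by rewrite endo_action_gen free_lift_gen.
rewrite -act_compat !braid_s_cw Hu braid_s_cw (homV sM) sE /v.
by rewrite !gnorm.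
Qed.

Definition braid_B3 : B3 -> W := sd_lift (phi := act_s_uv) braid_uv braid_s.

Lemma braid_B3M : {morph braid_B3 : x y / x * y}.
Proof. exact: sd_lift_morph uvM sM braid_s_uv. Qed.

Lemma braid_B3_cw (q : B3) n :
  braid_cw (act_B3_cw q n) = braid_B3 q * braid_cw n * (braid_B3 q)^-1.
Proof.
by case: q => q m; rewrite /= /sd_action_fun braid_uv_cw braid_s_cw /braid_B3 /sd_lift !gnorm.
Qed.

Definition braid_hom : BB -> W := sd_lift (phi := act_B3_cw) braid_cw braid_B3.

Lemma braid_homM : {morph braid_hom : x y / x * y}.
Proof. exact: sd_lift_morph cwM braid_B3M braid_B3_cw. Qed.

Let cw1 : braid_cw 1 = 1. Proof. exact: hom1. Qed.
Let uv1 : braid_uv 1 = 1. Proof. exact: hom1. Qed.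

Lemma braid_hom1 : braid_hom sigma1 = s1.
Proof. by rewrite /braid_hom /sd_lift /= cw1 /braid_B3 /sd_lift /= uv1 !mul1g. Qed.

Lemma braid_hom2 : braid_hom sigma2 = s2.
Proof.
by rewrite /braid_hom /sd_lift /= cw1 mul1g /braid_B3 /sd_lift /= sE uE mulgVK.
Qed.

Lemma braid_hom3 : braid_hom sigma3 = s3.
Proof.
by rewrite /braid_hom /sd_lift /= cE /braid_B3 /sd_lift /= uv1 mul1g sE mulgVK.
Qed.

End Universal.

Definition in_cw (n : Fcw) : BB := sd_inl act_B3_cw n.
Definition in_uv (q : F2) : BB := sd_inr act_B3_cw (sd_inl act_s_uv q).
Definition in_s (m : FZ) : BB := sd_inr act_B3_cw (sd_inr act_s_uv m).

Lemma in_cwM : {morph in_cw : x y / x * y}.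
Proof. exact: sd_inl_morph. Qed.
Lemma in_uvM : {morph in_uv : x y / x * y}.
Proof. by move=> x y; rewrite /in_uv sd_inl_morph sd_inr_morph. Qed.
Lemma in_sM : {morph in_s : x y / x * y}.
Proof. by move=> x y; rewrite /in_s sd_inr_morph sd_inr_morph. Qed.

Lemma in_BBE (x : BB) : x = in_cw x.1 * in_uv x.2.1 * in_s x.2.2.
Proof.
rewrite [LHS]sd_inE -mulgA -sd_inr_morph; congr (_ * sd_inr _ _).
exact: sd_inE.
Qed.

Lemma sigma2E : sigma2 = in_uv gen_u * sigma1.
Proof. rewrite -[sigma1]/(in_s gen_s) -sd_inr_morph; congr (sd_inr _ _).
exact: sd_inE. Qed.

Lemma sigma3E : sigma3 = in_cw gen_c * sigma1.
Proof. exact: sd_inE. Qed.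

Lemma conj_s_uv m q : in_s m * in_uv q * (in_s m)^-1 = in_uv (act_s_uv m q).
Proof. by rewrite /in_s /in_uv -(homV (@sd_inr_morph _ _ _)) -!sd_inr_morph sd_in_conj. Qed.

Lemma conj_uv_cw q n : in_uv q * in_cw n * (in_uv q)^-1 = in_cw (act_uv_cw q n).
Proof. by rewrite /in_uv /in_cw sd_in_conj; congr (sd_inl _ _). Qed.

(** The three sigmas generate: u and c are quotients of two of them, v = s u s^-1 and w = u c
    u^-1. *)
Lemma BB_ind (P : BB -> Prop) : P sigma1 -> P sigma2 -> P sigma3 ->
  (forall x y, P x -> P y -> P (x * y)) -> (forall x, P x -> P x^-1) ->
  forall x, P x.
Proof.
move=> P1 P2 P3 PM PV.
have P11 : P 1 by rewrite -(mulgV sigma1); exact/PM/PV.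
have Pfree (T : choiceType) (g : free_group T -> BB) :
    {morph g : x y / x * y} -> (forall t, P (g (free_gen t))) -> forall x, P (g x).
  move=> gM Pg; elim/free_ind=> [|[t b] x IH]; first by rewrite (hom1 gM).
  rewrite gM; apply: (PM) IH; rewrite hom_letter // /letter_lift /=.
  by case: b => //; exact: PV.
have Pu : P (in_uv gen_u).
  by rewrite -[in_uv _](mulgK sigma1) -sigma2E; exact/PM/PV.
have Pc : P (in_cw gen_c).
  by rewrite -[in_cw _](mulgK sigma1) -sigma3E; exact/PM/PV.
have Pv : P (in_uv gen_v).
  have -> : gen_v = act_s_uv gen_s gen_u by rewrite endo_action_gen free_lift_gen.
  by rewrite -conj_s_uv; apply: (PM) (PV _ _); first exact: PM.
have Pw : P (in_cw gen_w).
  have -> : gen_w = act_uv_cw gen_u gen_c by rewrite endo_action_gen free_lift_gen.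
  by rewrite -conj_uv_cw; apply: (PM) (PV _ _); first exact: PM.
move=> x; rewrite (in_BBE x); apply: (PM); first apply: (PM).
- by apply: (Pfree _ in_cw in_cwM) => -[].
- by apply: (Pfree _ in_uv in_uvM) => -[].
- by apply: (Pfree _ in_s in_sM) => -[].
Qed.

(* Unlike the group structure of BB, this form can be evaluated. *)
Definition BB_mul (x y : BB) : BB :=
  (x.1 * fold_action im_uv_cw x.2.1 (fold_action im_s_cw x.2.2 y.1),
   (x.2.1 * fold_action im_s_uv x.2.2 y.2.1, x.2.2 * y.2.2)).

Lemma BB_mulE x y : x * y = BB_mul x y.
Proof.
by rewrite /BB_mul -!(endo_actionE im_uv_cwK, endo_actionE im_s_cwK, endo_actionE im_s_uvK).
Qed.

(** Forgets the proofs of reducedness, so that equality in the model becomes a computable comparison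
    of words. *)
Definition BB_word (x : BB) := (word x.1, word x.2.1, word x.2.2).

Lemma BB_word_inj : injective BB_word.
Proof.
by case=> n [q m] [n' [q' m']] [] /val_inj-> /val_inj-> /val_inj->.
Qed.

(** * The subgroup of index 4 *)

(* F_5 is the subgroup of index 4 of Fcw formed by the elements of even degree
   both in c and in w. In the basis chosen here, the restrictions of the actions
   of u and v are given by the t_i and the w_i. *)
Definition emb_gen (i : nat) : Fcw :=
  match i with
  | 0 => gen_c * gen_c
  | 1 => gen_w * gen_w
  | 2 => gen_c * gen_w * (gen_c * gen_w)
  | 3 => gen_w * gen_c * gen_c * gen_w^-1
  | _ => gen_c * gen_w * gen_w * gen_c^-1
  end.

Definition emb (x : F5) : Fcw := free_lift (fun i : 'I_5 => emb_gen i) x.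

Lemma embM : {morph emb : x y / x * y}. Proof. exact: free_lift_morph. Qed.

Lemma emb_z i : (i < 5)%N -> emb (z_ i.+1) = emb_gen i.
Proof. by move=> i5; rewrite /emb /z_ free_lift_gen inordK. Qed.

Lemma F5_letterE (i : 'I_5) : free_gen i = z_ i.+1 :> F5.
Proof. by rewrite /z_ /= inord_val. Qed.

(* The right cosets of emb F_5 are represented by 1, c, w and cw: the state
   (p, q) stands for c^p w^q. *)
Definition coset_rep (s : bool * bool) : Fcw :=
  (if s.1 then gen_c else 1) * (if s.2 then gen_w else 1).

Definition coset_next (a : bool * bool) (s : bool * bool) : bool * bool :=
  if a.1 then (~~ s.1, s.2) else (s.1, ~~ s.2).

(** Reidemeister-Schreier rewriting: if r represents the state and r' the next one, the output is r
    a r'^-1 expressed in the z_i. *)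
Definition coset_out_pos (a : bool) (s : bool * bool) : F5 :=
  match a, s with
  | true, (false, false) => 1
  | true, (true, false) => z_ 1
  | true, (false, true) => z_ 4 * z_ 2 * (z_ 3)^-1
  | true, (true, true) => z_ 3 * (z_ 2)^-1
  | false, (false, false) => 1
  | false, (true, false) => 1
  | false, (false, true) => z_ 2
  | false, (true, true) => z_ 5
  end.

Definition coset_out (a : bool * bool) (s : bool * bool) : F5 :=
  if a.2 then (coset_out_pos a.1 (coset_next a s))^-1 else coset_out_pos a.1 s.

Lemma coset_nextK a s : coset_next (letter_inv a) (coset_next a s) = s.
Proof. by case: a s => [[] []] [[] []]. Qed.

Lemma coset_outV a s : coset_out (letter_inv a) (coset_next a s) = (coset_out a s)^-1.
Proof.
case: a => a []; rewrite /coset_out ?invgK /=.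
  by congr coset_out_pos; case: a s => [] [[] []].
by congr (coset_out_pos _ _)^-1; case: a s => [] [[] []].
Qed.

Definition coset0 := (false, false).
(** Total, but inverse to [emb] only on the words that lead from [coset0] back to it. *)
Definition unemb (x : Fcw) : F5 := run coset_next coset_out x coset0.
Definition coset (x : Fcw) (s : bool * bool) := final coset_next x s.

Lemma cosetM x y s : coset (x * y) s = coset y (coset x s).
Proof. exact: finalM coset_nextK x y s. Qed.

Lemma unembM x y : coset x coset0 = coset0 -> unemb (x * y) = unemb x * unemb y.
Proof. by move=> xo; rewrite /unemb (runM coset_nextK coset_outV) -/(coset _ _) xo. Qed.

Lemma cosetV x : coset x coset0 = coset0 -> coset x^-1 coset0 = coset0.
Proof. by move=> xo; rewrite -{1}xo -cosetM mulgV. Qed.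

Lemma F5_ind (P : F5 -> Prop) :
  (forall i, (i < 5)%N -> P (z_ i.+1)) ->
  (forall x y, P x -> P y -> P (x * y)) -> (forall x, P x -> P x^-1) -> forall x, P x.
Proof.
move=> Pz PM PV.
have P1 : P 1 by rewrite -(mulgV (z_ 1)); apply: (PM); [|apply: (PV)]; exact: (Pz 0%N).
elim/free_ind=> [//|[i b] x Px]; apply: (PM) => //.
have Pi : P (free_gen i) by rewrite F5_letterE; exact/Pz/ltn_ord.
by case: b => //; exact: PV.
Qed.

Lemma coset_emb x : coset (emb x) coset0 = coset0.
Proof.
elim/F5_ind: x => [i i5|x y cx cy|x cx].
- rewrite emb_z //; move: i i5; do 5?[case=> //]; by vm_compute.
- by rewrite embM cosetM cx.
- by rewrite (homV embM) cosetV.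
Qed.

Lemma unemb_gen i : (i < 5)%N -> unemb (emb_gen i) = z_ i.+1.
Proof.
rewrite /unemb /run; move: i; do 5?[case]; last by [].
all: move=> _; match goal with |- run_word _ _ (word ?x) _ = _ =>
  let l := eval vm_compute in (word x) in
  have -> : word x = l by (vm_compute; reflexivity) end;
  by rewrite /= /coset_out /= !gnorm.
Qed.

Lemma unemb_emb x : unemb (emb x) = x.
Proof.
apply: (@free_hom_ext _ _ (fun x => unemb (emb x)) id) => // [y z|i].
  by rewrite embM unembM // coset_emb.
by rewrite F5_letterE emb_z ?unemb_gen ?ltn_ord.
Qed.

Lemma emb_inj : injective emb.
Proof. exact: can_inj unemb_emb. Qed.

(** The invariant of the rewriting, for an arbitrary starting state; with [coset0] at both ends it
    says that [emb] undoes [unemb]. *)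
Lemma coset_repM x s :
  coset_rep s * x = emb (run coset_next coset_out x s) * coset_rep (coset x s).
Proof.
elim/free_ind: x s => [|a x IH] s.
  by rewrite /run /coset /final /= (hom1 embM) mulg1 mul1g.
rewrite /coset (final_letterM coset_nextK) -/(coset _ _).
rewrite (run_letterM coset_nextK coset_outV) embM -[RHS]mulgA -IH [LHS]mulgA [RHS]mulgA.
congr (_ * x).
have pos b t : coset_rep t * free_gen b =
    emb (coset_out_pos b t) * coset_rep (coset_next (b, false) t).
  case: b t => [] [[] []] /=;
    rewrite ?embM ?(homV embM) ?(hom1 embM) ?emb_z //; fg_compute.
case: a => b []; last exact: pos.
(* An inverse letter is the positive letter read backwards, from the state [t] to which the inverse
   letter leads. *)
rewrite /coset_out /= (homV embM); set t := coset_next (b, true) s.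
have -> : s = coset_next (b, false) t by rewrite /t (coset_nextK (b, true)).
rewrite -[letter _]/((free_gen b)^-1).
by apply: (mulIg (free_gen b)); rewrite mulgVK -mulgA pos mulKg.
Qed.

Lemma emb_unemb x : coset x coset0 = coset0 -> emb (unemb x) = x.
Proof.
move=> xo; have := coset_repM x coset0.
by rewrite xo /coset_rep !mul1g !mulg1.
Qed.

Lemma coset_endo (im : bool -> Fcw) x :
  (forall i, (i < 5)%N -> coset (fold_lift im (emb_gen i)) coset0 = coset0) ->
  coset (free_lift im (emb x)) coset0 = coset0.
Proof.
move=> H; elim/F5_ind: x => [i i5|x y cx cy|x cx].
- by rewrite emb_z // free_liftE; exact: H.
- by rewrite embM free_lift_morph cosetM cx.
- by rewrite (homV embM) (homV (@free_lift_morph _ _ im)) cosetV.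
Qed.

Lemma coset_s m n : coset n coset0 = coset0 -> coset (act_s_cw m n) coset0 = coset0.
Proof.
elim/free_ind: m n => [|a m IH] n cn; first by rewrite gact1.
rewrite gactM endo_action_letter -(emb_unemb (IH n cn)).
by apply: coset_endo; case: a => [[] []]; do 5?[case=> //]; vm_compute.
Qed.

Lemma coset_uv q n : coset n coset0 = coset0 -> coset (act_uv_cw q n) coset0 = coset0.
Proof.
elim/free_ind: q n => [|a q IH] n cn; first by rewrite gact1.
rewrite gactM endo_action_letter -(emb_unemb (IH n cn)).
by apply: coset_endo; case: a => [[] []]; do 5?[case=> //]; vm_compute.
Qed.

Lemma coset_B3 (q : B3) n : coset n coset0 = coset0 -> coset (act_B3_cw q n) coset0 = coset0.
Proof. by case: q => q m cn; exact/coset_uv/coset_s. Qed.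

Definition act5_fun (q : B3) (n : F5) : F5 := unemb (act_B3_cw q (emb n)).

Lemma emb_act5 q n : emb (act5_fun q n) = act_B3_cw q (emb n).
Proof. by rewrite emb_unemb //; apply/coset_B3/coset_emb. Qed.

Lemma act5_1 n : act5_fun 1 n = n.
Proof. by rewrite /act5_fun gact1 unemb_emb. Qed.

Lemma act5_M q r n : act5_fun (q * r) n = act5_fun q (act5_fun r n).
Proof. by rewrite {1 2}/act5_fun gactM emb_act5. Qed.

Lemma act5_Mr q n m : act5_fun q (n * m) = act5_fun q n * act5_fun q m.
Proof. by rewrite /act5_fun embM gactMr unembM //; apply/coset_B3/coset_emb. Qed.

Definition act5 : group_action B3 F5 := GroupAction act5_1 act5_M act5_Mr.

Definition in3_uv (q : F2) : B3 := sd_inl act_s_uv q.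
Definition in3_s (m : FZ) : B3 := sd_inr act_s_uv m.

Lemma act5_uE x : act5 (in3_uv gen_u) x = unemb (free_lift (im_uv_cw (true, false)) (emb x)).
Proof. exact: (congr1 unemb (endo_action_gen im_uv_cwK true _)). Qed.

Lemma act5_vE x : act5 (in3_uv gen_v) x = unemb (free_lift (im_uv_cw (false, false)) (emb x)).
Proof. exact: (congr1 unemb (endo_action_gen im_uv_cwK false _)). Qed.

Lemma act5_sE x : act5 (in3_s gen_s) x = unemb (free_lift (im_s_cw (tt, false)) (emb x)).
Proof. exact: (congr1 unemb (endo_action_gen im_s_cwK tt _)). Qed.

(** The origin of the t_i: since [emb] is injective, each of them is pinned down by an identity of
    reduced words in c and w. *)
Lemma act5_u i : (i < 5)%N -> act5 (in3_uv gen_u) (z_ i.+1) = t_ i.+1.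
Proof.
move=> i5; rewrite act5_uE; apply: emb_inj; rewrite emb_unemb; last first.
  by apply: coset_endo; do 5?[case=> //]; vm_compute.
move: i i5; do 5?[case=> //]; move=> _; rewrite /t_ ?expgS ?expg0 ?mulg1 ?embM ?(homV embM) ?emb_z //.
all: fg_compute.
Qed.

Lemma act5_v i : (i < 5)%N -> act5 (in3_uv gen_v) (z_ i.+1) = w_ i.+1.
Proof.
move=> i5; rewrite act5_vE; apply: emb_inj; rewrite emb_unemb; last first.
  by apply: coset_endo; do 5?[case=> //]; vm_compute.
move: i i5; do 5?[case=> //]; move=> _; rewrite /w_ ?expgS ?expg0 ?mulg1 /w1 ?(embM, homV embM) ?emb_z //.
all: fg_compute.
Qed.

(** * Degrees and the free basis of L *)

Lemma expgzS (G : groupType) (x : G) (k : int) : expgz x (k + 1)%R = expgz x k * x.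
Proof.
case: k => n; first by rewrite -[(Posz n + 1)%R]/(Posz (n + 1)) addn1 /= expgSr.
case: n => [|n].
  by rewrite (_ : (Negz 0 + 1)%R = 0%R) //= mulVg.
rewrite (_ : (Negz n.+1 + 1)%R = Negz n); last by rewrite !NegzE; lia.
by rewrite /= [x ^+ n.+2]expgS invgM mulgVK.
Qed.

Lemma expgzB (G : groupType) (x : G) (k : int) : expgz x (k - 1)%R = expgz x k * x^-1.
Proof. by rewrite -{2}(subrK 1%R k) expgzS mulgK. Qed.

Lemma expgzD (G : groupType) (x : G) (k l : int) :
  expgz x (k + l)%R = expgz x k * expgz x l.
Proof.
elim/int_rect: l => [|n IH|n IH]; first by rewrite addr0 mulg1.
  by rewrite -(addn1 n) PoszD addrA !expgzS IH mulgA.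
by rewrite -(addn1 n) PoszD opprD addrA !expgzB IH mulgA.
Qed.

Lemma expgzN (G : groupType) (x : G) (k : int) : expgz x (- k)%R = (expgz x k)^-1.
Proof. by apply: (mulIg (expgz x k)); rewrite mulVg -expgzD addNr. Qed.

Lemma expgz_morph (G H : groupType) (f : G -> H) : {morph f : x y / x * y} ->
  forall x k, f (expgz x k) = expgz (f x) k.
Proof.
move=> fM x; elim/int_rect=> [|n IH|n IH]; first exact: hom1.
  by rewrite -(addn1 n) PoszD !expgzS fM IH.
by rewrite -(addn1 n) PoszD opprD !expgzB fM IH homV.
Qed.

Lemma z1XD k l : z1X (k + l)%R = z1X k * z1X l. Proof. exact: expgzD. Qed.
Lemma z1XN k : z1X (- k)%R = (z1X k)^-1. Proof. exact: expgzN. Qed.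

(** Weight 1 for z_1, z_2, z_3 and -1 for z_4, z_5: these weights give every alpha_{i,j} degree 0,
    and t_i and w_i the degree of z_i. *)
Definition letter_deg (a : 'I_5 * bool) : int :=
  let d : int := if (a.1 < 3)%N then 1%R else (-1)%R in if a.2 then (- d)%R else d.

Definition deg (x : F5) : int := foldr (fun a d => (letter_deg a + d)%R) 0%R (word x).

Lemma deg_letterM a x : deg (letter a * x) = (letter_deg a + deg x)%R.
Proof.
rewrite /deg letter_mulE; case: (word x) => //= b w; case: eqP => //= ->.
by case: a => i []; rewrite /letter_deg /= ?addNKr ?addrNK ?addKr.
Qed.

Lemma degM x y : deg (x * y) = (deg x + deg y)%R.
Proof.
elim/free_ind: x => [|a x IH]; first by rewrite mul1g add0r.
by rewrite -mulgA !deg_letterM IH addrA.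
Qed.

Lemma deg1 : deg 1 = 0%R. Proof. by []. Qed.

Lemma degV x : deg x^-1 = (- deg x)%R.
Proof. by apply: (@addrI _ (deg x)); rewrite -degM mulgV subrr. Qed.

Lemma deg_z i : (i < 5)%N -> deg (z_ i.+1) = (if (i < 3)%N then 1 else -1)%R.
Proof. by move=> i5; rewrite /deg /= addr0 /letter_deg /= inordK. Qed.

Lemma deg_expgz x k : deg (expgz x k) = (deg x * k)%R.
Proof.
elim/int_rect: k => [|n IH|n IH]; first by rewrite mulr0.
  by rewrite -(addn1 n) PoszD expgzS degM IH mulrDr mulr1.
by rewrite -(addn1 n) PoszD opprD expgzB degM IH degV mulrDr mulrN1.
Qed.

Lemma deg_z1X k : deg (z1X k) = k.
Proof. by rewrite deg_expgz deg_z // mul1r. Qed.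

Lemma deg_t i : (i < 5)%N -> deg (t_ i.+1) = deg (z_ i.+1).
Proof.
by move: i; do 5?[case=> //]; rewrite /t_ ?expgS ?expg0 ?mulg1 ?(degM, degV) ?deg_z.
Qed.

Lemma deg_w i : (i < 5)%N -> deg (w_ i.+1) = deg (z_ i.+1).
Proof.
by move: i; do 5?[case=> //]; rewrite /w_ ?expgS ?expg0 ?mulg1 /w1 ?(degM, degV) ?deg_z.
Qed.

Lemma alpha_ixE (ij : 'I_4 * int) :
  alpha_ix ij = z1X ij.2 * z_ ij.1.+2 *
    z1X (- (if (ij.1 < 2)%N then ij.2 + 1 else ij.2 - 1))%R.
Proof. by rewrite /alpha_ix /alpha ltnS; case: ifP. Qed.

Lemma deg_alpha ij : deg (alpha_ix ij) = 0%R.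
Proof.
rewrite alpha_ixE !degM !deg_z1X deg_z; last exact: (ltn_ord ij.1).
rewrite [(ij.1.+1 < 3)%N]ltnS.
by case: ifP => _; lia.
Qed.

Local Notation Lset := (gen_set (range alpha_ix)).

Lemma gen_subgroup (G : groupType) (S : set G) : subgroup (gen_set S).
Proof.
split=> [H [] //|x y Hx Hy H HS SH|x Hx H HS SH].
  by have [_ HM _] := HS; apply: HM; [exact: Hx | exact: Hy].
by have [_ _ HV] := HS; apply: HV; exact: Hx.
Qed.

Lemma gen_deg x : Lset x -> deg x = 0%R.
Proof.
move=> Lx; apply: (Lx [set x | deg x = 0%R]);
  last by move=> _ [ij _ <-]; exact: deg_alpha.
split=> [|y z|y]; rewrite ?deg1 //= ?degM ?degV.
  by move=> -> ->.
by move=> ->; rewrite oppr0.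
Qed.

Lemma alpha_shift k ij : z1X k * alpha_ix ij * z1X (- k)%R = alpha_ix (ij.1, (k + ij.2)%R).
Proof.
rewrite !alpha_ixE /= z1XD !mulgA -[LHS]mulgA; congr (_ * _).
by rewrite -z1XD; congr z1X; case: ifP => _; lia.
Qed.

Lemma gen_conj k x : Lset x -> Lset (z1X k * x * z1X (- k)%R).
Proof.
have [G1 GM GV] := gen_subgroup (range alpha_ix).
rewrite z1XN; move=> Lx.
apply: (Lx [set x | Lset (z1X k * x * (z1X k)^-1)]); last first.
  by move=> _ [ij _ <-]; rewrite /= -z1XN alpha_shift; apply: sub_gen; exact: imageT.
split=> [|y z Hy Hz|y Hy] /=; first by rewrite mulg1 mulgV.
  have := GM _ _ Hy Hz; rewrite /=.
  by rewrite !mulgA mulgVK.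
by have := GV _ Hy; rewrite !invgM invgK !mulgA.
Qed.

Lemma z_alpha (i : 'I_4) :
  z_ i.+2 = alpha_ix (i, 0%R) * z1X (if (i < 2)%N then 1 else -1)%R.
Proof. by rewrite alpha_ixE /= mul1g -mulgA -z1XD; case: ifP => _; rewrite mulg1. Qed.

(** The powers of z_1 normalize the subgroup, conjugation by them shifting j, so they can be
    collected on the right. Hence L is the kernel of [deg]. *)
Lemma gen_decomp x : exists2 l, Lset l & x = l * z1X (deg x).
Proof.
have [G1 GM GV] := gen_subgroup (range alpha_ix).
have za k l : Lset l -> exists2 l', Lset l' & z1X k * l = l' * z1X k.
  move=> Ll; exists (z1X k * l * z1X (- k)%R); first exact: gen_conj.
  by rewrite z1XN mulgVK.
have Ha ij : Lset (alpha_ix ij) by apply: sub_gen; exact: imageT.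
suff H a : exists2 l, Lset l & letter a = l * z1X (letter_deg a).
  elim/free_ind: x => [|a x [l Ll xE]]; first by exists 1 => //; rewrite mul1g.
  have [l' Ll' aE] := H a; have [m Lm mE] := za (letter_deg a) l Ll.
  exists (l' * m); first exact: GM.
  by rewrite deg_letterM {1}xE aE -(mulgA l') (mulgA (z1X _)) mE z1XD !mulgA.
case: a => i b.
have [l [Ll iE]] : exists l, Lset l /\ free_gen i = l * z1X (letter_deg (i, false)).
  rewrite F5_letterE /letter_deg /=; case: i => [[|i] i5] /=.
    by exists 1; split=> //; rewrite mul1g.
  have i4 : (i < 4)%N by [].
  exists (alpha_ix (Ordinal i4, 0%R)); split=> //.
  by rewrite -[i.+2]/((Ordinal i4).+2) z_alpha.
case: b; last by exists l.
have [m Lm mE] := za (letter_deg (i, true)) _ (GV _ Ll).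
exists m => //; rewrite -mE -[letter _]/((free_gen i)^-1) iE invgM -z1XN.
by [].
Qed.

Lemma gen_degP x : Lset x <-> deg x = 0%R.
Proof.
split=> [/gen_deg //|d0]; have [l Ll ->] := gen_decomp x.
by rewrite d0 mulg1.
Qed.

Lemma L_deg (l : L) : deg (val l) = 0%R.
Proof. exact/gen_degP/set_mem/valP. Qed.

Definition toL (x : F5) (d0 : deg x = 0%R) : L :=
  exist _ x (mem_set (proj2 (gen_degP x) d0)).

(* The basis of L read off from a word of degree 0: the letter z_{i+2} read at
   degree j contributes alpha_{i,j}. *)
Definition FA : groupType := free_group ('I_4 * int)%type.

Definition basis_next (a : 'I_5 * bool) (k : int) : int := (k + letter_deg a)%R.

(** Schreier generators for the transversal formed by the powers of z_1: reading z_1 stays in the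
    transversal and outputs nothing. *)
Definition basis_pos (i : 'I_5) (k : int) : FA :=
  if i == ord0 then 1 else free_gen (inord i.-1 : 'I_4, k).

Definition basis_out (a : 'I_5 * bool) (k : int) : FA :=
  if a.2 then (basis_pos a.1 (basis_next a k))^-1 else basis_pos a.1 k.

Lemma letter_degV a : letter_deg (letter_inv a) = (- letter_deg a)%R.
Proof. by case: a => i []; rewrite /letter_deg //= opprK. Qed.

Lemma basis_nextK a k : basis_next (letter_inv a) (basis_next a k) = k.
Proof. by rewrite /basis_next letter_degV addrK. Qed.

Lemma basis_outV a k : basis_out (letter_inv a) (basis_next a k) = (basis_out a k)^-1.
Proof.
case: a => i []; rewrite /basis_out ?invgK //=.
by congr (basis_pos _ _)^-1; exact: (basis_nextK (i, false)).
Qed.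

Definition basis_run (x : F5) (k : int) : FA := run basis_next basis_out x k.

Lemma basis_final x k : final basis_next x k = (k + deg x)%R.
Proof.
elim/free_ind: x k => [|a x IH] k; first by rewrite addr0.
by rewrite (final_letterM basis_nextK) IH deg_letterM addrA.
Qed.

Lemma basis_runM x y k : basis_run (x * y) k = basis_run x k * basis_run y (k + deg x)%R.
Proof. by rewrite /basis_run (runM basis_nextK basis_outV) basis_final. Qed.

Lemma basis_run_z1 k : basis_run (z_ 1) k = 1.
Proof. by rewrite /basis_run /run /= /basis_out /basis_pos /= -val_eqE /= inordK // mulg1. Qed.

Lemma basis_run_V x k : basis_run x^-1 k = (basis_run x (k - deg x)%R)^-1.
Proof.
apply: (mulgI (basis_run x (k - deg x)%R)); rewrite mulgV -[X in basis_run x^-1 X](subrK (deg x)).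
by rewrite -basis_runM mulgV.
Qed.

Lemma basis_run_z1X j k : basis_run (z1X j) k = 1.
Proof.
rewrite /z1X; elim/int_rect: j => [//|n IH|n IH].
  by rewrite -(addn1 n) PoszD expgzS basis_runM IH basis_run_z1 mul1g.
by rewrite -(addn1 n) PoszD opprD expgzB basis_runM IH basis_run_V basis_run_z1 invg1 mul1g.
Qed.

Lemma basis_run_alpha ij : basis_run (alpha_ix ij) 0%R = free_gen ij.
Proof.
rewrite alpha_ixE !basis_runM !basis_run_z1X mulg1 mul1g deg_z1X add0r.
case: ij => i j /=; rewrite /basis_run /run /= /basis_out /= /basis_pos mulg1.
have i5 : (i.+1 < 5)%N by exact: (ltn_ord i).
by rewrite -val_eqE /= !(inordK i5) /= inord_val.
Qed.

Lemma basis_run_lift (x : FA) : basis_run (val (free_lift alphaL x)) 0%R = x.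
Proof.
apply: (@free_hom_ext _ _ (fun x => basis_run (val (free_lift alphaL x)) 0%R) id) => //.
  by move=> y z; rewrite free_lift_morph basis_runM add0r L_deg.
by move=> ij; rewrite free_lift_gen basis_run_alpha.
Qed.

Lemma lift_basis_run (l : L) : free_lift alphaL (basis_run (val l) 0%R) = l.
Proof.
have [y yl] : exists y, val (free_lift alphaL y) = val l.
  apply: (set_mem (valP l)) [set x | exists y, val (free_lift alphaL y) = x] _ _.
    split=> [|_ _ [y <-] [z <-]|_ [y <-]].
    - by exists 1; rewrite free_lift1.
    - by exists (y * z); rewrite free_lift_morph.
    - by exists y^-1; rewrite (homV (@free_lift_morph _ _ alphaL)).
  by move=> _ [ij _ <-]; exists (free_gen ij); rewrite free_lift_gen.
by rewrite -yl basis_run_lift; apply: val_inj.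
Qed.

Lemma alphaL_free : freely_generates alphaL.
Proof.
by exists (fun l => basis_run (val l) 0%R); [exact: basis_run_lift | exact: lift_basis_run].
Qed.

Definition basis_coord (l : L) : FA := basis_run (val l) 0%R.

Lemma basis_coordM : {morph basis_coord : x y / x * y}.
Proof. by move=> x y; rewrite /basis_coord basis_runM add0r L_deg. Qed.

Lemma basis_coord_alpha ij : basis_coord (alphaL ij) = free_gen ij.
Proof. exact: basis_run_alpha. Qed.

(** Passage from the indexed family to the set of its values: [k] reads off coordinates over the
    indices, then replaces each index by the element of the set that it names. *)
Lemma L_free_basis : free_basis (range alphaL).
Proof.
pose h (ij : 'I_4 * int) : set_type (range alphaL) :=
  exist _ (alphaL ij) (mem_set (imageT alphaL ij)).
pose k (l : L) := free_lift (fun ij => free_gen (h ij)) (basis_coord l).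
have kM : {morph k : x y / x * y} by move=> x y; rewrite /k basis_coordM free_lift_morph.
have vM := @free_lift_morph _ _ (fun s : range alphaL => val s).
exists k => [y|l].
  apply: (@free_hom_ext _ _ (fun y => k (free_lift (fun s : range alphaL => val s) y)) id) => //.
    by move=> x z; rewrite vM kM.
  move=> s; rewrite free_lift_gen.
  have [ij _ ijs] := set_mem (valP s).
  rewrite -ijs /k basis_coord_alpha free_lift_gen; congr free_gen.
  exact/val_inj.
rewrite -[RHS]lift_basis_run -/(basis_coord l) /k.
apply: (@free_hom_ext _ _ (fun y => free_lift (fun s : range alphaL => val s)
    (free_lift (fun ij => free_gen (h ij)) y)) (free_lift alphaL)).
- by move=> x z; rewrite !free_lift_morph.
- exact: free_lift_morph.
- by move=> ij; rewrite !free_lift_gen.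
Qed.

(** The words of a finite basis involve finitely many j. Killing every alpha_{i,j} except those with
    one larger j = n then annihilates the basis, hence L, although alpha_{2,n} survives. *)
Lemma L_infinite_rank (S : set L) : free_basis S -> infinite_set S.
Proof.
move=> [k kK kV] /finite_seqP[s SE].
pose letters := flatten [seq word (basis_coord l) | l <- s].
pose n := (\max_(a <- letters) `|a.1.2|%N).+1.
have nP l a : l \in s -> a \in word (basis_coord l) -> (`|a.1.2| < n)%N.
  move=> ls al; rewrite ltnS; apply: (leq_bigmax_seq (P := xpredT)) => //.
  by apply/flatten_mapP; exists l.
pose f (ij : 'I_4 * int) : FZ := if ij.2 == Posz n then gen_s else 1.
pose F (l : L) := free_lift f (basis_coord l).
have FM : {morph F : x y / x * y} by move=> x y; rewrite /F basis_coordM free_lift_morph.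
have Fs (l : L) : S l -> F l = 1.
  rewrite SE => /= ls; rewrite /F free_liftE /fold_lift.
  have := nP l ^~ ls; elim: (word _) => //= a w IH aP.
  rewrite IH => [|b bw]; last by apply: aP; rewrite inE bw orbT.
  have an : (a.1.2 == Posz n) = false.
    apply/eqP => an; have := aP a (mem_head _ _); rewrite an.
    by rewrite absz_nat ltnn.
  by rewrite /letter_lift /f an mulg1 invg1 if_same.
have F1 l : F l = 1.
  rewrite -(kV l); apply: (@free_hom_ext _ _ (fun y => F (free_lift (fun s : S => val s) y))
    (fun=> 1)) => [x y|x y|t].
  - by rewrite free_lift_morph FM.
  - by rewrite mulg1.
  - by rewrite free_lift_gen; apply: Fs; exact/set_mem/valP.
have := F1 (alphaL (ord0, Posz n)); rewrite /F basis_coord_alpha free_lift_gen /f eqxx.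
by move=> /(congr1 (@word _)).
Qed.

(** The inner powers of z_1 telescope. It follows that R_j^-1 z_1^j is t_1^j and that S_j^-1 z_1^j
    is w_1^j, which explains the role of R_j and S_j in the formulas for the action. *)
Lemma tele_prodE a j : tele_prod a j = z1X j * expgz a (- j)%R.
Proof.
case: j => n; rewrite /tele_prod.
  elim: n => [|n IH]; first by rewrite big_ord0 mulg1.
  rewrite big_ord_recl (eq_bigr (fun i : 'I_n => (tele_factor a (Posz n - 1 - Posz i)%R)^-1)).
    rewrite IH /tele_factor -[nat_of_ord ord0]/0%N.
    have -> : (Posz n.+1 - 1 - Posz 0)%R = Posz n by lia.
    have -> : (- Posz n.+1)%R = (- 1 - Posz n)%R by lia.
    have -> : (Posz n.+1)%R = (Posz n + 1)%R by lia.
    rewrite [expgz a (-1 - _)%R]expgzD z1XN !invgM invgK !mulgA.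
    by rewrite mulgVK.
  by move=> i _; congr (tele_factor a _)^-1; rewrite lift0; lia.
have -> : Negz n = (- Posz n.+1)%R by rewrite NegzE.
elim: n => [|n IH].
  by rewrite big_ord_recl big_ord0 mulg1 /tele_factor addr0 addNr mulg1 opprK.
rewrite big_ord_recl (eq_bigr (fun i : 'I_n.+1 => tele_factor a (- Posz n.+1 + Posz i)%R)).
  rewrite IH /tele_factor -[nat_of_ord ord0]/0%N addr0.
  have -> : (- Posz n.+2 + 1)%R = (- Posz n.+1)%R by lia.
  have -> : (- - Posz n.+2)%R = (1 + - - Posz n.+1)%R by lia.
  rewrite [expgz a (1 + _)%R]expgzD !mulgA [z1X (- - _)]z1XN.
  by rewrite mulgVK.
by move=> i _; congr (tele_factor a _); rewrite lift0; lia.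
Qed.

Lemma tele_prod_gen a : deg a = 1%R -> forall j, gen_set (range alpha_ix) (tele_prod a j).
Proof.
move=> a1 j; apply/gen_degP.
by rewrite tele_prodE degM deg_z1X deg_expgz a1 mul1r subrr.
Qed.

Lemma tele_prodVz1X a j : (tele_prod a j)^-1 * z1X j = expgz a j.
Proof. by rewrite tele_prodE invgM -expgzN opprK mulgVK. Qed.

(** The right-hand side is alpha_{i,j} with s_1 and s_i substituted for z_1 and z_i, as it must be
    for the image under an endomorphism. *)
Lemma alpha_conjE (s : nat -> F5) i j :
  alpha_conj s (tele_prod (s 1%N)) i j =
  expgz (s 1%N) j * s i * expgz (s 1%N) (- (if (i <= 3)%N then j + 1 else j - 1))%R.
Proof.
have H : z1X (- j)%R * tele_prod (s 1%N) j = expgz (s 1%N) (- j)%R.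
  by apply: invg_inj; rewrite invgM -z1XN opprK tele_prodVz1X -expgzN opprK.
rewrite /alpha_conj; case: ifP => _;
  rewrite -(mulgA _ (z1X (- j)%R)) H tele_prodVz1X -[LHS]mulgA; congr (_ * _).
- by rewrite (_ : (- (j + 1))%R = (- 1 + - j)%R) ?[RHS]expgzD //; lia.
- by rewrite (_ : (- (j - 1))%R = (1 + - j)%R) ?[RHS]expgzD //; lia.
Qed.

Lemma deg_act5_gen (q : B3) :
  (forall i, (i < 5)%N -> deg (act5 q (z_ i.+1)) = deg (z_ i.+1)) ->
  forall n, deg (act5 q n) = deg n.
Proof.
move=> H; elim/F5_ind=> [//|x y dx dy|x dx]; first by rewrite gactMr !degM dx dy.
by rewrite (homV (gactMr act5 q)) !degV dx.
Qed.

Lemma deg_act5V (q : B3) : (forall n, deg (act5 q n) = deg n) ->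
  forall n, deg (act5 q^-1 n) = deg n.
Proof. by move=> H n; rewrite -H -gactM mulgV gact1. Qed.

Lemma deg_act5_s n : deg (act5 (in3_s gen_s) n) = deg n.
Proof.
apply: deg_act5_gen n => i; rewrite act5_sE; move: i; do 5?[case]; last by [].
all: move=> i5; rewrite emb_z // free_liftE /unemb /run;
  match goal with |- deg (run_word _ _ (word ?x) _) = _ =>
  let l := eval vm_compute in (word x) in
  have -> : word x = l by (vm_compute; reflexivity) end.
all: by rewrite /= /coset_out /= ?(degM, degV, deg1, deg_z).
Qed.

Lemma deg_act5_uv q n : deg (act5 (in3_uv q) n) = deg n.
Proof.
elim/free_ind: q n => [|[t b] q IH] n; first by rewrite gact1.
rewrite /in3_uv sd_inl_morph gactM -[RHS]IH; move: (act5 _ n) => {IH} {}n.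
have H (t' : bool) m : deg (act5 (in3_uv (free_gen t')) m) = deg m.
  apply: deg_act5_gen => i i5; case: t'.
    by rewrite act5_u // deg_t.
  by rewrite act5_v // deg_w.
case: b; last exact: H.
rewrite -[letter _]/((free_gen t)^-1) (homV (@sd_inl_morph _ _ _)).
exact: deg_act5V.
Qed.

Lemma deg_act5 q n : deg (act5 q n) = deg n.
Proof.
rewrite (sd_inE q) gactM deg_act5_uv; move: (q.2) => m.
elim/free_ind: m n => [|[[] b] m IH] n; first by rewrite gact1.
rewrite sd_inr_morph gactM -[RHS]IH; move: (act5 _ n) => {IH} {}n.
case: b; last exact: deg_act5_s.
rewrite -[letter _]/(gen_s^-1) (homV (@sd_inr_morph _ _ _)).
exact/deg_act5V/deg_act5_s.
Qed.

Lemma deg_actL (q : F2) (l : L) : deg (act5 (in3_uv q) (val l)) = 0%R.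
Proof. by rewrite deg_act5 L_deg. Qed.

Definition actL_fun (q : F2) (l : L) : L := toL (deg_actL q l).

Lemma actL1 l : actL_fun 1 l = l.
Proof. by apply/val_inj; exact: (gact1 act5). Qed.

Lemma actL_M q r l : actL_fun (q * r) l = actL_fun q (actL_fun r l).
Proof.
apply/val_inj; rewrite -[LHS]/(act5 (in3_uv (q * r)) (val l)) /in3_uv sd_inl_morph.
exact: gactM.
Qed.

Lemma actL_Mr q l m : actL_fun q (l * m) = actL_fun q l * actL_fun q m.
Proof. by apply/val_inj; exact: (gactMr act5). Qed.

Definition actL : group_action F2 L := GroupAction actL1 actL_M actL_Mr.

Lemma val_actL q l : val (actL q l) = act5 (in3_uv q) (val l). Proof. by []. Qed.

Lemma act5_alpha (q : B3) (s : nat -> F5) (i : 'I_4) j :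
  (forall k, (k < 5)%N -> act5 q (z_ k.+1) = s k.+1) ->
  act5 q (alpha_ix (i, j)) = alpha_conj s (tele_prod (s 1%N)) i.+2 j.
Proof.
move=> H; rewrite alpha_conjE alpha_ixE -[(i, j).1]/i -[(i, j).2]/j !gactMr /z1X !(expgz_morph (gactMr act5 q)).
rewrite !H //; last exact: (ltn_ord i).
Qed.

Lemma actL_u (i : 'I_4) j : val (actL gen_u (alphaL (i, j))) = alpha_conj t_ R_ i.+2 j.
Proof. by rewrite val_actL (act5_alpha _ _ act5_u). Qed.

Lemma actL_v (i : 'I_4) j : val (actL gen_v (alphaL (i, j))) = alpha_conj w_ S_ i.+2 j.
Proof. by rewrite val_actL (act5_alpha _ _ act5_v). Qed.

(** * Stabilizers of positions *)

Lemma FZ_comm (x y : FZ) : x * y = y * x.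
Proof.
have gC (z : FZ) : gen_s * z = z * gen_s.
  elim/free_ind: z => [|[[] b] z IH]; first by rewrite mul1g mulg1.
  rewrite mulgA -[RHS]mulgA -IH !mulgA; congr (_ * _).
  by case: b => //; rewrite -[letter _]/(gen_s^-1) mulgV mulVg.
elim/free_ind: x => [|[[] b] x IH]; first by rewrite mul1g mulg1.
rewrite -mulgA IH !mulgA; congr (_ * _); case: b; last exact: gC.
rewrite -[letter _]/(gen_s^-1); apply: (mulgI gen_s); apply: (mulIg gen_s).
by rewrite !gnorm gC.
Qed.

Section Congruence.
Context (G : groupType) (H : set G).
Hypotheses (Hs : subgroup H) (Hc : @commutators G `<=` H).

Definition eqmodH (x y : G) : Prop := H (x * y^-1).
Local Notation "x ~~ y" := (eqmodH x y) (at level 70).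

Let H1 : H 1. Proof. by case: Hs. Qed.
Let HM x y : H x -> H y -> H (x * y). Proof. by case: Hs => _ HM _; exact: HM. Qed.
Let HV x : H x -> H x^-1. Proof. by case: Hs => _ _ HV; exact: HV. Qed.

(** A conjugate of x differs from x by a commutator, so H is normal; this makes the congruence
    compatible with products. *)
Lemma normalH g x : H x -> H (g * x * g^-1).
Proof.
move=> Hx; rewrite -[_ * g^-1](mulgVK x); apply: HM Hx.
apply: Hc; exists g^-1, x^-1.
by rewrite /commg /conjg !gnorm.
Qed.

Lemma eqmodH_refl x : x ~~ x. Proof. by rewrite /eqmodH mulgV. Qed.
Lemma eqmodH_sym x y : x ~~ y -> y ~~ x.
Proof. by move=> /HV; rewrite invgM invgK. Qed.
Lemma eqmodH_trans y x z : x ~~ y -> y ~~ z -> x ~~ z.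
Proof. by move=> xy yz; have := HM xy yz; rewrite mulgA mulgVK. Qed.
Lemma eqmodH_mul x x' y y' : x ~~ x' -> y ~~ y' -> x * y ~~ x' * y'.
Proof.
move=> xx yy; have := HM (normalH x yy) xx.
by rewrite /eqmodH invgM !mulgA mulgVK.
Qed.
Lemma eqmodH_conj g x : g * x * g^-1 ~~ x.
Proof. by apply: Hc; exists g^-1, x^-1; rewrite /commg /conjg !gnorm. Qed.
Lemma eqmodH_conjV g x : g^-1 * x * g ~~ x.
Proof. by have := eqmodH_conj g^-1 x; rewrite invgK. Qed.
Lemma eqmodH_inv x y : x ~~ y -> x^-1 ~~ y^-1.
Proof.
move=> xy; have := normalH x^-1 (eqmodH_sym xy).
by rewrite /eqmodH !gnorm.
Qed.
Lemma eqmodH_cancell g x y : g * x ~~ g * y -> x ~~ y.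
Proof. by move=> /(eqmodH_mul (eqmodH_refl g^-1)); rewrite !mulKg. Qed.
Lemma eqmodH_H x y : x ~~ y -> H y -> H x.
Proof. by move=> xy /(HM xy); rewrite mulgVK. Qed.

End Congruence.

(* The stabilizer of the last position in BB. *)
Definition Gam : groupType := sdprod_group act5.

Definition derGam : set Gam := [set x | deg x.1 = 0%R /\ x.2.2 = 1].

Lemma derGam_deg1 (x y : Gam) : deg (x * y).1 = (deg x.1 + deg y.1)%R.
Proof. by rewrite sd_mulE degM deg_act5. Qed.

Lemma derGam_deg1V (x : Gam) : deg x^-1.1 = (- deg x.1)%R.
Proof. by rewrite sd_invE deg_act5 degV. Qed.

Lemma derGam_subgroup : subgroup derGam.
Proof.
split=> [//|x y [dx sx] [dy sy]|x [dx sx]]; split.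
- by rewrite derGam_deg1 dx dy.
- by rewrite sd_mulE sd_mulE /= sx sy mulg1.
- by rewrite derGam_deg1V dx.
- by rewrite sd_invE sd_invE /= sx invg1.
Qed.

Lemma commutators_derGam : @commutators Gam `<=` derGam.
Proof.
move=> _ [x [y ->]]; split.
  by rewrite /commg /conjg !(derGam_deg1, derGam_deg1V); lia.
rewrite /commg /conjg !(sd_mulE, sd_invE) /=.
by rewrite (FZ_comm _ y.2.2) !mulgA mulgVK mulVg.
Qed.

Definition in5 (n : F5) : Gam := sd_inl act5 n.
Definition in5_uv (q : F2) : Gam := sd_inr act5 (in3_uv q).
Definition in5_s : Gam := sd_inr act5 (in3_s gen_s).

Lemma in5M : {morph in5 : x y / x * y}. Proof. exact: sd_inl_morph. Qed.
Lemma in5_uvM : {morph in5_uv : x y / x * y}.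
Proof. by move=> x y; rewrite /in5_uv /in3_uv sd_inl_morph sd_inr_morph. Qed.

(** Modulo commutators, s v s^-1 = u^-1 v and s u s^-1 = v kill u and v, and t_i and w_i, being
    conjugate to z_i, force z_1 = z_2 = z_3 = z_4^-1 = z_5^-1. Only the degree and the exponent of s
    survive. *)
Lemma derGam_gen x : derGam x -> gen_set (@commutators Gam) x.
Proof.
move=> [dx sx] H Hs Hc; have [H1 HM HV] := Hs.
pose e := eqmodH H.
have conjE g y z : g * y * g^-1 = z -> e z y by move=> <-; exact: eqmodH_conj.
have refl := eqmodH_refl Hs.
have trans y z t : e y z -> e z t -> e y t by exact: eqmodH_trans.
have sym := eqmodH_sym Hs; have mul := eqmodH_mul Hs Hc.
have suv q : in5_s * in5_uv q * in5_s^-1 = in5_uv (act_s_uv gen_s q).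
  by rewrite /in5_s /in5_uv -(homV (@sd_inr_morph _ _ act5)) -!sd_inr_morph sd_in_conj.
have Hu : H (in5_uv gen_u).
  have := conjE _ _ _ (suv gen_v).
  rewrite endo_action_gen free_lift_gen /= in5_uvM (homV in5_uvM) /e /eqmodH mulgK.
  by move=> /HV; rewrite invgK.
have Hv : H (in5_uv gen_v).
  have := conjE _ _ _ (suv gen_u); rewrite endo_action_gen free_lift_gen /=.
  by move=> /(eqmodH_H Hs); apply.
have HQ q : H (in5_uv q).
  elim/free_ind: q => [|[t b] q IH]; first by rewrite (hom1 in5_uvM).
  rewrite in5_uvM; apply: HM IH.
  have Ht : H (in5_uv (free_gen t)) by case: t.
  case: b => //; rewrite -[letter _]/((free_gen t)^-1) (homV in5_uvM); exact: HV.
pose zz i := in5 (z_ i).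
have tz i : (i < 5)%N -> e (in5 (t_ i.+1)) (zz i.+1).
  by move=> i5; apply: (conjE (in5_uv gen_u)); rewrite /in5_uv sd_in_conj act5_u.
have wz i : (i < 5)%N -> e (in5 (w_ i.+1)) (zz i.+1).
  by move=> i5; apply: (conjE (in5_uv gen_v)); rewrite /in5_uv sd_in_conj act5_v.
have z21 : e (zz 2%N) (zz 1%N) by exact: (tz 0%N).
(* t_4 is a conjugate of z_5. *)
have z54 : e (zz 5%N) (zz 4%N).
  apply: (trans _ _ _ _ (tz 3%N isT)); apply: (sym).
  have := eqmodH_conj Hc (zz 2%N * (zz 1%N)^-1) (zz 5%N).
  by rewrite invgM invgK /= !in5M !(homV in5M) !mulgA.
(* In t_2 the conjugate z_2^-1 z_4^-1 z_2 is congruent to z_5^-1, so z_5 z_3 times it is congruent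
   to z_3: what remains is z_2 z_1^-1 z_3, congruent to z_2. *)
have z31 : e (zz 3%N) (zz 1%N).
  have := tz 1%N isT; rewrite /= !in5M !(homV in5M) -/(zz _).
  move=> h; apply: (eqmodH_cancell Hs Hc (g := zz 2%N * (zz 1%N)^-1)).
  rewrite mulgVK; apply: (trans _ _ _ _ h); apply: (sym).
  rewrite -!(mulgA (zz 2%N * (zz 1%N)^-1)); apply: (mul); first exact: refl.
  have h1 : e ((zz 2%N)^-1 * (zz 4%N)^-1 * zz 2%N) (zz 5%N)^-1.
    apply: (trans _ _ _ (eqmodH_conjV Hc _ _)); apply: (eqmodH_inv Hs Hc); exact: sym.
  apply: (trans _ _ _ _ (eqmodH_conj Hc (zz 5%N) (zz 3%N))).
  by have := mul _ _ _ _ (refl (zz 5%N * zz 3%N)) h1; rewrite !mulgA.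
have z41 : e (zz 4%N)^-1 (zz 1%N).
  apply: (trans _ _ _ _ (wz 0%N isT)); apply: (sym).
  rewrite /= /w1 !in5M !(homV in5M) -/(zz _).
  have h : e ((zz 1%N)^-1 * zz 3%N) 1.
    rewrite -(mulVg (zz 1%N)); apply: (mul) z31; exact: refl.
  have := mul _ _ _ _ h (eqmodH_conjV Hc (zz 2%N) (zz 4%N)^-1).
  by rewrite mul1g !mulgA.
have Halpha ij : H (in5 (alpha_ix ij)).
  have -> : alpha_ix ij = z1X ij.2 * alpha_ix (ij.1, 0%R) * (z1X ij.2)^-1.
    by rewrite -z1XN alpha_shift /= addr0; case: ij.
  rewrite !in5M (homV in5M); apply: (normalH Hs Hc).
  have := z_alpha ij.1; move: ij.1 => i /esym/(canRL (mulgK _)) ->.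
  rewrite in5M (homV in5M).
  have z41' : e (zz 4%N) (in5 (z1X (-1)%R)).
    by have := eqmodH_inv Hs Hc z41; rewrite invgK -(homV in5M).
  case: i => [[|[|[|[|i]]]] i4] //=.
  exact: trans z54 z41'.
have HL n : deg n = 0%R -> H (in5 n).
  move=> /gen_degP Ln.
  apply: (Ln [set n | H (in5 n)]); last by move=> _ [ij _ <-].
  split=> [|a b Ha Hb|a Ha] /=; first by rewrite (hom1 in5M).
    by rewrite in5M; exact: HM.
  by rewrite (homV in5M); exact: HV.
rewrite (sd_inE x); apply: HM; first exact: HL.
by case: x dx sx => n [q m] /= _ ->; exact: HQ.
Qed.

Lemma group_isoI (G H : groupType) (f : G -> H) :
  {morph f : x y / x * y} -> bijective f -> group_iso G H.
Proof.
move=> fM fbij; pose m := isMultiplicative.Build G H f fM.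
pose F : {multiplicative G -> H} := HB.pack f m.
by exists F.
Qed.

Definition p4 (k : nat) : 'I_4 := inord k.
Definition tau1 : {perm 'I_4} := tperm (p4 0) (p4 1).
Definition tau2 : {perm 'I_4} := tperm (p4 1) (p4 2).
Definition tau3 : {perm 'I_4} := tperm (p4 2) (p4 3).

Lemma p4_neq i j : (i < 4)%N -> (j < 4)%N -> (p4 i == p4 j) = (i == j).
Proof. by move=> i4 j4; rewrite -val_eqE /= !inordK. Qed.

Lemma p4_ind (P : 'I_4 -> Prop) : P (p4 0) -> P (p4 1) -> P (p4 2) -> P (p4 3) ->
  forall k, P k.
Proof.
move=> P0 P1 P2 P3 k; rewrite -[k]inord_val.
by case: k => [[|[|[|[|k]]]] k4].
Qed.

Lemma tau1E : [/\ tau1 (p4 0) = p4 1, tau1 (p4 1) = p4 0, tau1 (p4 2) = p4 2 & tau1 (p4 3) = p4 3].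
Proof. by split; rewrite ?tpermL ?tpermR ?tpermD ?p4_neq. Qed.
Lemma tau2E : [/\ tau2 (p4 0) = p4 0, tau2 (p4 1) = p4 2, tau2 (p4 2) = p4 1 & tau2 (p4 3) = p4 3].
Proof. by split; rewrite ?tpermL ?tpermR ?tpermD ?p4_neq. Qed.
Lemma tau3E : [/\ tau3 (p4 0) = p4 0, tau3 (p4 1) = p4 1, tau3 (p4 2) = p4 3 & tau3 (p4 3) = p4 2].
Proof. by split; rewrite ?tpermL ?tpermR ?tpermD ?p4_neq. Qed.

Ltac tau_simp :=
  case: tau1E => ? ? ? ?; case: tau2E => ? ? ? ?; case: tau3E => ? ? ? ?; congruence.

Lemma tau_br12 : tau1 * tau2 * tau1 = tau2 * tau1 * tau2.
Proof. by apply/permP; apply: p4_ind; rewrite !permM; tau_simp. Qed.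

Lemma tau_br23 : tau2 * tau3 * tau2 = tau3 * tau2 * tau3.
Proof. by apply/permP; apply: p4_ind; rewrite !permM; tau_simp. Qed.

Lemma tau_br13 : tau1 * tau3 = tau3 * tau1.
Proof. by apply/permP; apply: p4_ind; rewrite !permM; tau_simp. Qed.

Definition posn : BB -> {perm 'I_4} := braid_hom tau1 tau2 tau3.

Lemma posnM : {morph posn : x y / x * y}.
Proof. exact: braid_homM tau_br12 tau_br23 tau_br13. Qed.

Lemma posn_comp x y k : posn (x * y) k = posn y (posn x k).
Proof. by rewrite posnM permM. Qed.

Lemma posn_sigma : [/\ posn sigma1 = tau1, posn sigma2 = tau2 & posn sigma3 = tau3].
Proof. by rewrite /posn braid_hom1 braid_hom2 braid_hom3. Qed.

Lemma in_uE : in_uv gen_u = sigma2 * sigma1^-1. Proof. by rewrite sigma2E mulgK. Qed.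
Lemma in_cE : in_cw gen_c = sigma3 * sigma1^-1. Proof. by rewrite sigma3E mulgK. Qed.
Lemma in_vE : in_uv gen_v = sigma1 * in_uv gen_u * sigma1^-1.
Proof. by rewrite -[sigma1]/(in_s gen_s) conj_s_uv endo_action_gen free_lift_gen. Qed.
Lemma in_wE : in_cw gen_w = in_uv gen_u * in_cw gen_c * (in_uv gen_u)^-1.
Proof. by rewrite conj_uv_cw endo_action_gen free_lift_gen. Qed.

Definition pos_of (s : bool * bool) : 'I_4 :=
  match s with
  | (false, false) => p4 3 | (true, false) => p4 2
  | (false, true) => p4 1 | (true, true) => p4 0
  end.

Lemma pos_of_inj : injective pos_of.
Proof.
by move=> [[] []] [[] []] //= /eqP; rewrite p4_neq.
Qed.

(** c and w go to the double transpositions (0 1)(2 3) and (0 2)(1 3), which permute the positions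
    as c and w permute the four cosets. *)
Lemma posn_cw n s : posn (in_cw n) (pos_of s) = pos_of (coset n s).
Proof.
have [s1 s2 s3] := posn_sigma.
have V1 : tau1^-1 = tau1 by exact: tpermV.
have V2 : tau2^-1 = tau2 by exact: tpermV.
have V3 : tau3^-1 = tau3 by exact: tpermV.
have posnV := homV posnM.
have uE : posn (in_uv gen_u) = tau2 * tau1 by rewrite in_uE posnM posnV s1 s2 V1.
have cE : posn (in_cw gen_c) = tau3 * tau1 by rewrite in_cE posnM posnV s1 s3 V1.
have wE : posn (in_cw gen_w) = tau2 * tau1 * (tau3 * tau1) * (tau1 * tau2).
  by rewrite in_wE !posnM posnV uE cE invgM V1 V2.
have gE b t : posn (in_cw (free_gen b)) (pos_of t) = pos_of (coset_next (b, false) t).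
  by case: b t => [] [[] []]; rewrite -?/gen_c -?/gen_w ?cE ?wE !permM /=; tau_simp.
elim/free_ind: n s => [|a n IH] s.
  by rewrite (hom1 in_cwM) (hom1 posnM) perm1.
rewrite in_cwM posnM permM /coset (final_letterM coset_nextK) -/(coset _ _) -IH.
congr (posn (in_cw n) _); case: a => b [] ; last exact: gE.
rewrite -[letter _]/((free_gen b)^-1) (homV in_cwM) posnV.
set t := coset_next (b, true) s.
have -> : s = coset_next (b, false) t by rewrite /t (coset_nextK (b, true)).
by rewrite -gE permK.
Qed.

Lemma posn_B3 (q : B3) : posn (sd_inr act_B3_cw q) (p4 3) = p4 3.
Proof.
have [s1 s2 s3] := posn_sigma; have posnV := homV posnM.
have fixV x : posn x (p4 3) = p4 3 -> posn x^-1 (p4 3) = p4 3.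
  by move=> H; rewrite posnV -{1}H permK.
have fixM x y : posn x (p4 3) = p4 3 -> posn y (p4 3) = p4 3 -> posn (x * y) (p4 3) = p4 3.
  by move=> Hx Hy; rewrite posnM permM Hx.
have f1 : posn sigma1 (p4 3) = p4 3 by rewrite s1; tau_simp.
have f2 : posn sigma2 (p4 3) = p4 3 by rewrite s2; tau_simp.
have fu : posn (in_uv gen_u) (p4 3) = p4 3 by rewrite in_uE; apply: (fixM); [|apply: (fixV)].
have fv : posn (in_uv gen_v) (p4 3) = p4 3 by rewrite in_vE; apply: (fixM) (fixV _ _); first exact: fixM.
case: q => q m; rewrite (sd_inE (q, m)) sd_inr_morph; apply: (fixM).
  rewrite -/(in_uv q); elim/free_ind: q => [|[t b] q IH].
    by rewrite (hom1 in_uvM) (hom1 posnM) perm1.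
  rewrite in_uvM; apply: (fixM) IH.
  case: b; last by case: t.
  by rewrite -[letter _]/((free_gen t)^-1) (homV in_uvM); apply: (fixV); case: t.
rewrite -/(in_s m); elim/free_ind: m => [|[[] b] m IH].
  by rewrite (hom1 in_sM) (hom1 posnM) perm1.
rewrite in_sM; apply: (fixM) IH; case: b => //.
by rewrite -[letter _]/(gen_s^-1) (homV in_sM); apply: (fixV).
Qed.

Definition kappa (g : Gam) : BB := (emb g.1, g.2).

Lemma kappaM : {morph kappa : x y / x * y}.
Proof.
move=> x y.
by rewrite -[LHS]/((emb (x.1 * act5 x.2 y.1), x.2 * y.2) : BB) embM emb_act5.
Qed.

Lemma kappa_inj : injective kappa.
Proof.
move=> [n q] [m r] e; have /= nm := emb_inj (congr1 fst e).
by have /= qr := congr1 snd e; rewrite nm qr.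
Qed.

(** The factor B3 fixes the last position, so only the component in F_2(c, w) decides, and it must
    lie in the trivial coset. *)
Lemma kappa_image (x : BB) : posn x (p4 3) = p4 3 <-> exists g, kappa g = x.
Proof.
have fixE : posn x (p4 3) = p4 3 <-> coset x.1 coset0 = coset0.
  rewrite {1}(sd_inE x) posnM permM.
  have -> : p4 3 = pos_of coset0 by [].
  rewrite -/(in_cw x.1) posn_cw; split=> [h|->]; last exact: posn_B3.
  apply: pos_of_inj; apply: (@perm_inj _ (posn (sd_inr act_B3_cw x.2))).
  by rewrite h posn_B3.
rewrite fixE; split=> [cx|[g <-]]; last exact: coset_emb.
by exists (unemb x.1, x.2); rewrite /kappa emb_unemb //; case: x {cx fixE}.
Qed.

Lemma BB_transitive (k : 'I_4) : exists x, posn x (p4 3) = k.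
Proof.
exists (in_cw (match val k with 0 => gen_c * gen_w | 1 => gen_w | 2 => gen_c | _ => 1 end)).
have -> : p4 3 = pos_of coset0 by [].
rewrite posn_cw -[RHS]inord_val; case: k => [[|[|[|[|k]]]] k4] //=.
Qed.

Section DerivedIso.
Context (G : groupType) (f : G -> Gam).
Hypotheses (fM : {morph f : x y / x * y}) (fbij : bijective f).

Lemma comm_transfer (A B : groupType) (h : A -> B) : {morph h : x y / x * y} ->
  forall x, gen_set (@commutators A) x -> gen_set (@commutators B) (h x).
Proof.
move=> hM x Hx.
have [G1 GM GV] := gen_subgroup (@commutators B).
apply: (Hx [set x | gen_set (@commutators B) (h x)]).
  split=> [|y z Hy Hz|y Hy] /=; first by rewrite (hom1 hM).
    by rewrite hM; exact: GM.
  by rewrite (homV hM); exact: GV.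
move=> _ [y [z ->]] /=; apply: sub_gen; exists (h y), (h z).
by rewrite /commg /conjg !(hM, homV hM).
Qed.

Lemma derived_derGam (x : derived_group G) : derGam (f (val x)).
Proof.
have := comm_transfer fM (set_mem (valP x)); apply; first exact: derGam_subgroup.
exact: commutators_derGam.
Qed.

Definition der_map (x : derived_group G) : sdprod_group actL :=
  (toL (proj1 (derived_derGam x)), (f (val x)).2.1).

Lemma derived_iso : group_iso (derived_group G) (sdprod_group actL).
Proof.
case: fbij => g fK gK; apply: (@group_isoI _ _ der_map).
  move=> x y; rewrite sd_mulE; congr (_, _).
    apply/val_inj => /=.
    have [_ xs] := derived_derGam x.
    rewrite fM sd_mulE /=; congr (_ * act5 _ _).
    by case: (f (val x)) xs => n [q m] /= ->.
  have [_ /= xs] := derived_derGam x.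
  by rewrite /= fM sd_mulE /= xs.
have gM : {morph g : x y / x * y}.
  by move=> x y; apply: (can_inj fK); rewrite fM !gK.
pose lift (a : sdprod_group actL) : Gam := (val a.1, in3_uv a.2).
have liftP a : gen_set (@commutators G) (g (lift a)).
  apply: comm_transfer gM _ _; apply: derGam_gen; split=> //; exact: L_deg.
exists (fun a => exist _ (g (lift a)) (mem_set (liftP a))) => [x|[l q]].
  apply/val_inj => /=; apply: (can_inj fK); rewrite gK /lift /=.
  have [_] := derived_derGam x.
  by case: (f (val x)) => n [q m] /= ->.
rewrite /der_map; congr (_, _); last by rewrite /= gK.
by apply/val_inj; rewrite /= gK.
Qed.

End DerivedIso.

(** All positions are conjugate: an element [t] carrying the last position to k conjugates the image
    of [F] onto that of [kappa]. *)
Lemma stabilizer_derived (G : groupType) (k : 'I_4) (F : G -> BB) :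
  {morph F : x y / x * y} -> injective F ->
  (forall x, posn x k = k <-> exists y, F y = x) ->
  group_iso (derived_group G) (sdprod_group actL).
Proof.
move=> FM Finj Fim; have [t tk] := BB_transitive k.
have posnV := homV posnM.
have kP y : exists g, kappa g = t * F y * t^-1.
  apply/kappa_image; rewrite !posn_comp tk posnV.
  have -> : posn (F y) k = k by apply/Fim; exists y.
  by rewrite -tk permK.
pose f y := sval (cid (kP y)).
have fE y : kappa (f y) = t * F y * t^-1 by rewrite /f; case: cid.
have fM : {morph f : x y / x * y}.
  by move=> x y; apply: kappa_inj; rewrite kappaM !fE FM !gnorm.
have fS g : exists y, f y = g.
  have [|y yE] := proj1 (Fim (t^-1 * kappa g * t)).
    rewrite !posn_comp posnV -{1}tk permK.
    by have -> : posn (kappa g) (p4 3) = p4 3 by apply/kappa_image; exists g.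
  by exists y; apply: kappa_inj; rewrite fE yE !gnorm.
apply: (derived_iso fM); exists (fun g => sval (cid (fS g))).
  move=> y; apply: Finj; apply: (mulgI t); apply: (mulIg t^-1).
  by rewrite -!fE (svalP (cid (fS (f y)))).
by move=> g; exact: (svalP (cid (fS g))).
Qed.

(** * Orders and bubble sorts *)

(* The label 0 stands for the origin, the others for the points of a
   configuration. *)
Definition labels : seq nat := [:: 0; 1; 2; 3]%N.
Definition orders : seq (seq nat) := permutations labels.

Lemma ordersP C : (C \in orders) = perm_eq C labels.
Proof. by rewrite mem_permutations perm_sym. Qed.

Definition before (C : seq nat) (a b : nat) : bool := (index a C < index b C)%N.

Definition oswap (i : nat) (C : seq nat) : seq nat :=
  match C, i with
  | [:: a; b; c; d], 0%N => [:: b; a; c; d]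
  | [:: a; b; c; d], 1%N => [:: a; c; b; d]
  | [:: a; b; c; d], _ => [:: a; b; d; c]
  | _, _ => C
  end.

Definition descent (J C : seq nat) (i : nat) : bool :=
  before J (nth 0%N C i.+1) (nth 0%N C i).

(* The steps of a bubble sort turning the order C into the order J. *)
Fixpoint gallery (n : nat) (C J : seq nat) : seq nat :=
  if n is n'.+1 then
    if descent J C 0%N then 0%N :: gallery n' (oswap 0%N C) J
    else if descent J C 1%N then 1%N :: gallery n' (oswap 1%N C) J
    else if descent J C 2%N then 2%N :: gallery n' (oswap 2%N C) J
    else [::]
  else [::].

Definition sigma (i : nat) : BB :=
  match i with 0%N => sigma1 | 1%N => sigma2 | _ => sigma3 end.

Definition word_sigma (s : seq nat) : BB := foldr (fun i x => sigma i * x) 1 s.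

(** Four labels have six pairs and each step removes one inversion, so six steps suffice. The value
    is the positive permutation braid leading from C to J. *)
Definition rho (C J : seq nat) : BB := word_sigma (gallery 6 C J).

Definition all_pairs (P : nat -> nat -> bool) : bool := all (fun a => all (P a) labels) labels.

Lemma all_pairsP (P : nat -> nat -> bool) :
  reflect (forall a b, a \in labels -> b \in labels -> P a b) (all_pairs P).
Proof.
apply: (iffP allP) => [H a b al bl|H a al]; last by apply/allP => b; exact: H.
by have /allP := H a al; apply.
Qed.

(** In Coxeter terms, J lies on a geodesic from C to K, so that the lengths of the permutation
    braids add up. *)
Definition aligned (C J K : seq nat) : bool :=
  all_pairs (fun a b => ~~ [&& before C a b, before J b a & before K a b]).

Definition eval_gallery (s : seq nat) : BB := foldr (fun i x => BB_mul (sigma i) x) 1 s.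

Lemma word_sigmaE s : word_sigma s = eval_gallery s.
Proof. by rewrite /word_sigma; elim: s => //= i s ->; rewrite BB_mulE. Qed.

Definition isorder (C : seq nat) : bool := perm_eq C labels.

Lemma isorder_orders C : isorder C = (C \in orders).
Proof. by rewrite ordersP. Qed.

Lemma isorder_uniq C : isorder C -> uniq C.
Proof. by move=> /perm_uniq ->. Qed.

Lemma isorder_size C : isorder C -> size C = 4%N.
Proof. by move=> /perm_size ->. Qed.

Lemma isorder_mem C : isorder C -> C =i labels.
Proof. exact: perm_mem. Qed.

Lemma oswap_perm i C : perm_eq (oswap i C) C.
Proof.
case: C => [|a [|b [|c [|d [|e C]]]]]; case: i => [|[|i]]; rewrite ?perm_refl //=.
- exact/permPl/(perm_catCA [:: b] [:: a]).
- by rewrite perm_cons; exact/permPl/(perm_catCA [:: c] [:: b]).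
- by rewrite !perm_cons; exact/permPl/(perm_catCA [:: d] [:: c] [::]).
Qed.

Lemma isorder_oswap i C : isorder C -> isorder (oswap i C).
Proof. by apply: perm_trans; exact: oswap_perm. Qed.

Lemma gallery_end C J : isorder C -> isorder J ->
  foldl (fun D i => oswap i D) C (gallery 6 C J) = J.
Proof.
have H : all (fun C => all (fun J =>
    foldl (fun D i => oswap i D) C (gallery 6 C J) == J) orders) orders.
  by vm_compute.
rewrite !isorder_orders => Co Jo.
by move/allP: H => /(_ C Co) /allP /(_ J Jo) /eqP.
Qed.

Section Relabel.
Context (f : nat -> nat) (C : seq nat).
Hypothesis fI : {in C &, injective f}.

Lemma index_map_in a : a \in C -> index (f a) (map f C) = index a C.
Proof.
elim: C fI => //= b s IH inj; rewrite inE eq_sym.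
have [->|ba /= as_] := eqVneq b a; first by rewrite eqxx.
have -> : (f b == f a) = false.
  by apply/eqP => e; move: ba; rewrite (inj b a) ?eqxx ?inE ?eqxx ?as_ ?orbT.
rewrite IH // => x y xs ys; apply: inj; by rewrite inE ?xs ?ys orbT.
Qed.

Lemma before_map a b : a \in C -> b \in C -> before (map f C) (f a) (f b) = before C a b.
Proof. by move=> aC bC; rewrite /before !index_map_in. Qed.

End Relabel.

Lemma oswap_map f i C : oswap i (map f C) = map f (oswap i C).
Proof. by case: C => [|a [|b [|c [|d [|e C]]]]]; case: i => [|[|i]]. Qed.

Lemma isorder_map_inj (f : nat -> nat) C J : {in labels &, injective f} -> isorder C -> isorder J ->
  {in C &, injective f} /\ C =i J.
Proof.
move=> fI oC oJ; split=> [x y|x]; last by rewrite !isorder_mem.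
by rewrite !isorder_mem //; exact: fI.
Qed.

Lemma descent_map (f : nat -> nat) C J i : {in labels &, injective f} -> isorder C -> isorder J ->
  (i < 3)%N -> descent (map f J) (map f C) i = descent J C i.
Proof.
move=> fI oC oJ i3; rewrite /descent !(nth_map 0%N) ?isorder_size //; last by lia.
have [fC _] := isorder_map_inj fI oJ oC.
by rewrite before_map // isorder_mem // -(isorder_mem oC) mem_nth // isorder_size //; lia.
Qed.

Lemma gallery_map (f : nat -> nat) n C J : {in labels &, injective f} -> isorder C -> isorder J ->
  gallery n (map f C) (map f J) = gallery n C J.
Proof.
move=> fI; elim: n C => //= n IH C oC oJ.
by rewrite !descent_map // !oswap_map !IH // isorder_oswap.
Qed.

Lemma rho_map (f : nat -> nat) C J : {in labels &, injective f} -> isorder C -> isorder J ->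
  rho (map f C) (map f J) = rho C J.
Proof. by move=> fI oC oJ; rewrite /rho gallery_map. Qed.

Definition rho_check (J K : seq nat) : bool :=
  aligned labels J K ==>
  (BB_word (eval_gallery (gallery 6 labels K)) ==
   BB_word (BB_mul (eval_gallery (gallery 6 labels J)) (eval_gallery (gallery 6 J K)))).

Lemma rhoE C J : rho C J = eval_gallery (gallery 6 C J).
Proof. exact: word_sigmaE. Qed.

(* Without this, comparing two instances of rho unfolds the bubble sort. *)
Opaque rho.

Lemma rho_checkP J K : rho_check J K -> aligned labels J K ->
  rho labels K = rho labels J * rho J K.
Proof.
move=> /implyP H /H /eqP /BB_word_inj E.
by rewrite [RHS]BB_mulE !rhoE.
Qed.

Lemma rho_checked : all (fun J => all (rho_check J) orders) orders.
Proof. by vm_compute. Qed.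

(** Relabelling turns C into the standard order; what remains are the 24 x 24 pairs of orders
    evaluated in [rho_checked]. *)
Lemma rho_aligned C J K : isorder C -> isorder J -> isorder K -> aligned C J K ->
  rho C K = rho C J * rho J K.
Proof.
move=> oC oJ oK al; pose f a := index a C.
have fI : {in labels &, injective f}.
  move=> a b al' bl /(congr1 (nth 0%N C)).
  by rewrite /f !nth_index ?isorder_mem.
have fC : map f C = labels.
  have H : all (fun C => map (index^~ C) C == labels) orders by vm_compute.
  by move: oC; rewrite isorder_orders => /(allP H) /eqP.
have fo D : isorder D -> isorder (map f D).
  by move=> oD; rewrite /isorder -fC; apply: perm_map; rewrite (perm_trans oD) // perm_sym.
rewrite -(rho_map fI oC oK) -(rho_map fI oC oJ) -(rho_map fI oJ oK) fC.
have := rho_checked => /allP /(_ (map f J)); rewrite -isorder_orders => /(_ (fo _ oJ)).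
move=> /allP /(_ (map f K)); rewrite -isorder_orders => /(_ (fo _ oK)) /rho_checkP; apply.
apply/all_pairsP => a b; rewrite -{1 2}fC => /mapP[a' a'C ->] /mapP[b' b'C ->].
rewrite -fC !before_map //; first (move/all_pairsP: al; apply; by rewrite -(isorder_mem oC)).
all: try by move=> x y; rewrite !isorder_mem //; exact: fI.
all: by rewrite isorder_mem // -(isorder_mem oC).
Qed.

Lemma before_oswap C i a b : isorder C -> a \in labels -> b \in labels ->
  before (oswap i C) a b -> before C a b \/ (a = nth 0%N C (minn i 2).+1 /\ b = nth 0%N C (minn i 2)).
Proof.
have H : all (fun C => all (fun i => all_pairs (fun a b => before (oswap i C) a b ==>
   (before C a b || ((a == nth 0%N C (minn i 2).+1) && (b == nth 0%N C (minn i 2))))))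
   [:: 0; 1; 2]%N) orders by vm_compute.
move=> oC al bl.
have -> : oswap i C = oswap (minn i 2) C.
  by case: C {oC} => [|? [|? [|? [|? [|? ?]]]]] //; case: i => [|[|i]].
have i2 : minn i 2 \in [:: 0; 1; 2]%N.
  by case: i => [|[|[|i]]].
move: oC; rewrite isorder_orders => /(allP H) /allP /(_ _ i2) /all_pairsP /(_ a b al bl).
move=> /implyP h /h /orP[->|/andP[/eqP-> /eqP->]]; [by left|right; split=> //].
  by case: i {i2 h} => [|[|[|i]]].
by case: i {i2 h} => [|[|[|i]]].
Qed.

Lemma before_total (C : seq nat) a b : a \in C -> b \in C -> a != b -> before C a b \/ before C b a.
Proof.
rewrite /before => aC bC ab.
case: (ltngtP (index a C) (index b C)); [by left|by right|].
by move=> /(congr1 (nth 0%N C)); rewrite !nth_index // => e; rewrite e eqxx in ab.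
Qed.

(** * Planar charts and the order by imaginary parts *)

Section Planar.
Context (R : realDomainType).
Local Open Scope ring_scope.
Implicit Types x y : nat -> R.

(* (dx, dy) does not lie on the closed negative real half-axis *)
Definition offray (dx dy : R) : bool := (dy != 0) || (0 < dx).

Definition good x y (C : seq nat) : bool :=
  all_pairs (fun a b => before C a b ==> offray (x b - x a) (y b - y a)).

(** Breaking ties by the real part is what puts a configuration into the chart of its own order
    ([good_ordIm]). *)
Definition leIm x y (a b : nat) : bool := (y a < y b) || (y a == y b) && (x a <= x b).

Definition ordIm x y : seq nat := sort (leIm x y) labels.

Definition distinct x y : Prop :=
  forall a b, a \in labels -> b \in labels -> a != b -> ~~ ((x a == x b) && (y a == y b)).

Lemma goodP x y C : reflect
  (forall a b, a \in labels -> b \in labels -> before C a b -> offray (x b - x a) (y b - y a))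
  (good x y C).
Proof.
by apply: (iffP (all_pairsP _)) => H a b al bl; [move=> ?; apply: (implyP (H a b al bl))
  | apply/implyP; exact: H].
Qed.

Lemma leIm_total x y : total (leIm x y).
Proof. by rewrite /leIm => a b; case: (ltgtP (y a) (y b)) => //= _; exact: le_total. Qed.

Lemma leIm_trans x y : transitive (leIm x y).
Proof.
rewrite /leIm => b a c; case: (ltgtP (y a) (y b)) => //= ab.
  by case: (ltgtP (y b) (y c)) => //= bc; rewrite ?(lt_trans ab bc) // -bc ab.
rewrite ab; case: (ltgtP (y b) (y c)) => //= bc; exact: le_trans.
Qed.

Lemma ordIm_order x y : isorder (ordIm x y).
Proof. by rewrite /isorder perm_sort. Qed.

Lemma ordIm_before x y a b : before (ordIm x y) a b -> b \in labels -> leIm x y a b.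
Proof.
rewrite /before => ab bl.
have bJ : b \in ordIm x y by rewrite isorder_mem // ordIm_order.
have aJ : a \in ordIm x y by rewrite -index_mem (ltn_trans ab) // index_mem.
have := sort_sorted (leIm_total x y) labels.
move=> /(sorted_ltn_nth (@leIm_trans x y) 0%N) /(_ (index a (ordIm x y)) (index b (ordIm x y))).
by rewrite !inE !index_mem => /(_ aJ bJ ab); rewrite !nth_index.
Qed.

Lemma good_ordIm x y : distinct x y -> good x y (ordIm x y).
Proof.
move=> d; apply/goodP => a b al bl ab.
have nab : a != b by apply/eqP => e; move: ab; rewrite /before e ltnn.
have := ordIm_before ab bl; rewrite /leIm /offray subr_eq0 subr_gt0.
have := d a b al bl nab.
rewrite [y b == _]eq_sym; case: (ltgtP (y a) (y b)) => //= _; rewrite andbT.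
by rewrite lt_neqAle => -> ->.
Qed.

(** If the imaginary parts were equal, the chart would force the real part to increase from a to b,
    and the tie-break would not exchange them. The inequality is therefore strict. *)
Lemma good_exchanged x y C a b : good x y C -> a \in labels -> b \in labels ->
  before C a b -> before (ordIm x y) b a -> y b < y a.
Proof.
move=> /goodP g al bl ab /ordIm_before /(_ al).
have := g a b al bl ab; rewrite /offray /leIm subr_eq0 subr_gt0.
by case: (ltgtP (y b) (y a)) => //= _; rewrite ltNge => /negbTE ->.
Qed.

Lemma descent_exchanged x y C i : isorder C -> (i < 3)%N -> good x y C ->
  descent (ordIm x y) C i -> y (nth 0%N C i.+1) < y (nth 0%N C i).
Proof.
move=> oC i3 g de.
have il k : (k < 4)%N -> nth 0%N C k \in labels.
  by move=> k4; rewrite -(isorder_mem oC) mem_nth // isorder_size.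
apply: (good_exchanged g) => //; [apply: il; lia|exact: il|].
by rewrite /before !index_uniq ?isorder_size ?isorder_uniq //; lia.
Qed.

Lemma good_oswap x y C i : isorder C -> (i < 3)%N -> good x y C ->
  y (nth 0%N C i.+1) != y (nth 0%N C i) -> good x y (oswap i C).
Proof.
move=> oC i3 /goodP g yi; apply/goodP => a b al bl /(before_oswap oC al bl).
have -> : minn i 2 = i by lia.
by case=> [|[-> ->]]; [exact: g | rewrite /offray subr_eq0 eq_sym yi].
Qed.

(** A pair exchanged at the centre is separated by a strict inequality of imaginary parts; this
    inequality is still valid at (x, y) and prevents exchanging the pair back. *)
Lemma aligned_near x0 y0 x y C : isorder C -> good x0 y0 C ->
  (forall a b, a \in labels -> b \in labels -> y0 a < y0 b -> y a < y b) ->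
  aligned C (ordIm x0 y0) (ordIm x y).
Proof.
move=> oC g near; apply/all_pairsP => a b al bl.
apply/negP => /and3P[ab ba] /ordIm_before /(_ bl); rewrite /leIm.
have := near _ _ bl al (good_exchanged g al bl ab ba).
by case: (ltgtP (y a) (y b)).
Qed.

Lemma ordIm_map (f : nat -> nat) x y : {in labels &, injective f} ->
  {in labels, forall a, f a \in labels} -> distinct x y ->
  map f (ordIm (x \o f) (y \o f)) = ordIm x y.
Proof.
move=> fI fl d; set J := ordIm _ _.
have oJ : isorder J by exact: ordIm_order.
have -> : map f J = sort (leIm x y) (map f labels).
  by rewrite /J /ordIm sort_map.
have fP : perm_eq (map f labels) labels.
  have fu : uniq (map f labels) by rewrite map_inj_in_uniq.
  apply: uniq_perm => //.
  by have [|//|_ e] := uniq_min_size fu (s2 := labels); [move=> _ /mapP[a al ->]; exact: fl|exact: e].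
apply/perm_sort_inP => //.
- by move=> a b _ _; exact: leIm_total.
- by move=> a b c _ _ _; exact: leIm_trans.
- move=> _ _ /mapP[a al ->] /mapP[b bl ->] /andP[].
  rewrite /leIm; have := d (f a) (f b) (fl _ al) (fl _ bl).
  have [//|_ /(_ isT)] := eqVneq (f a) (f b).
  case: (ltgtP (y (f a)) (y (f b))) => //= _; rewrite andbT => nx h1 h2.
  by rewrite eq_le h1 h2 in nx.
Qed.

End Planar.

(** * Paths and classes of loops *)

Section Paths.
Local Open Scope ring_scope.
Context (R : realType) (X : topologicalType).
Local Notation I := (unit_interval R).
Implicit Types f g h k : I -> X.

(** Two paths in the parameter plane are joined by straight segments; [F] only has to be constant on
    the segments traced by their two ends. *)
Lemma square_homotopic (F : R * R -> X) (a1 a2 b1 b2 : R -> R) :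
  continuous F -> continuous a1 -> continuous a2 -> continuous b1 -> continuous b2 ->
  (forall s, 0 <= s <= 1 ->
    F ((1 - s) * a1 0 + s * b1 0, (1 - s) * a2 0 + s * b2 0) = F (a1 0, a2 0)) ->
  (forall s, 0 <= s <= 1 ->
    F ((1 - s) * a1 1 + s * b1 1, (1 - s) * a2 1 + s * b2 1) = F (a1 1, a2 1)) ->
  @homotopic R X (fun t => F (a1 (valI t), a2 (valI t))) (fun t => F (b1 (valI t), b2 (valI t))).
Proof.
move=> cF ca1 ca2 cb1 cb2 h0 h1.
pose L (a b : R -> R) (z : I * I) : R := (1 - valI z.1) * a (valI z.2) + valI z.1 * b (valI z.2).
have cL a b : continuous a -> continuous b -> continuous (L a b).
  move=> ca cb.
  have cv1 : continuous (fun z : I * I => valI z.1).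
    by apply: cont_comp; [exact: cont_fst | exact: valI_continuous].
  have cv2 : continuous (fun z : I * I => valI z.2).
    by apply: cont_comp; [exact: cont_snd | exact: valI_continuous].
  apply: cont_add; apply: cont_mul => //.
  + by apply: cont_sub => //; exact: cst_continuous.
  + by apply: cont_comp; [exact: cv2 | exact: ca].
  + by apply: cont_comp; [exact: cv2 | exact: cb].
exists (fun z => F (L a1 b1 z, L a2 b2 z)); split; rewrite /L /=.
- by apply: cont_comp cF; apply: cont_pair; exact: cL.
- by move=> t; rewrite valI0 subr0 !mul1r !mul0r !addr0.
- by move=> t; rewrite valI1 subrr !mul1r !mul0r !add0r.
- by move=> s; rewrite valI0 h0 // valI_bounds.
- by move=> s; rewrite valI1 h1 // valI_bounds.
Qed.

Lemma reparam_homotopic (p f g : I -> X) (a b : R -> R) :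
  continuous p -> continuous a -> continuous b -> a 0 = b 0 -> a 1 = b 1 ->
  (forall t, f t = p (clampI (a (valI t)))) ->
  (forall t, g t = p (clampI (b (valI t)))) -> homotopic f g.
Proof.
by move=> cp ca cb e0 e1 /funext -> /funext ->; exact: (homotopic_reparam cp ca cb e0 e1).
Qed.

Lemma concatA f g h : continuous f -> continuous g -> continuous h ->
  f one = g zero -> g one = h zero ->
  homotopic (concat f (concat g h)) (concat (concat f g) h).
Proof.
move=> cf cg ch fg gh.
(* The reparametrization carries [0, 1/2], [1/2, 3/4], [3/4, 1] onto [0, 1/4], [1/4, 1/2], [1/2, 1];
   its slopes increase, so it is a maximum of three affine maps. *)
pose a (t : R) := Num.max (t / 2) (Num.max (t - 4^-1) (2 * t - 1)).
apply: (@reparam_homotopic (concat (concat f g) h) _ _ a id).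
- apply: concat_continuous => //; last by rewrite concat1.
  exact: concat_continuous.
- apply: cont_max.
    by apply: cont_mul; [exact: id_continuous | exact: cst_continuous].
  apply: cont_max; last exact: affine_cont.
  by apply: cont_sub; [exact: id_continuous | exact: cst_continuous].
- exact: id_continuous.
- by rewrite /a mul0r max_l // ge_max; apply/andP; split; lra.
- by rewrite /a [X in Num.max _ X]max_r ?max_r; lra.
- move=> t; have t01 := valI_bounds t; rewrite /concat.
  have [t1|t1] := leP (valI t) 2^-1.
    have -> : a (valI t) = valI t / 2.
      by rewrite /a max_l // ge_max; apply/andP; split; lra.
    rewrite (_ : valI (clampI _) = valI t / 2); last by rewrite clampIE //; lra.
    rewrite ifT; last lra.
    rewrite (_ : valI (clampI _) = valI t); last by rewrite clampIE //; lra.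
    by rewrite t1.
  rewrite (_ : valI (clampI (2 * valI t - 1)) = 2 * valI t - 1);
    last by rewrite clampIE //; lra.
  have [t2|t2] := leP (2 * valI t - 1) 2^-1.
    have -> : a (valI t) = valI t - 4^-1.
      by rewrite /a [X in Num.max _ X]max_l ?max_r; lra.
    rewrite (_ : valI (clampI (valI t - _)) = valI t - 4^-1);
      last by rewrite clampIE //; lra.
    rewrite ifT; last lra.
    rewrite (_ : valI (clampI _) = 2 * valI t - 2^-1);
      last by rewrite clampIE //; lra.
    rewrite ifF; last by apply/negbTE; lra.
    by congr (g (clampI _)); lra.
  have -> : a (valI t) = 2 * valI t - 1.
    by rewrite /a [X in Num.max _ X]max_r ?max_r; lra.
  rewrite (_ : valI (clampI _) = 2 * valI t - 1);
    last by rewrite clampIE //; lra.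
  by rewrite leNgt t2.
- by move=> t; rewrite clampI_val.
Qed.

Lemma concat_id f : continuous f -> homotopic (concat f (fun=> f one)) f.
Proof.
move=> cf; apply: (@reparam_homotopic f _ _ (fun t => Num.min (2 * t) 1) id) => //.
- apply: cont_min; last exact: cst_continuous.
  by apply: cont_mul; [exact: cst_continuous | exact: id_continuous].
- exact: id_continuous.
- by rewrite min_l //; lra.
- by rewrite min_r; lra.
- move=> t; rewrite /concat; case: leP => t1; first by rewrite min_l //; lra.
  by rewrite min_r ?clampI1 //; lra.
- by move=> t; rewrite clampI_val.
Qed.

Lemma reverse_continuous f : continuous f -> continuous (reverse f).
Proof.
move=> cf; apply: cont_comp cf.
apply: (@cont_comp _ _ _ (fun t : I => 1 - valI t) (@clampI R));
  last exact: clampI_continuous.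
by apply: cont_sub; [exact: cst_continuous | exact: valI_continuous].
Qed.

Lemma reverse0 f : reverse f zero = f one.
Proof. by rewrite /reverse valI0 subr0 clampI1. Qed.

Lemma reverse1 f : reverse f one = f zero.
Proof. by rewrite /reverse valI1 subrr clampI0. Qed.

Lemma reverseK f : reverse (reverse f) = f.
Proof.
apply/funext => t; rewrite /reverse clampIE; last by have := valI_bounds t; lra.
by rewrite opprB addrC subrK clampI_val.
Qed.

Lemma concat_reverse f : continuous f -> homotopic (concat f (reverse f)) (fun=> f zero).
Proof.
move=> cf; apply: (@reparam_homotopic f _ _ (fun t => Num.min (2 * t) (2 - 2 * t)) (cst 0)) => //.
- apply: cont_min.
    by apply: cont_mul; [exact: cst_continuous | exact: id_continuous].
  apply: cont_sub; first exact: cst_continuous.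
  by apply: cont_mul; [exact: cst_continuous | exact: id_continuous].
- exact: cst_continuous.
- by rewrite min_l //=; lra.
- by rewrite min_r /=; lra.
- move=> t; have t01 := valI_bounds t; rewrite /concat /reverse.
  case: leP => t1; first by rewrite min_l //; lra.
  rewrite min_r; last lra.
  by rewrite clampIE; [congr (f (clampI _)); lra | lra].
Qed.

Lemma reverse_homotopic f g : homotopic f g -> homotopic (reverse f) (reverse g).
Proof.
move=> [H [cH H0 H1 Hz Ho]]; exists (fun z => H (z.1, clampI (1 - valI z.2))); split=> /=.
- apply: cont_comp cH; apply: cont_pair; first exact: cont_fst.
  apply: (@cont_comp _ _ _ (fun z : I * I => 1 - valI z.2) (@clampI R));
    last exact: clampI_continuous.
  apply: cont_sub; first exact: cst_continuous.
  by apply: cont_comp; [exact: cont_snd | exact: valI_continuous].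
- by move=> t; rewrite H0.
- by move=> t; rewrite H1.
- by move=> s; rewrite valI0 subr0 clampI1 Ho reverse0.
- by move=> s; rewrite valI1 subrr clampI0 Hz reverse1.
Qed.

Lemma reverse_concat f g : f one = g zero ->
  reverse (concat f g) = concat (reverse g) (reverse f).
Proof.
move=> fg; apply/funext => t; have t01 := valI_bounds t; rewrite /reverse /concat.
rewrite clampIE; last lra.
have [t1|t1|t1] := ltgtP (valI t) 2^-1.
- rewrite ifF; last by apply/negbTE; lra.
  by rewrite clampIE; [congr (g (clampI _)); lra | lra].
- rewrite ifT; last by lra.
  by rewrite clampIE; [congr (f (clampI _)); lra | lra].
- rewrite t1 ifT; last by lra.
  rewrite divff ?subrr ?pnatr_eq0 // (_ : 2 * (1 - 2^-1) = 1); last by lra.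
  by rewrite clampIE ?subrr ?clampI0 ?clampI1 //; lra.
Qed.

End Paths.

Section Classes.
Local Open Scope ring_scope.
Local Open Scope quotient_scope.
Context (R : realType) (X : topologicalType) (b : X).
Local Notation I := (unit_interval R).
Local Notation pi1 := (@fundamental_group R X b).
Local Open Scope group_scope.

(** Loops are treated as plain functions with a class attached, so that concatenations of paths need
    not carry their ends in the type. *)
Definition loop_class (x : pi1) (f : I -> X) : Prop :=
  exists l : {path I from b to b in X}, \pi_pi1 l = x /\ homotopic l f.

Lemma loop_class_exists f : continuous f -> f zero = b -> f one = b ->
  exists x, loop_class x f.
Proof.
move=> cf f0 f1; exists (\pi_pi1 (mk_path cf f0 f1)), (mk_path cf f0 f1); split=> //.
exact: homotopic_refl.
Qed.

Lemma loop_class_uniq x y f : loop_class x f -> loop_class y f -> x = y.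
Proof.
move=> [l [<- lf]] [m [<- mf]]; apply/pi1_eqP.
exact: homotopic_trans lf (homotopic_sym mf).
Qed.

Lemma loop_class_homotopic x f g : homotopic f g -> loop_class x f -> loop_class x g.
Proof. by move=> fg [l [<- lf]]; exists l; split=> //; exact: homotopic_trans lf fg. Qed.

Lemma loop_classM x y f g : loop_class x f -> loop_class y g ->
  loop_class (x * y) (concat f g).
Proof.
move=> [l [<- lf]] [m [<- mg]]; exists (loop_concat l m); split.
  by rewrite -pi1_mulE.
by apply: homotopic_concat lf mg; exact: loop_ends.
Qed.

Lemma loop_class1 f : (forall t, f t = b) -> loop_class 1 f.
Proof. by move=> /funext ->; exists (@loop_cst R X b); split=> //; apply/homotopic_refl/loop_continuous. Qed.

Definition from_base (f : I -> X) : Prop := continuous f /\ f zero = b.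

Definition diff_class (f g : I -> X) (x : pi1) : Prop := loop_class x (concat f (reverse g)).

Implicit Types f g h k : I -> X.

Lemma diff_cont f g : from_base f -> from_base g -> f one = g one ->
  continuous (concat f (reverse g)).
Proof.
move=> [cf _] [cg _] fg; apply: concat_continuous => //; last by rewrite reverse0.
exact: reverse_continuous.
Qed.

Lemma diff_exists f g : from_base f -> from_base g -> f one = g one ->
  exists x, diff_class f g x.
Proof.
move=> bf bg fg; apply: loop_class_exists; first exact: diff_cont.
  by rewrite concat0; case: bf.
by rewrite concat1 reverse1; case: bg.
Qed.

Lemma diff_uniq f g x y : diff_class f g x -> diff_class f g y -> x = y.
Proof. exact: loop_class_uniq. Qed.

Lemma diff_homotopic f f' g g' x : from_base f -> from_base g -> f one = g one ->
  homotopic f f' -> homotopic g g' -> diff_class f g x -> diff_class f' g' x.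
Proof.
move=> bf bg fg ff gg; apply: loop_class_homotopic.
by apply: homotopic_concat => //; [rewrite reverse0 | exact: reverse_homotopic].
Qed.

Lemma diff_trans f g h x y : from_base f -> from_base g -> from_base h ->
  f one = g one -> g one = h one ->
  diff_class f g x -> diff_class g h y -> diff_class f h (x * y).
Proof.
move=> [cf f0] [cg g0] [ch h0] fg gh fgx ghy.
apply: loop_class_homotopic (loop_classM fgx ghy).
have crg := reverse_continuous cg; have crh := reverse_continuous ch.
have c1 : continuous (concat f (reverse g)) by apply: diff_cont.
have c2 : continuous (concat g (reverse h)) by apply: diff_cont.
have ef : f one = reverse g zero by rewrite reverse0.
have eg : g one = reverse h zero by rewrite reverse0.
have egg : reverse g one = g zero by rewrite reverse1.
apply: (homotopic_trans (g := concat f (concat (reverse g) (concat g (reverse h))))).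
  by apply/homotopic_sym/concatA => //; rewrite concat0.
apply: homotopic_concat; [by rewrite concat0|exact: homotopic_refl|].
apply: (homotopic_trans (g := concat (concat (reverse g) g) (reverse h))).
  exact: concatA.
have := concat_reverse crg; rewrite reverseK => gg.
apply: (homotopic_trans (g := concat (fun=> reverse g zero) (reverse h))).
  apply: homotopic_concat; [by rewrite concat1|exact: gg|exact: homotopic_refl].
have := concat_id ch; rewrite gh in eg *.
move=> /reverse_homotopic; rewrite reverse_concat // => H.
by rewrite reverse0 gh.
Qed.

Lemma diff_refl f : from_base f -> diff_class f f 1.
Proof.
move=> [cf f0]; apply: loop_class_homotopic (loop_class1 (f := fun=> f zero) _).
  exact/homotopic_sym/concat_reverse.
by move=> t.
Qed.

Lemma diff_sym f g x : from_base f -> from_base g -> f one = g one ->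
  diff_class f g x -> diff_class g f x^-1.
Proof.
move=> bf bg fg fgx; have [y gfy] := diff_exists bg bf (esym fg).
suff -> : x^-1 = y by [].
apply: mulg1_eq; apply: diff_uniq (diff_refl bf).
by apply: diff_trans fgx gfy.
Qed.

Lemma from_base_concat f d : from_base f -> continuous d -> f one = d zero ->
  from_base (concat f d).
Proof. by move=> [cf f0] cd fd; split; [exact: concat_continuous|rewrite concat0]. Qed.

(** The common continuation [d] is run forth and back, hence contracts. *)
Lemma diff_concat f g d x : from_base f -> from_base g -> f one = g one ->
  continuous d -> f one = d zero ->
  diff_class f g x -> diff_class (concat f d) (concat g d) x.
Proof.
move=> [cf f0] [cg g0] fg cd fd; apply: loop_class_homotopic.
have gd : g one = d zero by rewrite -fg.
have crg := reverse_continuous cg; have crd := reverse_continuous cd.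
rewrite reverse_concat //; apply: homotopic_sym.
have e1 : d one = reverse d zero by rewrite reverse0.
have e2 : reverse d one = reverse g zero by rewrite reverse0 reverse1.
apply: (homotopic_trans (g := concat (concat (concat f d) (reverse d)) (reverse g))).
  apply: concatA => //; [exact: concat_continuous|by rewrite concat1].
apply: homotopic_concat; [by rewrite concat1| |exact: homotopic_refl].
apply: (homotopic_trans (g := concat f (concat d (reverse d)))).
  exact/homotopic_sym/concatA.
apply: (homotopic_trans (g := concat f (fun=> d zero))).
  apply: homotopic_concat; [by rewrite concat0|exact: homotopic_refl|exact: concat_reverse].
by rewrite -fd; exact: concat_id.
Qed.

End Classes.

(** * Holonomy *)

Section Cousin.
Local Open Scope ring_scope.
Context (R : realType).

(** Cousin's principle, by the supremum of the x for which [P 0 x] holds. It replaces Lebesgue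
    numbers and subdivisions in all that follows. *)
Lemma interval_induction (P : R -> R -> Prop) :
  (forall a c b, a <= c -> c <= b -> P a c -> P c b -> P a b) ->
  (forall t, 0 <= t <= 1 -> exists2 e : R, 0 < e &
     forall a b, t - e <= a -> a <= b -> b <= t + e -> P a b) ->
  P 0 1.
Proof.
move=> glue loc.
pose S := [set x : R | 0 <= x <= 1 /\ P 0 x].
have S0 : S 0.
  have [|e e0 Pe] := loc 0; first by rewrite lexx ler01.
  by split; [rewrite lexx ler01 | apply: Pe; lra].
have hS : has_sup S.
  by split; [exists 0 | exists 1 => x [/andP[_ x1] _]].
have s0 : 0 <= sup S by apply: sup_upper_bound.
have s1 : sup S <= 1 by apply: ge_sup; [exists 0 | move=> x [/andP[]]].
have [|e e0 Pe] := loc (sup S); first by rewrite s0 s1.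
have [x [/andP[x0 x1] Px] xs] := sup_adherent e0 hS.
have xS : x <= sup S by apply: sup_upper_bound => //; split=> //; rewrite x0 x1.
(* Capped at 1, since the local interval around the supremum may leave [0, 1]. *)
pose y := Num.min (sup S + e) 1.
have yS : S y.
  split; first by rewrite /y le_min ler01 ge_min lexx orbT !andbT; lra.
  apply: glue Px _ => //; first by rewrite /y le_min x1 andbT; lra.
  by apply: Pe; rewrite /y; [lra | rewrite le_min x1 andbT; lra | rewrite ge_min lexx].
have : y <= sup S by apply: sup_upper_bound.
rewrite /y ge_min => /orP[|ge1]; first by lra.
case: yS; rewrite /y min_r //; lra.
Qed.

End Cousin.

Section Holonomy.
Local Open Scope ring_scope.
Context (R : realType) (E X : topologicalType) (G : groupType).
Context (q : E -> X) (tau : E -> E -> G).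
Local Open Scope group_scope.

(** The two hypotheses play the part of a flat local system on X: along local sections [tau] is a
    coboundary, and its germs do not depend on the lift. *)
Hypothesis tau_chart : forall x0 : X, exists V (s : X -> E) (h : X -> G),
  [/\ open V, V x0 & forall x, V x -> [/\ q (s x) = x, {for x, continuous s} &
      \forall x' \near x, tau (s x) (s x') = (h x)^-1 * h x'] ].

Hypothesis tau_uniq : forall (Y : topologicalType) (A : set Y) (y0 : Y) (z z' : Y -> E),
  A y0 -> {for y0, continuous z} -> {for y0, continuous z'} ->
  (\forall y \near y0, A y -> q (z y) = q (z' y)) ->
  \forall y \near y0, A y -> tau (z y0) (z y) = tau (z' y0) (z' y).

Section Horizontal.
Context (Y : topologicalType) (f : Y -> X).
Implicit Types (A : set Y) (g : Y -> G).

(** A flat section along [f]: near each point its increments are the [tau] of a lift. Restricting by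
    a set [A] rather than to a subspace keeps intervals and rectangles inside the real line and
    plane. *)
Definition horizontal A g : Prop := forall y0, A y0 -> exists z : Y -> E,
  [/\ {for y0, continuous z}, \forall y \near y0, A y -> q (z y) = f y &
      \forall y \near y0, A y -> g y = g y0 * tau (z y0) (z y)].

Lemma horizontal_sub A B g : B `<=` A -> horizontal A g -> horizontal B g.
Proof.
move=> BA H y0 /BA /H [z [cz qz gz]]; exists z; split=> //.
  by apply: filterS qz => y yz /BA.
by apply: filterS gz => y yz /BA.
Qed.

Lemma horizontal_mul A g c : horizontal A g -> horizontal A (fun y => c * g y).
Proof.
move=> H y0 /H [z [cz qz gz]]; exists z; split=> //.
by apply: filterS gz => y yz /yz ->; rewrite mulgA.
Qed.

Lemma horizontal_lift A g y0 (z : Y -> E) : horizontal A g -> A y0 ->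
  {for y0, continuous z} -> (\forall y \near y0, A y -> q (z y) = f y) ->
  \forall y \near y0, A y -> g y = g y0 * tau (z y0) (z y).
Proof.
move=> H Ay cz qz; have [z' [cz' qz' gz']] := H y0 Ay.
have tu : \forall y \near y0, A y -> tau (z y0) (z y) = tau (z' y0) (z' y).
  apply: tau_uniq => //.
  by near=> y => Ay'; rewrite (near qz y) // (near qz' y).
by near=> y => Ay'; rewrite (near tu y) //; exact: (near gz' y).
Unshelve. all: by end_near. Qed.

Lemma horizontal_diff A g g' : horizontal A g -> horizontal A g' ->
  forall y0, A y0 -> \forall y \near y0, A y -> g y * (g' y)^-1 = g y0 * (g' y0)^-1.
Proof.
move=> H H' y0 Ay; have [z [cz qz gz]] := H y0 Ay.
have gz' := horizontal_lift H' Ay cz qz.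
near=> y => Ay'; rewrite (near gz y) // (near gz' y) //.
by rewrite invgM !mulgA mulgK.
Unshelve. all: by end_near. Qed.

Lemma lift_near : continuous f -> forall y0, exists z : Y -> E,
  {for y0, continuous z} /\ \forall y \near y0, q (z y) = f y.
Proof.
move=> cf y0; have [V [s [h [oV Vy0 Vs]]]] := tau_chart (f y0).
exists (s \o f); split.
  by apply: continuous_comp; [exact: cf | have [] := Vs _ Vy0].
have : \forall y \near y0, V (f y) by exact: (cf y0 _ (open_nbhs_nbhs (conj oV Vy0))).
by apply: filterS => y Vy; have [] := Vs _ Vy.
Qed.

Lemma horizontal_glue A g1 g2 (c : Y -> R) (k : R) : continuous f -> continuous c ->
  horizontal (A `&` [set y | c y <= k]%R) g1 ->
  horizontal (A `&` [set y | k <= c y]%R) g2 ->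
  (forall y, A y -> c y = k -> g1 y = g2 y) ->
  horizontal A (fun y => if (c y <= k)%R then g1 y else g2 y).
Proof.
move=> cf cc H1 H2 e y0 Ay; have [z [cz qz]] := lift_near cf y0.
have qzA (B : set Y) : \forall y \near y0, B y -> q (z y) = f y.
  by apply: filterS qz => y ->.
exists z; split=> //; have [cy|cy|cy] := ltgtP (c y0) k.
- have nc : \forall y \near y0, (c y < k)%R by exact: (cc y0 _ (lt_nbhsl cy)).
  have gz := horizontal_lift H1 (conj Ay (ltW cy)) cz (qzA _).
  near=> y => Ay'; have cyk : (c y <= k)%R by apply: ltW; exact: (near nc y).
  by rewrite cyk; apply: (near gz y).
- have nc : \forall y \near y0, (k < c y)%R by exact: (cc y0 _ (lt_nbhsr cy)).
  have gz := horizontal_lift H2 (conj Ay (ltW cy)) cz (qzA _).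
  near=> y => Ay'; have cyk : (k < c y)%R by exact: (near nc y).
  by rewrite leNgt cyk /=; apply: (near gz y) => //; split=> //; exact: ltW.
- have c1 : (c y0 <= k)%R by rewrite cy.
  have c2 : (k <= c y0)%R by rewrite cy.
  have gz1 := horizontal_lift H1 (conj Ay c1) cz (qzA _).
  have gz2 := horizontal_lift H2 (conj Ay c2) cz (qzA _).
  near=> y => Ay'; have [cyk|cyk] := leP (c y) k; first by apply: (near gz1 y).
  by rewrite e //; apply: (near gz2 y) => //; split=> //; exact: ltW.
Unshelve. all: by end_near. Qed.

Lemma horizontal_local : continuous f -> forall y0, exists W g,
  [/\ open W, W y0 & horizontal W g].
Proof.
move=> cf y0; have [V [s [h [oV Vy0 Vs]]]] := tau_chart (f y0).
exists (f @^-1` V), (h \o f); split=> //; first by have /continuousP := cf; apply.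
move=> y1 /= Vy1; have [qs cs ts] := Vs _ Vy1.
exists (s \o f); split.
- by apply: continuous_comp; [exact: cf | exact: cs].
- have : \forall y \near y1, V (f y) by exact: (cf y1 _ (open_nbhs_nbhs (conj oV Vy1))).
  by apply: filterS => y Vy _; have [] := Vs _ Vy.
- have : \forall y \near y1, tau (s (f y1)) (s (f y)) = (h (f y1))^-1 * h (f y).
    by exact: (cf y1 _ ts).
  by apply: filterS => y /= -> _; rewrite mulVKg.
Qed.

End Horizontal.

Lemma horizontal_congr (Y : topologicalType) (f f' : Y -> X) A g g' :
  (forall y, A y -> f y = f' y) -> (forall y, A y -> g y = g' y) ->
  horizontal f A g -> horizontal f' A g'.
Proof.
move=> ff gg H y0 Ay; have [z [cz qz gz]] := H y0 Ay; exists z; split=> //.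
  by apply: filterS qz => y qy Ay'; rewrite -ff // qy.
by apply: filterS gz => y gy Ay'; rewrite -!gg // gy.
Qed.

Lemma horizontal_comp (Y Z : topologicalType) (f : Y -> X) (A : set Y) g (p : Z -> Y) (B : set Z) :
  continuous p -> (forall w, B w -> A (p w)) -> horizontal f A g -> horizontal (f \o p) B (g \o p).
Proof.
move=> cp BA H w0 /BA /H [z [cz qz gz]]; exists (z \o p); split.
- by apply: continuous_comp; [exact: cp | exact: cz].
- have qp : \forall w \near w0, A (p w) -> q (z (p w)) = f (p w) by exact: (cp w0 _ qz).
  by apply: filterS qp => w qw /BA; exact: qw.
- have gp : \forall w \near w0, A (p w) -> g (p w) = g (p w0) * tau (z (p w0)) (z (p w)).
    exact: (cp w0 _ gz).
  by apply: filterS gp => w gw /BA; exact: gw.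
Qed.

(** Two flat sections differ by a left factor that is locally constant by [horizontal_diff], hence
    constant along the path. *)
Lemma horizontal_segment (Y : topologicalType) (f : Y -> X) A g g' (p : R -> Y) :
  continuous p -> (forall t, (0 <= t <= 1)%R -> A (p t)) ->
  horizontal f A g -> horizontal f A g' ->
  g (p 0%R) * (g' (p 0%R))^-1 = g (p 1%R) * (g' (p 1%R))^-1.
Proof.
move=> cp pA H H'.
(* The local step of [interval_induction] also concerns parameters outside [0, 1], where [p] may
   leave [A]; clamping brings them back. *)
pose cl (t : R) : R := Num.max 0%R (Num.min t 1%R).
have ccl : continuous cl.
  by apply: cont_max; [exact: cst_continuous|apply: cont_min; [exact: id_continuous|exact: cst_continuous]].
have clin t : (0 <= cl t <= 1)%R.
  by rewrite /cl le_max lexx /= ge_max ler01 ge_min lexx orbT.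
pose d t := g (p (cl t)) * (g' (p (cl t)))^-1.
have [c0 c1] : cl 0%R = 0%R /\ cl 1%R = 1%R.
  by rewrite /cl min_l ?ler01 // maxxx min_r // max_r ?ler01.
suff : d 0%R = d 1%R by rewrite /d c0 c1.
apply: (@interval_induction R (fun a b => d a = d b)).
  by move=> a c b _ _ -> ->.
move=> t t01.
have [e /= e0 ed] : exists2 e : R, (0 < e)%R & forall x, (`|t - x| < e)%R -> d x = d t.
  have := horizontal_diff H H' (pA _ (clin t)).
  move=> /(cont_comp ccl cp) /nbhs_ballP[e e0 He]; exists e => // x xe.
  by apply: He => //; exact/pA/clin.
exists (e / 2)%R; first by lra.
by move=> a b ta ab bt; rewrite !ed // ltr_norml; lra.
Qed.

Section Rectangle.
Context (f : R * R -> X).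
Hypothesis cf : continuous f.

Definition rect (a b c d : R) : set (R * R) :=
  [set y | (a <= y.1 <= b)%R && (c <= y.2 <= d)%R].

Definition rect_horizontal a b c d := exists g, horizontal f (rect a b c d) g.

(** The common side is a segment, so the two sections differ on it by the constant [m], and one of
    them can be corrected. *)
Lemma rect_glue2 a b c k d : (c <= k <= d)%R -> (a <= b)%R ->
  rect_horizontal a b c k -> rect_horizontal a b k d -> rect_horizontal a b c d.
Proof.
move=> /andP[ck kd] ab [g1 H1] [g2 H2].
pose m := g1 (a, k) * (g2 (a, k))^-1.
exists (fun y => if (y.2 <= k)%R then g1 y else m * g2 y).
apply: horizontal_glue => //.
- exact: cont_snd.
- apply: horizontal_sub H1 => -[s t] /=; rewrite /rect /= => -[/andP[-> /andP[-> _]] ->].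
  by [].
- apply/horizontal_mul/(horizontal_sub _ H2) => -[s t] /=.
  by rewrite /rect /= => -[/andP[-> /andP[_ ->]] ->].
- move=> [s t]; rewrite /rect /= => /andP[/andP[sa sb] _] ->.
  have := @horizontal_segment _ f (rect a b k k) g1 g2 (fun r => (a + r * (s - a), k)%R) _ _ _ _.
  have -> : (a + 0 * (s - a) = a)%R by lra.
  have -> : (a + 1 * (s - a) = s)%R by lra.
  rewrite -/m => -> //.
  + by rewrite mulgVK.
  + apply: cont_pair; last exact: cst_continuous.
    apply: cont_add; first exact: cst_continuous.
    by apply: cont_mul; [exact: id_continuous|exact: cst_continuous].
  + move=> r r01; rewrite /rect /= lexx !andbT; nra.
  + by apply: horizontal_sub H1 => -[x y]; rewrite /rect /=; lra.
  + by apply: horizontal_sub H2 => -[x y]; rewrite /rect /=; lra.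
Qed.

Lemma rect_glue1 a k b c d : (a <= k <= b)%R -> (c <= d)%R ->
  rect_horizontal a k c d -> rect_horizontal k b c d -> rect_horizontal a b c d.
Proof.
move=> /andP[ak kb] cd [g1 H1] [g2 H2].
pose m := g1 (k, c) * (g2 (k, c))^-1.
exists (fun y => if (y.1 <= k)%R then g1 y else m * g2 y).
apply: horizontal_glue => //.
- exact: cont_fst.
- by apply: horizontal_sub H1 => -[s t] /=; rewrite /rect /= => -[/andP[/andP[-> _] ->] ->].
- apply/horizontal_mul/(horizontal_sub _ H2) => -[s t] /=.
  by rewrite /rect /= => -[/andP[/andP[_ ->] ->] ->].
- move=> [s t]; rewrite /rect /= => /andP[_ /andP[tc td]] ->.
  have := @horizontal_segment _ f (rect k k c d) g1 g2 (fun r => (k, c + r * (t - c))%R) _ _ _ _.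
  have -> : (c + 0 * (t - c) = c)%R by lra.
  have -> : (c + 1 * (t - c) = t)%R by lra.
  rewrite -/m => -> //.
  + by rewrite mulgVK.
  + apply: cont_pair; first exact: cst_continuous.
    apply: cont_add; first exact: cst_continuous.
    by apply: cont_mul; [exact: id_continuous|exact: cst_continuous].
  + move=> r r01; rewrite /rect /= lexx /=; nra.
  + by apply: horizontal_sub H1 => -[x y]; rewrite /rect /=; lra.
  + by apply: horizontal_sub H2 => -[x y]; rewrite /rect /=; lra.
Qed.

Lemma rect_sub a b c d a' b' c' d' : (a <= a')%R -> (b' <= b)%R -> (c <= c')%R -> (d' <= d)%R ->
  rect_horizontal a b c d -> rect_horizontal a' b' c' d'.
Proof.
move=> aa bb cc dd [g H]; exists g; apply: horizontal_sub H => -[x y]; rewrite /rect /=; lra.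
Qed.

Lemma square_horizontal : rect_horizontal 0%R 1%R 0%R 1%R.
Proof.
apply: (@interval_induction R (fun a b => (a <= b)%R -> rect_horizontal a b 0%R 1%R)) => //.
  move=> a c b ac cb Hac Hcb _; apply: (rect_glue1 (k := c)); rewrite ?ac ?ler01 //; auto.
move=> s s01.
suff [e e0 He] : exists2 e : R, (0 < e)%R & rect_horizontal (s - e)%R (s + e)%R 0%R 1%R.
  by exists e => // a b sa ab bs _; apply: rect_sub He.
suff H : exists2 e : R, (0 < e)%R & (0 <= 1 :> R)%R -> rect_horizontal (s - e)%R (s + e)%R 0%R 1%R.
  by case: H => e e0 He; exists e => //; apply: He.
(* The width of the strip around [s] belongs to the inductive statement: gluing two pieces takes the
   smaller of their widths. *)
apply: (@interval_induction R (fun c d => exists2 e : R, (0 < e)%R & (c <= d)%R ->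
   rect_horizontal (s - e)%R (s + e)%R c d)).
  move=> c k d ck kd [e e0 He] [e' e'0 He'].
  exists (Num.min e e'); first by rewrite lt_min e0 e'0.
  move=> _; have me : (Num.min e e' <= e)%R by rewrite ge_min lexx.
  have me' : (Num.min e e' <= e')%R by rewrite ge_min lexx orbT.
  have m0 : (0 < Num.min e e')%R by rewrite lt_min e0 e'0.
  apply: (rect_glue2 (k := k)); rewrite ?ck //; first by lra.
    by apply: rect_sub (He ck); lra.
  by apply: rect_sub (He' kd); lra.
move=> t t01; have [W [g [oW Wst H]]] := horizontal_local cf (s, t).
have [e /= e0 eW] : exists2 e : R, (0 < e)%R & ball (s, t) e `<=` W.
  by apply/nbhs_ballP; exact: open_nbhs_nbhs.
exists (e / 2)%R; first by lra.
move=> c d tc cd dt; exists (e / 2)%R; first by lra.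
move=> _; exists g; apply: horizontal_sub H => -[x y]; rewrite /rect /= => xy.
by apply: eW; split=> /=; rewrite /ball /= ltr_norml; lra.
Qed.

End Rectangle.

Local Notation I := (unit_interval R).

Definition path_horizontal (f : I -> X) (g : R -> G) : Prop :=
  horizontal (f \o @clampI R) [set t | (0 <= t <= 1)%R] g.

Lemma path_horizontal_exists f : continuous f -> exists g, path_horizontal f g.
Proof.
move=> cf; have cF : continuous (fun y : R * R => f (clampI y.2)).
  apply: (@cont_comp _ _ _ (fun y : R * R => clampI y.2) f) => //.
  apply: (@cont_comp _ _ _ (fun y : R * R => y.2) (@clampI R)); first exact: cont_snd.
  exact: clampI_continuous.
have [g H] := square_horizontal cF.
exists (fun t => g (0%R, t)).
apply: (@horizontal_comp _ _ _ _ _ (fun t : R => (0%R, t)) _ _ _ H).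
  by apply: cont_pair; [exact: cst_continuous|exact: id_continuous].
by move=> t /= t01; rewrite /rect /= lexx ler01.
Qed.

Lemma path_horizontal_uniq f g g' : path_horizontal f g -> path_horizontal f g' ->
  (g 0%R)^-1 * g 1%R = (g' 0%R)^-1 * g' 1%R.
Proof.
move=> H H'; have := @horizontal_segment _ _ _ g g' id (@id_continuous _) _ H H'.
move=> /(_ (fun _ h => h)) e.
apply: (mulgI (g 0%R)); rewrite mulVKg.
apply: (mulIg (g' 1%R)^-1); rewrite -e.
by rewrite !mulgA mulgK.
Qed.

(** The value 1 on discontinuous functions is a mere default. *)
Definition holonomy (f : I -> X) : G :=
  if pselect (continuous f) is left cf then
    let g := sval (cid (path_horizontal_exists cf)) in (g 0%R)^-1 * g 1%R
  else 1.

Lemma holonomyE f g : continuous f -> path_horizontal f g ->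
  holonomy f = (g 0%R)^-1 * g 1%R.
Proof.
move=> cf H; rewrite /holonomy; case: pselect => // cf'.
by apply: path_horizontal_uniq H; exact: (svalP (cid (path_horizontal_exists cf'))).
Qed.

Lemma holonomy_concat f f' : continuous f -> continuous f' -> f one = f' zero ->
  holonomy (concat f f') = holonomy f * holonomy f'.
Proof.
move=> cf cf' ff; have [g H] := path_horizontal_exists cf.
have [g' H'] := path_horizontal_exists cf'.
rewrite (holonomyE cf H) (holonomyE cf' H').
pose m := g 1%R * (g' 0%R)^-1.
have c2 : continuous (fun t : R => 2 * t)%R.
  by apply: cont_mul; [exact: cst_continuous|exact: id_continuous].
rewrite (@holonomyE _ (fun t => if (t <= 2^-1)%R then g (2 * t)%R else m * g' (2 * t - 1)%R)).
- rewrite invr_ge0 ler0n mulr0 ifF; last by apply/negbTE; lra.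
  by rewrite (_ : 2 * 1 - 1 = 1 :> R)%R ?mulgA //; lra.
- exact: concat_continuous.
apply: horizontal_glue.
- apply: cont_comp; [exact: clampI_continuous|exact: concat_continuous].
- exact: id_continuous.
- apply: (@horizontal_sub _ _ [set t : R | 0 <= t <= 2^-1]%R).
    by move=> t [/= /andP[-> _] ->].
  have h1 := @horizontal_comp _ _ _ _ _ (fun t : R => 2 * t)%R [set t : R | 0 <= t <= 2^-1]%R c2 _ H.
  apply: horizontal_congr (h1 _) => //= [t /andP[t0 t1]|t /=]; last by lra.
  by rewrite /concat clampIE ?t1 //; lra.
- apply: (@horizontal_sub _ _ [set t : R | 2^-1 <= t <= 1]%R).
    by move=> t [/= /andP[_ ->] ->].
  have h2 := @horizontal_comp _ _ _ _ _ (fun t : R => 2 * t - 1)%R [set t : R | 2^-1 <= t <= 1]%R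
    (@affine_cont R 2%R (-1)%R) _ H'.
  apply: horizontal_mul; apply: horizontal_congr (h2 _) => //= [t /andP[t0 t1]|t /=]; last by lra.
  rewrite /concat clampIE; last by lra.
  have [t2|//] := leP t (2^-1)%R.
  have -> : t = 2^-1%R by lra.
  by rewrite divff ?pnatr_eq0 // subrr clampI0 clampI1.
- move=> t _ ->.
  by rewrite divff ?pnatr_eq0 // subrr /m mulgVK.
Qed.

Lemma holonomy_cst x0 : holonomy (fun=> x0) = 1.
Proof.
have [V [s [h [oV Vx Vs]]]] := tau_chart x0; have [qs cs ts] := Vs _ Vx.
have c0 : continuous (fun _ : I => x0) by exact: cst_continuous.
rewrite (holonomyE (g := fun=> 1) c0) ?mulVg // => t t01.
exists (fun=> s x0); split; [exact: cst_continuous|by near=> y|].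
have := nbhs_singleton ts; rewrite mulVg => e.
by near=> y => _; rewrite e mulg1.
Unshelve. all: by end_near. Qed.

Lemma holonomy_reverse f : continuous f -> holonomy (reverse f) = (holonomy f)^-1.
Proof.
move=> cf; have [g H] := path_horizontal_exists cf.
have cr := reverse_continuous cf.
rewrite (holonomyE cf H) (holonomyE (g := fun t => g (1 - t)%R) cr).
  by rewrite subr0 subrr invgM invgK.
have cm : continuous (fun t : R => 1 - t)%R.
  by apply: cont_sub; [exact: cst_continuous|exact: id_continuous].
have h1 := @horizontal_comp _ _ _ _ _ (fun t : R => 1 - t)%R [set t : R | 0 <= t <= 1]%R cm _ H.
apply: horizontal_congr (h1 _) => //= [t t01|t /=]; last by lra.
by rewrite /reverse clampIE.
Qed.

(** One flat section over the whole square computes both holonomies along the rows s = 0 and s = 1.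
    On the two end columns the homotopy is constant, so the section takes the same values at the
    corresponding ends of the rows. *)
Lemma holonomy_homotopic f f' : continuous f -> continuous f' ->
  homotopic f f' -> holonomy f = holonomy f'.
Proof.
move=> cf cf' [H [cH H0 H1 Hz Ho]].
pose F (y : R * R) := H (clampI y.1, clampI y.2).
have cF : continuous F.
  apply: (@cont_comp _ _ _ (fun y : R * R => (clampI y.1, clampI y.2) : I * I) H) => //.
  apply: cont_pair.
    by apply: (@cont_comp _ _ _ (fun y : R * R => y.1) (@clampI R)); [exact: cont_fst|exact: clampI_continuous].
  by apply: (@cont_comp _ _ _ (fun y : R * R => y.2) (@clampI R)); [exact: cont_snd|exact: clampI_continuous].
have [g Hg] := square_horizontal cF.
have row (s : R) (k : I -> X) : (0 <= s <= 1)%R -> (forall t, H (clampI s, t) = k t) ->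
    path_horizontal k (fun t => g (s, t)).
  move=> s01 Hk.
  have cp : continuous (fun t : R => (s, t)).
    by apply: cont_pair; [exact: cst_continuous|exact: id_continuous].
  have := @horizontal_comp _ _ _ _ _ (fun t : R => (s, t)) [set t : R | 0 <= t <= 1]%R cp _ Hg.
  move=> h; apply: horizontal_congr (h _) => //= [t _|t t01]; first by rewrite /F /= Hk.
  by rewrite /rect /= s01 t01.
have col (t : R) x0 : (0 <= t <= 1)%R -> (forall s, H (s, clampI t) = x0) ->
    g (1%R, t) = g (0%R, t).
  move=> t01 Hx; apply: (mulgI (g (0%R, t))^-1); rewrite mulVg.
  have c0 : continuous (fun _ : I => x0) by exact: cst_continuous.
  rewrite -(holonomy_cst x0); apply/esym; apply: (@holonomyE _ (fun s => g (s, t))) => //.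
  have cp : continuous (fun s : R => (s, t)).
    by apply: cont_pair; [exact: id_continuous|exact: cst_continuous].
  have := @horizontal_comp _ _ _ _ _ (fun s : R => (s, t)) [set s : R | 0 <= s <= 1]%R cp _ Hg.
  move=> h; apply: horizontal_congr (h _) => //= [s _|s s01]; first by rewrite /F /= Hx.
  by rewrite /rect /= s01 t01.
have i0 : (0 <= (0 : R) <= 1)%R by apply/andP; split; [exact: lexx|exact: ler01].
have i1 : (0 <= (1 : R) <= 1)%R by apply/andP; split; [exact: ler01|exact: lexx].
rewrite (holonomyE cf (row 0%R f i0 H0)) (holonomyE cf' (row 1%R f' i1 H1)).
by rewrite (col 0%R _ i0 Hz) (col 1%R _ i1 Ho).
Qed.

End Holonomy.

(** * Configuration spaces *)

Section IntoSubspace.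
Context (Y T : topologicalType) (A : set T).

Lemma set_val_continuous : continuous (fun x : set_type A => val x).
Proof. exact: initial_continuous. Qed.

Lemma into_set_continuous (f : Y -> set_type A) :
  continuous (fun y => val (f y)) -> continuous f.
Proof. by move=> cf; apply: continuous_comp_initial. Qed.

End IntoSubspace.

Lemma into_ptws_continuous (Y T : topologicalType) (I : choiceType) (f : Y -> {ptws I -> T}) :
  (forall i, continuous (fun y => f y i)) -> continuous f.
Proof.
move=> cf y; apply/cvg_sup => i.
exact: (@continuous_comp_initial _ _ _ (fun g : {ptws I -> T} => g i) f (cf i) y).
Qed.

Section Configurations.
Context (M : topologicalType).
Local Notation E := (config 3 M).
Local Notation X := (unordered_config 3 M).

Definition conf_pt (e : E) (i : 'I_3) : M := (val e : 'I_3 -> M) i.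

Lemma conf_pt_continuous i : continuous (conf_pt^~ i).
Proof.
move=> e; apply: (@continuous_comp _ _ _ (fun e : E => val e : {ptws 'I_3 -> M}) (fun g => g i)).
  exact: set_val_continuous.
exact: (@proj_continuous 'I_3 (fun=> M) i).
Qed.

Lemma conf_pt_neq (e : E) i j : i != j -> conf_pt e i != conf_pt e j.
Proof. exact: (set_mem (valP e)). Qed.

Lemma conf_ext (e e' : E) : (forall i, conf_pt e i = conf_pt e' i) -> e = e'.
Proof. by move=> H; apply/val_inj/funext. Qed.

Lemma conf_build (Y : topologicalType) (F : 'I_3 -> Y -> M) :
  (forall i, continuous (F i)) -> (forall y i j, i != j -> F i y != F j y) ->
  exists f : Y -> E, continuous f /\ forall y i, conf_pt (f y) i = F i y.
Proof.
move=> cF nF.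
have mF y : (fun i => F i y) \in [set y : {ptws 'I_3 -> M} | forall i j, i != j -> y i != y j].
  by apply/mem_set => i j; exact: nF.
exists (fun y => exist _ (fun i => F i y) (mF y)); split=> //.
by apply: into_set_continuous; apply: into_ptws_continuous => i; exact: cF.
Qed.

Lemma conf_perm_in (s : {perm 'I_3}) (e : E) : (fun i => conf_pt e (s i)) \in
  [set y : {ptws 'I_3 -> M} | forall i j, i != j -> y i != y j].
Proof. by apply/mem_set => i j ij; apply: conf_pt_neq; rewrite (inj_eq perm_inj). Qed.

Definition conf_perm (s : {perm 'I_3}) (e : E) : E :=
  exist _ (fun i => conf_pt e (s i)) (conf_perm_in s e).

Lemma conf_permE s e i : conf_pt (conf_perm s e) i = conf_pt e (s i). Proof. by []. Qed.

Lemma conf_perm_continuous s : continuous (conf_perm s).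
Proof.
apply: into_set_continuous; apply: into_ptws_continuous => i.
exact: conf_pt_continuous.
Qed.

Definition quo (e : E) : X := \pi_X%qT e.

Lemma quo_continuous : continuous quo.
Proof. exact: pi_continuous. Qed.

Lemma quo_eqP (e e' : E) : quo e = quo e' <-> exists s, e' = conf_perm s e.
Proof.
split=> [/eqmodP /same_orbitP [s H]|[s ->]].
  by exists s; apply: conf_ext => i; rewrite conf_permE; exact: H.
by apply/eqmodP/same_orbitP; exists s.
Qed.

Lemma quo_perm s e : quo (conf_perm s e) = quo e.
Proof. by apply/esym/quo_eqP; exists s. Qed.

Lemma quo_surj (x : X) : exists e, quo e = x.
Proof. by exists (repr x); rewrite /quo reprK. Qed.

Lemma quo_open (U : set E) : open U -> open (quo @` U).
Proof.
move=> oU; rewrite -[open _]/(open (quo @^-1` (quo @` U))).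
have -> : quo @^-1` (quo @` U) = \bigcup_(s in [set: {perm 'I_3}]) (conf_perm s @^-1` U).
  apply/seteqP; split=> e /=.
    by move=> [e' Ue' /esym/quo_eqP [s ee]]; exists s => //=; rewrite -ee.
  by move=> [s _ Us]; exists (conf_perm s e) => //; exact: quo_perm.
apply: bigcup_open => s _; have /continuousP := @conf_perm_continuous s.
exact.
Qed.

Lemma conf_perm1 e : conf_perm 1 e = e.
Proof. by apply: conf_ext => i; rewrite conf_permE perm1. Qed.

(** W meets each orbit at most once, which determines the section over its image; it is continuous
    because [quo] is open. *)
Lemma local_section (W : set E) : open W ->
  (forall e s, W e -> W (conf_perm s e) -> s = 1) ->
  exists s : X -> E, forall x, (quo @` W) x ->
    [/\ W (s x), quo (s x) = x & {for x, continuous s}].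
Proof.
move=> oW Winj; pose s (x : X) : E := xget (repr x) [set e | W e /\ quo e = x].
have sW x : (quo @` W) x -> W (s x) /\ quo (s x) = x.
  move=> [e We ex]; rewrite /s; case: xgetP => [e' _ []//|/(_ e)/=].
  by move=> /not_andP [].
exists s => x Wx; have [Ws qs] := sW x Wx; split=> //.
rewrite /prop_for /continuous_at => N Ns.
have [N' [[oN' N's] N'N]] : open_nbhs (s x) `&` [set B | B `<=` N] !=set0.
  by move: Ns; rewrite nbhsE => -[B oB BN]; exists B.
have xN : nbhs x (quo @` (N' `&` W)).
  apply: open_nbhs_nbhs; split; first by apply: quo_open; exact: openI.
  by exists (s x).
apply: filterS xN => _ [e [N'e We] <-] /=; apply: N'N.
have [Ws' qs'] := sW (quo e) (ex_intro2 _ _ e We erefl).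
have /quo_eqP [r er] := esym qs'; rewrite er in Ws' *.
by rewrite (Winj _ _ We Ws') conf_perm1.
Qed.

End Configurations.

Section NearReal.
Local Open Scope ring_scope.
Context (R : realType) (Y : topologicalType).
Implicit Types f g : Y -> R.

Lemma near_lt_at f g y : {for y, continuous f} -> {for y, continuous g} ->
  f y < g y -> \forall y' \near y, f y' < g y'.
Proof.
move=> cf cg fg; have c : {for y, continuous (fun y => g y - f y)}.
  exact: continuousB.
have h : 0 < g y - f y by rewrite subr_gt0.
have H : \forall y' \near y, 0 < g y' - f y' by exact: (c _ (lt_nbhsr h)).
by apply: filterS H => y'; rewrite subr_gt0.
Qed.

End NearReal.

(** * Configurations in a punctured plane, through coordinates *)

Section Coordinates.
Local Open Scope ring_scope.
Context (R : realType) (M : topologicalType) (cx cy : M -> R).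
Hypotheses (ccx : continuous cx) (ccy : continuous cy).
Hypothesis c_inj : forall m m', cx m = cx m' -> cy m = cy m' -> m = m'.
Hypothesis c_nz : forall m, ~~ ((cx m == 0) && (cy m == 0)).
(** With [c_inj] and [c_nz], this is what a homeomorphism of M onto the punctured plane provides,
    phrased for families over Y so that paths and homotopies can be built coordinatewise. *)
Hypothesis c_lift : forall (Y : topologicalType) (f g : Y -> R),
  continuous f -> continuous g -> (forall y, ~~ ((f y == 0) && (g y == 0))) ->
  exists F : Y -> M, continuous F /\ forall y, cx (F y) = f y /\ cy (F y) = g y.
Local Notation E := (config 3 M).
Local Notation X := (unordered_config 3 M).

Definition lab (k : M -> R) (e : E) (a : nat) : R :=
  if a is j.+1 then k (conf_pt e (inord j)) else 0.

Local Notation px := (lab cx).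
Local Notation py := (lab cy).

Lemma lab_continuous k a : continuous k -> continuous (fun e => lab k e a).
Proof.
move=> ck; case: a => [|j]; first exact: cst_continuous.
by apply: (cont_comp (@conf_pt_continuous _ _)).
Qed.

Lemma labels_S a : (a.+1 \in labels) = (a < 3)%N.
Proof. by rewrite !inE /=; lia. Qed.

Lemma lab_distinct e : distinct (px e) (py e).
Proof.
move=> [|i] [|j] //; rewrite ?labels_S.
- by move=> _ _ _; rewrite /= ![0 == _]eq_sym; exact: c_nz.
- by move=> _ _ _; exact: c_nz.
- move=> i3 j3; rewrite eqSS => ij; apply/negP => /andP[/eqP h1 /eqP h2].
  have := @conf_pt_neq _ e (inord i) (inord j).
  by rewrite -val_eqE /= !inordK // => /(_ ij); rewrite (c_inj h1 h2) eqxx.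
Qed.

Lemma lab_ext e e' : (forall a, a \in labels -> px e a = px e' a /\ py e a = py e' a) -> e = e'.
Proof.
move=> H; apply: conf_ext => i.
have [] := H i.+1; first by rewrite labels_S.
by rewrite /= inord_val; exact: c_inj.
Qed.

Lemma lab_build (Y : topologicalType) (f g : nat -> Y -> R) :
  (forall a, continuous (f a)) -> (forall a, continuous (g a)) ->
  (forall y, f 0%N y = 0) -> (forall y, g 0%N y = 0) ->
  (forall y, distinct (f^~ y) (g^~ y)) ->
  exists F : Y -> E, continuous F /\
    forall y a, a \in labels -> px (F y) a = f a y /\ py (F y) a = g a y.
Proof.
move=> cf cg f0 g0 d.
have H (i : 'I_3) : exists F : Y -> M, continuous F /\
    forall y, cx (F y) = f i.+1 y /\ cy (F y) = g i.+1 y.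
  apply: c_lift => // y; have := d y i.+1 0%N; rewrite labels_S f0 g0.
  by move=> /(_ (ltn_ord i) isT isT).
pose F i := sval (cid (H i)).
have [cF FE] : (forall i, continuous (F i)) /\
    forall i y, cx (F i y) = f i.+1 y /\ cy (F i y) = g i.+1 y.
  by split=> i; rewrite /F; case: cid => F' [].
have [|y i j ij|F' [cF' F'E]] := conf_build (F := F); first exact: cF.
  apply/eqP => e; have [hx hy] := FE i y; have [hx' hy'] := FE j y.
  have := d y i.+1 j.+1; rewrite !labels_S eqSS => /(_ (ltn_ord i) (ltn_ord j) ij).
  by rewrite -hx -hy -hx' -hy' e !eqxx.
exists F'; split=> // y [|a]; first by rewrite f0 g0.
rewrite labels_S => a3; rewrite /= !F'E; have := FE (inord a) y.
by rewrite inordK.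
Qed.

Definition relabel (s : {perm 'I_3}) (a : nat) : nat :=
  if a is j.+1 then (if (j < 3)%N then (s (inord j)).+1 else a) else 0%N.

Lemma relabel_in s a : a \in labels -> relabel s a \in labels.
Proof. by case: a => // j; rewrite labels_S /= => ->; rewrite labels_S. Qed.

Lemma relabel_inj s : {in labels &, injective (relabel s)}.
Proof.
move=> [|i] [|j] //=; rewrite !labels_S; [by move=> _ ->|by move=> ->|].
move=> i3 j3; rewrite i3 j3 => -[] /ord_inj /perm_inj /(congr1 val).
by rewrite /= !inordK // => ->.
Qed.

Lemma lab_perm k s e a : a \in labels -> lab k (conf_perm s e) a = lab k e (relabel s a).
Proof.
case: a => // j; rewrite labels_S /= => j3; rewrite j3 /=.
by rewrite conf_permE inord_val.
Qed.

Definition good_e (e : E) (C : seq nat) : bool := good (px e) (py e) C.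
Definition ord_e (e : E) : seq nat := ordIm (px e) (py e).

Lemma leIm_anti (x y : nat -> R) : distinct x y -> {in labels &, antisymmetric (leIm x y)}.
Proof.
move=> d a b al bl /andP[]; rewrite /leIm; have := d a b al bl.
have [//|_ /(_ isT)] := eqVneq a b.
case: (ltgtP (y a) (y b)) => //= _; rewrite andbT => nx h1 h2.
by rewrite eq_le h1 h2 in nx.
Qed.

Lemma eq_ordIm (x y x' y' : nat -> R) : distinct x y ->
  {in labels, x =1 x'} -> {in labels, y =1 y'} -> ordIm x y = ordIm x' y'.
Proof.
move=> d xx yy; have oJ := ordIm_order x y; have oJ' := ordIm_order x' y'.
apply: (@sorted_eq_in _ (leIm x y)).
- by move=> a b c _ _ _; exact: leIm_trans.
- by move=> a b; rewrite !isorder_mem //; exact: leIm_anti.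
- exact/sort_sorted/leIm_total.
- rewrite (@eq_in_sorted _ (mem labels) _ (leIm x' y')).
  + exact/sort_sorted/leIm_total.
  + by move=> a b al bl; rewrite /leIm !xx // !yy.
  + by apply/allP => a; rewrite isorder_mem.
- by apply: perm_trans oJ _; rewrite perm_sym.
Qed.

(* Otherwise comparing ord_e at two points unfolds the sorting algorithm. *)
Opaque ordIm.

Lemma ord_e_perm s e : map (relabel s) (ord_e (conf_perm s e)) = ord_e e.
Proof.
rewrite /ord_e -[RHS](ordIm_map (@relabel_inj s) (@relabel_in s) (@lab_distinct e)).
congr map; apply: eq_ordIm; [exact: lab_distinct| |] => a al; exact: lab_perm.
Qed.

Lemma ord_e_order e : isorder (ord_e e). Proof. exact: ordIm_order. Qed.

Lemma good_ord_e e : good_e e (ord_e e).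
Proof. exact/good_ordIm/lab_distinct. Qed.

Lemma relabel_inj_in s C : isorder C -> {in C &, injective (relabel s)}.
Proof. by move=> oC a b; rewrite !isorder_mem //; exact: relabel_inj. Qed.

Lemma isorder_relabel s C : isorder C -> isorder (map (relabel s) C).
Proof.
move=> oC; have u : uniq (map (relabel s) C).
  by rewrite map_inj_in_uniq ?isorder_uniq //; exact: relabel_inj_in.
apply: uniq_perm => //.
have [|//|_ h] := uniq_min_size u (s2 := labels); last exact: h.
  by move=> _ /mapP[a aC ->]; apply: relabel_in; rewrite -(isorder_mem oC).
by rewrite size_map isorder_size.
Qed.

Lemma good_e_perm s e C : isorder C -> good_e (conf_perm s e) C = good_e e (map (relabel s) C).
Proof.
move=> oC; have fC := @relabel_inj_in s C oC; have oC' := isorder_relabel s oC.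
apply/goodP/goodP => H a b al bl.
  move: (al) (bl); rewrite -(isorder_mem oC') -[b \in _](isorder_mem oC').
  move=> /mapP[a' a'C ->] /mapP[b' b'C ->]; rewrite before_map // => ab.
  rewrite -!(lab_perm _ s e) -?(isorder_mem oC) //.
  by apply: H => //; rewrite -(isorder_mem oC).
move=> ab; rewrite !lab_perm //; apply: H; rewrite ?relabel_in //.
by rewrite before_map // isorder_mem.
Qed.

Lemma near_labels (Y : topologicalType) (y0 : Y) (P : nat -> Y -> Prop) :
  (forall a, a \in labels -> \forall y \near y0, P a y) ->
  \forall y \near y0, forall a, a \in labels -> P a y.
Proof.
move=> H.
have h0 := H 0%N isT; have h1 := H 1%N isT; have h2 := H 2%N isT; have h3 := H 3%N isT.
near=> y => a; rewrite !inE => /or4P[] /eqP->.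
- by near: y.
- by near: y.
- by near: y.
- by near: y.
Unshelve. all: by end_near. Qed.

Lemma near_exchange (Y : topologicalType) (y0 : Y) (z : Y -> E) :
  {for y0, continuous z} ->
  \forall y \near y0, forall a, a \in labels -> forall b, b \in labels ->
    py (z y0) a < py (z y0) b -> py (z y) a < py (z y) b.
Proof.
move=> cz; apply: near_labels => a al; apply: near_labels => b bl.
have cp c : {for y0, continuous (fun y => py (z y) c)}.
  by apply: (@continuous_comp _ _ _ z (fun e => py e c)) => //; exact: lab_continuous.
have [h|h] := ltP (py (z y0) a) (py (z y0) b); last by near=> y.
by apply: filterS (near_lt_at (cp a) (cp b) h).
Unshelve. all: by end_near. Qed.

Definition tau (e e' : E) : BB := rho (ord_e e) (ord_e e').

(** Near y0 the triple formed by C, the order at y0 and the order at y is aligned, so [rho] is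
    multiplicative along it. *)
Lemma near_tau (Y : topologicalType) (y0 : Y) (z : Y -> E) C :
  {for y0, continuous z} -> isorder C -> good_e (z y0) C ->
  \forall y \near y0, tau (z y0) (z y) = ((rho C (ord_e (z y0)))^-1 * rho C (ord_e (z y)))%g.
Proof.
move=> cz oC gC; apply: filterS (near_exchange cz) => y H.
rewrite (@rho_aligned C (ord_e (z y0)) (ord_e (z y))) ?ord_e_order //.
  by rewrite mulKg.
by apply: aligned_near => // a b al bl; exact: H.
Qed.

Lemma tau_perm s e e' : tau (conf_perm s e) (conf_perm s e') = tau e e'.
Proof.
rewrite /tau -(ord_e_perm s e) -(ord_e_perm s e').
by apply/esym/rho_map; [exact: relabel_inj|exact: ord_e_order..].
Qed.

(** The permutation relating the lifts at y0 persists: any other one is excluded at y0 by some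
    coordinate, hence near y0, and there are finitely many of them. *)
Lemma lift_unique (Y : topologicalType) (A : set Y) (y0 : Y) (z z' : Y -> E) :
  A y0 -> {for y0, continuous z} -> {for y0, continuous z'} ->
  (\forall y \near y0, A y -> quo (z y) = quo (z' y)) ->
  exists s, \forall y \near y0, A y -> z' y = conf_perm s (z y).
Proof.
move=> Ay cz cz' qz.
have /quo_eqP [s sE] := nbhs_singleton qz Ay.
exists s.
have H r : \forall y \near y0, r != s -> z' y <> conf_perm r (z y).
  have [->|rs] := eqVneq r s; first by near=> y.
  have /existsP [i ri] : [exists i, r i != s i].
    apply: contraT; rewrite negb_exists => /forallP h; case/eqP: rs; apply/permP => i.
    by apply/eqP; have := h i; rewrite negbK.
  have cp (k : M -> R) e j : continuous k -> {for y0, continuous (fun y => lab k (conf_perm e (z y)) j)}.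
    move=> ck; apply: (@continuous_comp _ _ _ z (fun e' => lab k (conf_perm e e') j)) => //.
    exact: (cont_comp (@conf_perm_continuous _ e) (@lab_continuous k j ck)).
  have cp' (k : M -> R) j : continuous k -> {for y0, continuous (fun y => lab k (z' y) j)}.
    move=> ck; apply: (@continuous_comp _ _ _ z' (fun e' => lab k e' j)) => //.
    exact: lab_continuous.
  have neq (k : M -> R) : continuous k -> k (conf_pt (z y0) (r i)) != k (conf_pt (z y0) (s i)) ->
      \forall y \near y0, true -> z' y <> conf_perm r (z y).
    move=> ck; rewrite -!conf_permE -sE.
    have e1 : k (conf_pt (conf_perm r (z y0)) i) = lab k (conf_perm r (z y0)) i.+1.
      by rewrite /= inord_val.
    have e2 : k (conf_pt (z' y0) i) = lab k (z' y0) i.+1 by rewrite /= inord_val.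
    rewrite e1 e2 => /lt_total /orP[h|h].
      apply: filterS (near_lt_at (cp k r i.+1 ck) (cp' k i.+1 ck) h) => y hy _ ee.
      by rewrite ee ltxx in hy.
    apply: filterS (near_lt_at (cp' k i.+1 ck) (cp k r i.+1 ck) h) => y hy _ ee.
    by rewrite ee ltxx in hy.
  have [hx|hx] := eqVneq (cx (conf_pt (z y0) (r i))) (cx (conf_pt (z y0) (s i)));
    last by apply: filterS (neq cx ccx hx) => y + _; apply.
  have [hy|hy] := eqVneq (cy (conf_pt (z y0) (r i))) (cy (conf_pt (z y0) (s i)));
    last by apply: filterS (neq cy ccy hy) => y + _; apply.
  by have := conf_pt_neq (z y0) ri; rewrite (c_inj hx hy) eqxx.
have HH : \forall y \near y0, forall r, r != s -> z' y <> conf_perm r (z y).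
  exact: filter_forall.
near=> y => Ay'.
have qy : quo (z y) = quo (z' y) by apply: (near qz y).
have /quo_eqP [r rE] := qy.
have [<- //|rs] := eqVneq r s.
by exfalso; apply: (near HH y _ r rs rE).
Unshelve. all: by end_near. Qed.

Lemma tau_unique (Y : topologicalType) (A : set Y) (y0 : Y) (z z' : Y -> E) :
  A y0 -> {for y0, continuous z} -> {for y0, continuous z'} ->
  (\forall y \near y0, A y -> quo (z y) = quo (z' y)) ->
  \forall y \near y0, A y -> tau (z y0) (z y) = tau (z' y0) (z' y).
Proof.
move=> Ay cz cz' qz; have [s sE] := lift_unique Ay cz cz' qz.
have s0 := nbhs_singleton sE Ay.
by apply: filterS sE => y h /h ->; rewrite s0 tau_perm.
Qed.

Definition dist1 (k k' : M -> R) (m m' : M) : R := `|k m - k m'| + `|k' m - k' m'|.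

Lemma dist1_gt0 m m' : m != m' -> 0 < dist1 cx cy m m'.
Proof.
move=> mm; rewrite lt0r addr_ge0 // andbT paddr_eq0 // !normr_eq0 !subr_eq0.
by apply: contraNN mm => /andP[/eqP hx /eqP hy]; apply/eqP/c_inj.
Qed.

Lemma conf_section (e0 : E) C : isorder C -> good_e e0 C ->
  exists V (s : X -> E), [/\ open V, V (quo e0) & forall x, V x ->
    [/\ quo (s x) = x, {for x, continuous s} & good_e (s x) C]].
Proof.
move=> oC gC.
pose d e i j := dist1 cx cy (conf_pt e i) (conf_pt e0 j).
(* Each point of e is closer, for the l^1 distance, to its own point of e0 than to the others; at
   most one numbering of a configuration has this property. *)
pose W1 := [set e : E | forall i j, i != j -> d e i i < d e i j].
have cd i j : continuous (fun e => d e i j).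
  have cc (k : M -> R) : continuous k -> continuous (fun e : E => `|k (conf_pt e i) - k (conf_pt e0 j)|).
    move=> ck e; apply: (@continuous_comp _ _ _ (fun e : E => k (conf_pt e i) - k (conf_pt e0 j)) (fun x : R => `|x|)).
      apply: (cont_sub (f := fun e : E => k (conf_pt e i))); last exact: cst_continuous.
      by apply: (cont_comp (@conf_pt_continuous _ _)).
    exact: norm_continuous.
  by apply: cont_add; exact: cc.
have oW1 : open W1.
  rewrite openE => e We; rewrite /interior.
  have H i j : \forall e' \near e, i != j -> d e' i i < d e' i j.
    have [ijE|ijn] := eqVneq i j; first by near=> e'.
    by apply: filterS (near_lt_at (@cd _ _ e) (@cd _ _ e) (We _ _ ijn)) => e' h _.
  have HH i : \forall e' \near e, forall j, i != j -> d e' i i < d e' i j.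
    exact: filter_forall (H i).
  exact: filter_forall HH.
have W1s e s : W1 e -> W1 (conf_perm s e) -> s = 1%g.
  move=> We Wse; apply/permP => i; rewrite perm1; apply/eqP/negPn/negP => si.
  have := We (s i) i si; have := Wse i (s i).
  rewrite /d !conf_permE eq_sym => /(_ si) h1 h2.
  by have := lt_trans h1 h2; rewrite ltxx.
have [s sP] := local_section oW1 W1s.
pose W2 := [set e : E | W1 e /\ good_e e C].
have oW2 : open W2.
  rewrite openE => e [We ge]; rewrite /interior.
  have n1 : \forall e' \near e, W1 e' by exact: (open_nbhs_nbhs (conj oW1 We)).
  have cl (k : M -> R) a : continuous k -> {for e, continuous (fun e => lab k e a)}.
    by move=> ck; exact: lab_continuous.
  have n2 : \forall e' \near e, forall a, a \in labels -> forall b, b \in labels ->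
      before C a b -> offray (px e' b - px e' a) (py e' b - py e' a).
    apply: near_labels => a al; apply: near_labels => b bl.
    have [ab|ab] := boolP (before C a b); last by near=> e'.
    have := (goodP _ _ _ ge) a b al bl ab; rewrite /offray subr_eq0 subr_gt0.
    move=> /orP[/lt_total /orP[h|h]|h].
    - apply: filterS (near_lt_at (cl cy b ccy) (cl cy a ccy) h) => e' h' _.
      by rewrite subr_eq0 lt_eqF.
    - apply: filterS (near_lt_at (cl cy a ccy) (cl cy b ccy) h) => e' h' _.
      by rewrite subr_eq0 gt_eqF.
    - apply: filterS (near_lt_at (cl cx a ccx) (cl cx b ccx) h) => e' h' _.
      by rewrite subr_gt0 h' orbT.
  near=> e'; split; first by near: e'.
  by apply/goodP => a b al bl; apply: (near n2 e').
exists (@quo M @` W2), s; split; first exact: quo_open.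
  exists e0 => //; split=> // i j ij; rewrite /d /dist1 !subrr !normr0 addr0.
  by apply: dist1_gt0; exact: conf_pt_neq.
move=> x [e [We ge] ex]; have [|Ws qs cs] := sP x; first by exists e.
split=> //; have /quo_eqP [r er] : quo (s x) = quo e by rewrite qs.
by rewrite er in We; have r1 := W1s _ _ Ws We; rewrite er r1 conf_perm1 in ge.
Unshelve. all: by end_near. Qed.

Lemma tau_charts (x0 : X) : exists V (s : X -> E) (h : X -> BB),
  [/\ open V, V x0 & forall x, V x -> [/\ quo (s x) = x, {for x, continuous s} &
      \forall x' \near x, tau (s x) (s x') = ((h x)^-1 * h x')%g] ].
Proof.
have [e0 e0x] := quo_surj x0.
have [V [s [oV Vx Vs]]] := conf_section (ord_e_order e0) (good_ord_e e0).
exists V, s, (fun x => rho (ord_e e0) (ord_e (s x))); split=> //; first by rewrite -e0x.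
move=> x /Vs [qs cs gs]; split=> //.
by have := near_tau cs (ord_e_order e0) gs.
Qed.

Definition hol := @holonomy R E X BB (@quo M) tau tau_charts tau_unique.

Local Notation I := (unit_interval R).

(** * Star-shaped charts, rays and trails *)

Lemma offray_mix (l p dx dy : R) : 0 <= l <= 1 -> 0 < p -> offray dx dy ->
  offray (l * dx + (1 - l) * p) (l * dy).
Proof.
move=> /andP[l0 l1] p0; rewrite /offray mulf_eq0 negb_or.
have [->|ln] := eqVneq l 0; first by rewrite mul0r subr0 mul1r add0r p0 orbT.
have lp : 0 < l by rewrite lt_neqAle eq_sym ln.
move=> /orP[->//|dx0]; apply/orP; right.
by apply: ltr_pwDl; [exact: mulr_gt0|apply: mulr_ge0; lra].
Qed.

Lemma offray_mixx (l p dx dy : R) : 0 <= l <= 1 -> 0 < p -> offray dx dy ->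
  offray (l * dx + (1 - l) * p) dy.
Proof.
move=> /andP[l0 l1] p0; rewrite /offray.
have [dy0|//] := eqVneq dy 0; rewrite /= => dx0.
have [->|ln] := eqVneq l 0; first by rewrite mul0r subr0 mul1r add0r p0.
have lp : 0 < l by rewrite lt_neqAle eq_sym ln.
by apply: ltr_pwDl; [exact: mulr_gt0|apply: mulr_ge0; lra].
Qed.

Lemma good_distinct (x y : nat -> R) C : isorder C -> good x y C -> distinct x y.
Proof.
move=> oC /goodP g a b al bl ab; apply/negP => /andP[/eqP ex /eqP ey].
have [||h|h] := before_total (C := C) _ _ ab; rewrite ?isorder_mem //.
  by have := g a b al bl h; rewrite /offray ex ey !subrr eqxx ltxx.
by have := g b a bl al h; rewrite /offray ex ey !subrr eqxx ltxx.
Qed.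

(** Abscissae of the centre of the chart: consecutive integers on the real line, translated so that
    the label 0 sits at the origin. *)
Definition vx (C : seq nat) (a : nat) : R := (index a C)%:R - (index 0%N C)%:R.

Lemma vx_before C a b : before C a b -> 0 < vx C b - vx C a.
Proof. by rewrite /before /vx => h; rewrite opprB addrA subrK subr_gt0 ltr_nat. Qed.

Lemma vx0 C : vx C 0%N = 0. Proof. by rewrite /vx subrr. Qed.

Lemma good_vx C y : good (vx C) y C.
Proof. by apply/goodP => a b al bl ab; rewrite /offray vx_before // orbT. Qed.

(** A convex combination of a difference off the ray with a positive real stays off the ray: the
    chart is star-shaped around its centre. *)
Lemma good_cone (l : R) x y C : 0 <= l <= 1 -> good x y C ->
  good (fun a => l * x a + (1 - l) * vx C a) (fun a => l * y a) C.
Proof.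
move=> l01 /goodP g; apply/goodP => a b al bl ab.
have -> : l * x b + (1 - l) * vx C b - (l * x a + (1 - l) * vx C a) =
  l * (x b - x a) + (1 - l) * (vx C b - vx C a) by ring.
by rewrite -mulrBr; apply: offray_mix; [|exact: vx_before|exact: g].
Qed.

(** Moves the real parts only, so that inequalities between imaginary parts persist; needed in
    [edge_gen]. *)
Lemma good_cylinder (l : R) x y C : 0 <= l <= 1 -> good x y C ->
  good (fun a => l * x a + (1 - l) * vx C a) y C.
Proof.
move=> l01 /goodP g; apply/goodP => a b al bl ab.
have -> : l * x b + (1 - l) * vx C b - (l * x a + (1 - l) * vx C a) =
  l * (x b - x a) + (1 - l) * (vx C b - vx C a) by ring.
by apply: offray_mixx; [|exact: vx_before|exact: g].
Qed.

Lemma good_lab (x y : nat -> R) e C :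
  (forall a, a \in labels -> px e a = x a /\ py e a = y a) -> good x y C -> good_e e C.
Proof.
move=> H /goodP g; apply/goodP => a b al bl ab.
by have [-> ->] := H a al; have [-> ->] := H b bl; exact: g.
Qed.

Lemma chart_build (Y : topologicalType) (f g : nat -> Y -> R) C : isorder C ->
  (forall a, continuous (f a)) -> (forall a, continuous (g a)) ->
  (forall y, f 0%N y = 0) -> (forall y, g 0%N y = 0) ->
  (forall y, good (f^~ y) (g^~ y) C) ->
  exists F : Y -> E, continuous F /\
    forall y a, a \in labels -> px (F y) a = f a y /\ py (F y) a = g a y.
Proof.
move=> oC cf cg f0 g0 d; apply: lab_build => // y; exact: good_distinct (d y).
Qed.

Definition cut (t : R) : R := Num.max 0 (Num.min t 1).

Lemma cut_continuous : continuous cut.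
Proof.
apply: cont_max; first exact: cst_continuous.
by apply: cont_min; [exact: id_continuous|exact: cst_continuous].
Qed.

Lemma cut_bounds t : 0 <= cut t <= 1.
Proof. by rewrite /cut le_max lexx /= ge_max ler01 ge_min lexx orbT. Qed.

Lemma cutE t : 0 <= t <= 1 -> cut t = t.
Proof. by move=> /andP[t0 t1]; rewrite /cut min_l // max_r. Qed.

Lemma cone_exists (Y : topologicalType) (z : Y -> E) C : isorder C -> continuous z ->
  (forall y, good_e (z y) C) ->
  exists F : R * Y -> E, continuous F /\ forall l y a, a \in labels ->
    px (F (l, y)) a = cut l * px (z y) a + (1 - cut l) * vx C a /\
    py (F (l, y)) a = cut l * py (z y) a.
Proof.
move=> oC cz gz.
have cc : continuous (fun w : R * Y => cut w.1).
  by apply: cont_comp; [exact: cont_fst|exact: cut_continuous].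
have cl k a : continuous k -> continuous (fun w : R * Y => lab k (z w.2) a).
  move=> ck; apply: (cont_comp (f := fun w : R * Y => w.2) (g := fun y => lab k (z y) a)).
    exact: cont_snd.
  exact: (cont_comp cz (@lab_continuous k a ck)).
have [||w|w|w|F [cF FE]] := chart_build (Y := (R * Y)%type)
  (f := fun a w => cut w.1 * px (z w.2) a + (1 - cut w.1) * vx C a)
  (g := fun a w => cut w.1 * py (z w.2) a) oC.
- move=> a; apply: cont_add; apply: cont_mul => //; [exact: cl| |exact: cst_continuous].
  by apply: cont_sub => //; exact: cst_continuous.
- by move=> a; apply: cont_mul => //; exact: cl.
- by rewrite vx0 /= !mulr0 addr0.
- by rewrite /= mulr0.
- exact: good_cone (cut_bounds w.1) (gz w.2).
exists F; split=> // l y a al; exact: (FE (l, y)).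
Qed.

Lemma ray_exists C e : isorder C -> good_e e C ->
  exists r : I -> E, continuous r /\ forall t a, a \in labels ->
    px (r t) a = valI t * px e a + (1 - valI t) * vx C a /\ py (r t) a = valI t * py e a.
Proof.
move=> oC ge; have ce : continuous (fun _ : R => e) by exact: cst_continuous.
have [F [cF FE]] := cone_exists oC ce (fun=> ge).
exists (fun t => F (valI t, 0)); split.
  apply: (cont_comp (f := fun t : I => (valI t, 0 : R)) (g := F)) => //.
  by apply: cont_pair; [exact: valI_continuous|exact: cst_continuous].
by move=> t a al; have := FE (valI t) 0 a al; rewrite cutE // valI_bounds.
Qed.

Definition ray (C : seq nat) (e : E) : I -> E :=
  if pselect (isorder C /\ good_e e C) is left p then sval (cid (ray_exists (proj1 p) (proj2 p)))
  else fun=> e.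

Lemma rayP C e : isorder C -> good_e e C -> continuous (ray C e) /\
  forall t a, a \in labels ->
    px (ray C e t) a = valI t * px e a + (1 - valI t) * vx C a /\
    py (ray C e t) a = valI t * py e a.
Proof.
by move=> oC ge; rewrite /ray; case: pselect => [p|[]//]; case: cid.
Qed.

Lemma ray_one C e : isorder C -> good_e e C -> ray C e one = e.
Proof.
move=> oC ge; have [_ H] := rayP oC ge; apply: lab_ext => a al.
by have [-> ->] := H one a al; rewrite valI1 subrr !mul1r mul0r addr0.
Qed.

Lemma ray_zero C e a : isorder C -> good_e e C -> a \in labels ->
  px (ray C e zero) a = vx C a /\ py (ray C e zero) a = 0.
Proof.
move=> oC ge al; have [_ H] := rayP oC ge.
by have [-> ->] := H zero a al; rewrite valI0 subr0 !mul0r mul1r add0r.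
Qed.

Lemma ray_good C e t : isorder C -> good_e e C -> good_e (ray C e t) C.
Proof.
move=> oC gC; have [_ rE] := rayP oC gC.
exact: good_lab (rE t) (good_cone (valI_bounds t) gC).
Qed.

Lemma index_relabel s C a : isorder C -> a \in labels ->
  index (relabel s a) (map (relabel s) C) = index a C.
Proof.
move=> oC al; rewrite index_map_in ?isorder_mem // => x y.
by rewrite !isorder_mem //; exact: relabel_inj.
Qed.

Lemma vx_relabel s C a : isorder C -> a \in labels -> vx (map (relabel s) C) (relabel s a) = vx C a.
Proof.
move=> oC al; rewrite /vx index_relabel //; congr (_ - _%:R).
by rewrite -[0%N in LHS]/(relabel s 0) index_relabel.
Qed.

Lemma ray_perm s C e t : isorder C -> good_e e (map (relabel s) C) ->
  ray C (conf_perm s e) t = conf_perm s (ray (map (relabel s) C) e t).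
Proof.
move=> oC ge; have ge' : good_e (conf_perm s e) C by rewrite good_e_perm.
have [_ H] := rayP oC ge'; have [_ H'] := rayP (isorder_relabel s oC) ge.
apply: lab_ext => a al; rewrite !(lab_perm _ s) //.
have [-> ->] := H t a al; have [-> ->] := H' t (relabel s a) (relabel_in s al).
by rewrite !lab_perm // vx_relabel.
Qed.

(** Relabellings permute the three points freely and fix 0, so the place of 0 is the only
    obstruction. In the quotient, four chart centres remain. *)
Lemma relabel_exists C C' : isorder C -> isorder C' -> index 0%N C = index 0%N C' ->
  exists s, map (relabel s) C = C'.
Proof.
move=> oC oC' e0; pose g a := nth 0%N C' (index a C).
have gl a : a \in labels -> g a \in labels.
  move=> al; rewrite -(isorder_mem oC') mem_nth // isorder_size // -(isorder_size oC).
  by rewrite index_mem isorder_mem.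
have gi : {in labels &, injective g}.
  move=> a b al bl /(congr1 (index^~ C')).
  rewrite /g !index_uniq ?isorder_uniq ?isorder_size // -?(isorder_size oC) ?index_mem ?isorder_mem //.
  by move=> /(congr1 (nth 0%N C)); rewrite !nth_index ?isorder_mem.
have g0 : g 0%N = 0%N by rewrite /g e0 nth_index // isorder_mem.
have gS (i : 'I_3) : exists j : 'I_3, g i.+1 = j.+1.
  have il : i.+1 \in labels by rewrite labels_S.
  have [v vE] : exists v, g i.+1 = v by exists (g i.+1).
  have := gl _ il; rewrite vE; case: v vE => [|j] vE.
    by have := gi i.+1 0%N il isT (etrans vE (esym g0)).
  by rewrite labels_S => j3; exists (Ordinal j3).
pose f (i : 'I_3) := sval (cid (gS i)).
have fE (i : 'I_3) : g i.+1 = (f i).+1 by rewrite /f; case: cid.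
have fI : injective f.
  move=> i j fij; have : g i.+1 = g j.+1 by rewrite !fE fij.
  by move=> /gi; rewrite !labels_S !ltn_ord => /(_ isT isT) [] /ord_inj.
exists (perm fI).
have -> : C' = map g C.
  apply: (@eq_from_nth _ 0%N); first by rewrite size_map !isorder_size.
  rewrite isorder_size // => i i4.
  by rewrite (nth_map 0%N) ?isorder_size // /g index_uniq ?isorder_size ?isorder_uniq.
apply/eq_in_map => a; rewrite isorder_mem //; case: a => [|a]; first by rewrite g0.
rewrite labels_S => a3; rewrite /= a3 permE -fE; congr (g _.+1).
by rewrite inordK.
Qed.

Lemma quo_ray_zero C C' e e' : isorder C -> isorder C' -> good_e e C -> good_e e' C' ->
  index 0%N C = index 0%N C' -> quo (ray C e zero) = quo (ray C' e' zero).
Proof.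
move=> oC oC' ge ge' e0; have [s sC] := relabel_exists oC oC' e0.
apply/esym/quo_eqP; exists s; apply: lab_ext => a al; rewrite !lab_perm //.
have [-> ->] := ray_zero oC ge al.
have [-> ->] := ray_zero oC' ge' (relabel_in s al).
by rewrite -sC vx_relabel.
Qed.

Definition std (k : nat) : seq nat :=
  match k with
  | 0 => [:: 0; 1; 2; 3] | 1 => [:: 1; 0; 2; 3]
  | 2 => [:: 1; 2; 0; 3] | _ => [:: 1; 2; 3; 0]
  end%N.

Lemma std_order k : isorder (std k).
Proof. by case: k => [|[|[|k]]]. Qed.

Lemma index_std k : (k < 4)%N -> index 0%N (std k) = k.
Proof. by case: k => [|[|[|[|k]]]]. Qed.

Lemma index_order C a : isorder C -> a \in labels -> (index a C < 4)%N.
Proof. by move=> oC al; rewrite -(isorder_size oC) index_mem isorder_mem. Qed.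

(* A configuration in the charts of all orders, with imaginary parts
   decreasing along C. *)
Lemma estar_exists C : isorder C -> exists e : E, forall a, a \in labels ->
  px e a = vx C a /\ py e a = - vx C a.
Proof.
move=> oC; have [||w|w|w|F [cF FE]] := chart_build (Y := R)
  (f := fun a w => vx C a) (g := fun a w => - vx C a) oC.
- by move=> a; exact: cst_continuous.
- by move=> a; exact: cst_continuous.
- exact: vx0.
- by rewrite vx0 oppr0.
- exact: good_vx.
by exists (F 0); exact: FE.
Qed.

Definition estar (k : nat) : E := sval (cid (estar_exists (std_order k))).

Lemma estarE k a : a \in labels -> px (estar k) a = vx (std k) a /\ py (estar k) a = - vx (std k) a.
Proof. by rewrite /estar; case: cid => e H; exact: H. Qed.

Lemma estar_before k a b : a \in labels -> b \in labels -> before (std k) a b ->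
  py (estar k) b < py (estar k) a.
Proof.
move=> al bl ab; have [_ ->] := estarE k al; have [_ ->] := estarE k bl.
by rewrite ltrN2 -subr_gt0; exact: vx_before.
Qed.

Lemma estar_good k C : isorder C -> good_e (estar k) C.
Proof.
move=> oC; apply/goodP => a b al bl ab; rewrite /offray subr_eq0.
have nab : a != b by apply/eqP => e; move: ab; rewrite /before e ltnn.
have [||h|h] := before_total (C := std k) _ _ nab; rewrite ?isorder_mem ?std_order //.
  by rewrite (lt_eqF (estar_before al bl h)).
by rewrite (gt_eqF (estar_before bl al h)).
Qed.

Lemma quo_ray_continuous C e : isorder C -> good_e e C -> continuous (fun t => quo (ray C e t)).
Proof.
move=> oC ge; have [cr _] := rayP oC ge.
exact: (cont_comp cr (@quo_continuous M)).
Qed.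

Lemma index0_order C : isorder C -> (index 0%N C < 4)%N.
Proof. by move=> oC; exact: index_order. Qed.

Definition joined (x y : X) : Prop :=
  exists f : I -> X, [/\ continuous f, f zero = x & f one = y].

Lemma joined_sym x y : joined x y -> joined y x.
Proof.
move=> [f [cf f0 f1]]; exists (reverse f); split; first exact: reverse_continuous.
  by rewrite reverse0.
by rewrite reverse1.
Qed.

Lemma joined_trans x y z : joined x y -> joined y z -> joined x z.
Proof.
move=> [f [cf f0 f1]] [g [cg g0 g1]]; exists (concat f g); split.
- by apply: concat_continuous => //; rewrite f1.
- by rewrite concat0.
- by rewrite concat1.
Qed.

Definition vtx (k : nat) : X := quo (ray (std k) (estar k) zero).

Lemma ray_vtx C e : isorder C -> good_e e C -> quo (ray C e zero) = vtx (index 0%N C).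
Proof.
move=> oC ge; apply: quo_ray_zero => //; [exact: std_order|exact/estar_good/std_order|].
by rewrite index_std // index_order.
Qed.

Lemma joined_ray C e : isorder C -> good_e e C -> joined (vtx (index 0%N C)) (quo e).
Proof.
move=> oC ge; exists (fun t => quo (ray C e t)); split; first exact: quo_ray_continuous.
  exact: ray_vtx.
by rewrite ray_one.
Qed.

(** The charts of [std j] and of its swap at j share the configuration [estar j], and this swap
    moves the label 0 from place j to place j + 1. *)
Lemma joined_vtx k : (k < 4)%N -> joined (vtx 0) (vtx k).
Proof.
have step j : (j < 3)%N -> joined (vtx j) (vtx j.+1).
  move=> j3; have oS := isorder_oswap j (std_order j).
  have := joined_ray oS (estar_good j oS).
  have -> : index 0%N (oswap j (std j)) = j.+1 by case: j j3 {oS} => [|[|[|]]].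
  move=> /joined_sym; apply: joined_trans.
  have := joined_ray (std_order j) (estar_good j (std_order j)).
  by rewrite index_std //; lia.
elim: k => [|k IH] k4; last by apply: joined_trans (IH _) (step _ _); lia.
by exists (fun=> vtx 0); split=> //; exact: cst_continuous.
Qed.

Section BasePoint.
Variable b : X.
Local Notation pi1 := (@fundamental_group R X b).

Lemma base_joined k : (k < 4)%N -> joined b (vtx k).
Proof.
move=> k4; have [e eb] := quo_surj b.
have := joined_ray (ord_e_order e) (good_ord_e e); rewrite eb => /joined_sym jb.
apply: joined_trans jb _; apply: joined_trans (joined_vtx k4).
by apply/joined_sym/joined_vtx; rewrite index_order // ord_e_order.
Qed.

Definition stem (k : nat) : I -> X :=
  if pselect (joined b (vtx k)) is left j then sval (cid j) else fun=> b.

Lemma stemP k : (k < 4)%N -> [/\ continuous (stem k), stem k zero = b & stem k one = vtx k].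
Proof.
by move=> k4; rewrite /stem; case: pselect => [j|/(_ (base_joined k4))//]; case: cid.
Qed.

(** The stem depends on the place of 0 alone, so that trails are unaffected by renumbering the
    points ([trail_perm]). *)
Definition trail (C : seq nat) (e : E) : I -> X :=
  concat (stem (index 0%N C)) (fun t => quo (ray C e t)).

Lemma trail_joint C e : isorder C -> good_e e C ->
  stem (index 0%N C) one = quo (ray C e zero).
Proof. by move=> oC ge; have [_ _ ->] := stemP (index0_order oC); rewrite ray_vtx. Qed.

Lemma trail_base C e : isorder C -> good_e e C -> from_base b (trail C e).
Proof.
move=> oC ge; have [cs s0 s1] := stemP (index0_order oC).
split; last by rewrite /trail concat0.
by apply: concat_continuous => //; [exact: quo_ray_continuous|exact: trail_joint].
Qed.

Lemma trail_one C e : isorder C -> good_e e C -> trail C e one = quo e.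
Proof. by move=> oC ge; rewrite /trail concat1 ray_one. Qed.

Lemma trail_perm s C e : isorder C -> good_e e (map (relabel s) C) ->
  trail C (conf_perm s e) = trail (map (relabel s) C) e.
Proof.
move=> oC ge; rewrite /trail; congr concat.
  by rewrite -[0%N in RHS]/(relabel s 0) index_relabel.
by apply/funext => t; rewrite ray_perm // quo_perm.
Qed.

Lemma trail_path C (z : I -> E) : isorder C -> continuous z -> (forall t, good_e (z t) C) ->
  homotopic (concat (trail C (z zero)) (fun t => quo (z t))) (trail C (z one)).
Proof.
move=> oC cz gz; have [cs s0 s1] := stemP (index0_order oC).
have cq : continuous (fun t => quo (z t)) by exact: (cont_comp cz (@quo_continuous M)).
have cr e : good_e e C -> continuous (fun t => quo (ray C e t)) by exact: quo_ray_continuous.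
apply: (homotopic_trans (g := concat (stem (index 0%N C))
   (concat (fun t => quo (ray C (z zero) t)) (fun t => quo (z t))))).
  apply/homotopic_sym/concatA => //; [exact: cr|exact: trail_joint|by rewrite ray_one].
apply: homotopic_concat.
- by rewrite concat0; exact: trail_joint.
- exact: homotopic_refl.
have [F [cF FE]] := cone_exists oC cz gz.
pose G (w : R * R) : X := quo (F (w.1, clampI w.2)).
have cG : continuous G.
  apply: (cont_comp (f := fun w : R * R => F (w.1, clampI w.2))); last exact: quo_continuous.
  apply: (cont_comp (f := fun w : R * R => (w.1, clampI w.2) : R * I)) => //.
  apply: cont_pair; first exact: cont_fst.
  by apply: cont_comp; [exact: cont_snd|exact: clampI_continuous].
have rayF t y : ray C (z y) t = F (valI t, y).
  have [_ H] := rayP oC (gz y); apply: lab_ext => a al.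
  by have [-> ->] := H t a al; have [-> ->] := FE (valI t) y a al; rewrite cutE ?valI_bounds.
have F1 y : F (1, y) = z y by rewrite -{1}valI1 -rayF ray_one.
have c2 : continuous (fun t : R => Num.min (2 * t) 1).
  apply: cont_min; last exact: cst_continuous.
  by apply: cont_mul; [exact: cst_continuous|exact: id_continuous].
have c3 : continuous (fun t : R => Num.max (2 * t - 1) 0).
  by apply: cont_max; [exact: affine_cont|exact: cst_continuous].
(* In the cone over [z], two sides of the unit square, the ray to the start of [z] and then [z]
   itself, are deformed into the ray to its end. The remaining side is collapsed to the centre of
   the chart. *)
have := @square_homotopic R X G (fun t => Num.min (2 * t) 1) (fun t => Num.max (2 * t - 1) 0)
  id (cst 1) cG c2 c3 (@id_continuous _) (@cst_continuous _ _ _).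
have -> : (fun t : I => G (Num.min (2 * valI t) 1, Num.max (2 * valI t - 1) 0)) =
    concat (fun t => quo (ray C (z zero) t)) (fun t => quo (z t)).
  apply/funext => t; have t01 := valI_bounds t; rewrite /concat /G /=.
  have [t1|t1] := leP (valI t) 2^-1.
    rewrite min_l; last lra.
    by rewrite max_r ?clampI0 ?rayF ?clampIE //; lra.
  rewrite min_r; last lra.
  by rewrite max_l ?F1 //; lra.
have -> : (fun t : I => G (valI t, cst 1 (valI t))) = (fun t => quo (ray C (z one) t)).
  by apply/funext => t; rewrite /G /= clampI1 rayF.
apply => s s01.
- rewrite /G /= mulr0 sub0r.
  rewrite (min_l (y := 1)) ?ler01 // (max_r (x := -1)) ?oppr_le0 ?ler01 //.
  rewrite !mulr0 !addr0 add0r mulr1 clampI0.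
  have -> : F (0, clampI s) = F (0, zero) .
    apply: lab_ext => a al.
    have [-> ->] := FE 0 (clampI s) a al; have [-> ->] := FE 0 zero a al.
    by rewrite cutE ?lexx ?ler01 // !mul0r.
  by [].
- rewrite /G /= mulr1 (min_r (x := 2)) ?ler1n // (max_l (y := 0)); last by lra.
  have -> : (1 - s) * 1 + s * 1 = 1 by ring.
  by have -> : (1 - s) * (2 - 1) + s * 1 = 2 - 1 by ring.
Qed.

(** * Edges: loops changing charts at a configuration *)

Definition edge (C D : seq nat) (e : E) : pi1 :=
  xget 1%g [set x : pi1 | diff_class (trail C e) (trail D e) x].

Lemma edgeP C D e : isorder C -> isorder D -> good_e e C -> good_e e D ->
  diff_class (trail C e) (trail D e) (edge C D e).
Proof.
move=> oC oD gC gD; rewrite /edge; case: xgetP => // /(_ _) H; exfalso.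
have [x hx] := diff_exists (trail_base oC gC) (trail_base oD gD)
  (etrans (trail_one oC gC) (esym (trail_one oD gD))).
exact: (H x).
Qed.

Section EdgeLemmas.
Variables (e : E) (C D K : seq nat).
Hypotheses (oC : isorder C) (oD : isorder D) (oK : isorder K).
Hypotheses (gC : good_e e C) (gD : good_e e D) (gK : good_e e K).

Lemma edge_refl : edge C C e = 1%g.
Proof. exact: diff_uniq (edgeP oC oC gC gC) (diff_refl (trail_base oC gC)). Qed.

Lemma edge_trans : (edge C D e * edge D K e = edge C K e)%g.
Proof.
apply: diff_uniq (edgeP oC oK gC gK).
by apply: diff_trans (edgeP oC oD gC gD) (edgeP oD oK gD gK);
  rewrite ?trail_one //; exact: trail_base.
Qed.

Lemma edge_sym : edge D C e = (edge C D e)^-1%g.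
Proof.
apply: diff_uniq (edgeP oD oC gD gC) _.
apply: diff_sym (edgeP oC oD gC gD); rewrite ?trail_one //; exact: trail_base.
Qed.

Lemma edge_perm s : good_e e (map (relabel s) C) -> good_e e (map (relabel s) D) ->
  edge C D (conf_perm s e) = edge (map (relabel s) C) (map (relabel s) D) e.
Proof. by move=> g1 g2; rewrite /edge !trail_perm. Qed.

End EdgeLemmas.

(** Appending the path to both trails does not change their difference, and each extended trail is
    homotopic to the trail ending at [z one]. *)
Lemma edge_path C D (z : I -> E) : isorder C -> isorder D -> continuous z ->
  (forall t, good_e (z t) C) -> (forall t, good_e (z t) D) ->
  edge C D (z zero) = edge C D (z one).
Proof.
move=> oC oD cz gC gD; apply/esym.
have cq : continuous (fun t => quo (z t)) by exact: (cont_comp cz (@quo_continuous M)).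
have bC := trail_base oC (gC zero); have bD := trail_base oD (gD zero).
have e0 : trail C (z zero) one = trail D (z zero) one by rewrite !trail_one.
have e1 : trail C (z zero) one = quo (z zero) by rewrite trail_one.
have e2 : trail D (z zero) one = quo (z zero) by rewrite trail_one.
have H := diff_concat bC bD e0 cq e1 (edgeP oC oD (gC zero) (gD zero)).
apply: diff_uniq (edgeP oC oD (gC one) (gD one)) _.
apply: diff_homotopic H; [exact: from_base_concat|exact: from_base_concat| | |].
- by rewrite !concat1.
- exact: trail_path.
- exact: trail_path.
Qed.

Definition gen_edge (i k : nat) : pi1 := edge (std k) (oswap i (std k)) (estar k).

Lemma convex_gt0 (l p r : R) : 0 <= l <= 1 -> 0 < p -> 0 < r -> 0 < (1 - l) * p + l * r.
Proof.
move=> /andP[l0 l1] p0 r0; have [->|ln] := eqVneq l 0; first by rewrite subr0 mul1r mul0r addr0.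
have lp : 0 < l by rewrite lt_neqAle eq_sym ln.
by apply: ltr_wpDl; [apply: mulr_ge0; lra|exact: mulr_gt0].
Qed.

(** A relabelling makes C standard; then the configuration can be moved to [estar] without leaving
    either chart, which does not change the edge. *)
Lemma edge_gen C i e : isorder C -> (i < 3)%N -> good_e e C ->
  py e (nth 0%N C i.+1) < py e (nth 0%N C i) ->
  edge C (oswap i C) e = gen_edge i (index 0%N C).
Proof.
move=> oC i3 gC h; set k := index 0%N C.
have oS := std_order k; have k4 : (k < 4)%N by exact: index_order.
have [s sC] := relabel_exists oS oC (index_std k4).
have nthC j : (j < 4)%N -> nth 0%N C j = relabel s (nth 0%N (std k) j).
  by move=> j4; rewrite -sC (nth_map 0%N) // isorder_size.
have sl j : (j < 4)%N -> nth 0%N (std k) j \in labels.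
  by move=> j4; rewrite -(isorder_mem oS) mem_nth // isorder_size.
pose e' := conf_perm s e.
have gS : good_e e' (std k) by rewrite good_e_perm // sC.
have h' : py e' (nth 0%N (std k) i.+1) < py e' (nth 0%N (std k) i).
  by rewrite !lab_perm ?sl -?nthC //; lia.
have oS' := isorder_oswap i oS.
have gS' : good_e e' (oswap i (std k)) by apply: good_oswap => //; rewrite lt_eqF.
have -> : edge C (oswap i C) e = edge (std k) (oswap i (std k)) e'.
  rewrite edge_perm ?sC // -oswap_map ?sC //.
  by apply: good_oswap => //; rewrite lt_eqF.
rewrite /gen_edge; clearbody e'; clear e gC h; rename e' into e.
(* first straighten the real parts, then move the imaginary parts *)
have cv : continuous (fun t : I => valI t) by exact: valI_continuous.
have cw : continuous (fun t : I => 1 - valI t).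
  by apply: cont_sub => //; exact: cst_continuous.
have cc (r : R) : continuous (fun _ : I => r) by exact: cst_continuous.
pose f1 a (t : I) := (1 - valI t) * px e a + (1 - (1 - valI t)) * vx (std k) a.
pose g2 a (t : I) := (1 - valI t) * py e a + valI t * - vx (std k) a.
have gf1 t : good (f1^~ t) (py e) (std k).
  by apply: good_cylinder => //; have := valI_bounds t; lra.
have [||w|w|//|z1 [cz1 z1E]] := chart_build (Y := I) (f := f1) (g := fun a _ => py e a) oS.
- by move=> a; apply: cont_add; apply: cont_mul => //; exact: cont_sub.
- by move=> a; exact: cc.
- by rewrite /f1 vx0 /= !mulr0 addr0.
- by [].
have [||w|w|w|z2 [cz2 z2E]] := chart_build (Y := I) (f := fun a _ => vx (std k) a) (g := g2) oS.
- by move=> a; exact: cc.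
- by move=> a; apply: cont_add; apply: cont_mul.
- exact: vx0.
- by rewrite /g2 vx0 /= oppr0 !mulr0 addr0.
- exact: good_vx.
have gz1 t : good_e (z1 t) (std k) by exact: good_lab (z1E t) (gf1 t).
have gz2 t : good_e (z2 t) (std k) by exact: good_lab (z2E t) (good_vx _ _).
have bi : before (std k) (nth 0%N (std k) i) (nth 0%N (std k) i.+1).
  by rewrite /before !index_uniq ?isorder_size ?isorder_uniq //; lia.
have [l1 l2] : nth 0%N (std k) i \in labels /\ nth 0%N (std k) i.+1 \in labels.
  by split; apply: sl; lia.
have gz1' t : good_e (z1 t) (oswap i (std k)).
  apply: good_oswap => //; first exact: gz1.
  have [_ ->] := z1E t _ l1; have [_ ->] := z1E t _ l2.
  by rewrite lt_eqF.
have gz2' t : good_e (z2 t) (oswap i (std k)).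
  apply: good_oswap => //; first exact: gz2.
  have [_ ->] := z2E t _ l1; have [_ ->] := z2E t _ l2.
  rewrite lt_eqF // /g2; have := vx_before bi; have := valI_bounds t.
  move: (valI t) => r r01 hv; rewrite -subr_gt0 in h'.
  by have := convex_gt0 r01 h' hv; lra.
have := edge_path oS oS' cz1 gz1 gz1'; have := edge_path oS oS' cz2 gz2 gz2'.
have -> : z1 zero = e.
  by apply: lab_ext => a al; have [-> ->] := z1E zero a al; rewrite /f1 valI0 subr0 subrr mul1r mul0r addr0.
have -> : z1 one = z2 zero.
  apply: lab_ext => a al; have [-> ->] := z1E one a al; have [-> ->] := z2E zero a al.
  by rewrite /f1 /g2 valI0 valI1 !(subrr, subr0) !mul1r !mul0r add0r addr0.
have -> : z2 one = estar k.
  apply: lab_ext => a al; have [-> ->] := z2E one a al; have [-> ->] := estarE k al.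
  by rewrite /g2 valI1 subrr mul0r mul1r add0r.
by move=> <- ->.
Qed.

(** * From braids to loops *)

Definition permute_values (s : {perm 'I_4}) (g : {ffun 'I_4 -> pi1}) : {ffun 'I_4 -> pi1} :=
  [ffun k => g (s k)].

Lemma permute_values1 g : permute_values 1%g g = g.
Proof. by apply/ffunP => k; rewrite ffunE perm1. Qed.

Lemma permute_valuesM s r g :
  permute_values (s * r)%g g = permute_values s (permute_values r g).
Proof. by apply/ffunP => k; rewrite !ffunE permM. Qed.

Lemma permute_valuesMr s g h :
  permute_values s (g * h)%g = (permute_values s g * permute_values s h)%g.
Proof. by apply/ffunP => k; rewrite !ffunE. Qed.

(** A crossing contributes a loop that depends on the place of 0, and also changes this place; the
    wreath product records both. *)
Definition wreath : groupType :=
  sdprod_group (GroupAction permute_values1 permute_valuesM permute_valuesMr).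

Lemma wreath_mul1 (x y : wreath) k : (x * y)%g.1 k = (x.1 k * y.1 (x.2 k))%g.
Proof. by rewrite sd_mulE /= !ffunE. Qed.

Lemma wreath_mul2 (x y : wreath) k : (x * y)%g.2 k = y.2 (x.2 k).
Proof. by rewrite sd_mulE /= permM. Qed.

Lemma wreath_ext (x y : wreath) : (forall k, (k < 4)%N ->
  x.1 (p4 k) = y.1 (p4 k) /\ x.2 (p4 k) = y.2 (p4 k)) -> x = y.
Proof.
case: x => x1 x2; case: y => y1 y2 H; congr pair; first apply/ffunP; last apply/permP;
  by apply: p4_ind; case: (H 0%N isT); case: (H 1%N isT); case: (H 2%N isT); case: (H 3%N isT).
Qed.

Definition taui (i : nat) : {perm 'I_4} :=
  match i with 0%N => tau1 | 1%N => tau2 | _ => tau3 end.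

Lemma taui_index i C : isorder C -> taui i (p4 (index 0%N C)) = p4 (index 0%N (oswap i C)).
Proof.
(* The rows of the table are [tau1], [tau2] and [tau3] as lists of values. *)
have H : all (fun C => all (fun i => index 0%N (oswap i C) ==
    nth 0%N (nth [::] [:: [:: 1; 0; 2; 3]; [:: 0; 2; 1; 3]; [:: 0; 1; 3; 2]] i) (index 0%N C))
   [:: 0; 1; 2])%N orders by vm_compute.
move=> oC; have k4 := index0_order oC; rewrite isorder_orders in oC.
move/(_ C oC)/allP: (allP H) => {}H.
have {}H j : j \in [:: 0; 1; 2]%N -> _ := fun j3 => eqP (H j j3).
case: tau1E => ? ? ? ?; case: tau2E => ? ? ? ?; case: tau3E => ? ? ? ?.
case: i => [|[|i]]; rewrite /taui.
- rewrite (H 0%N) //; by case: (index 0%N C) k4 => [|[|[|[|]]]].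
- rewrite (H 1%N) //; by case: (index 0%N C) k4 => [|[|[|[|]]]].
have -> : oswap i.+2 C = oswap 2 C by case: (C) => [|? [|? [|? [|? [|? ?]]]]].
rewrite (H 2%N) //; by case: (index 0%N C) k4 => [|[|[|[|]]]].
Qed.

Definition wgen (i : nat) : wreath := ([ffun k : 'I_4 => gen_edge i k], taui i).

Definition wreath_word (s : seq nat) : wreath := foldr (fun i x => wgen i * x)%g 1%g s.

Lemma wreath_word_cons i s : wreath_word (i :: s) = (wgen i * wreath_word s)%g.
Proof. by []. Qed.

(** The condition under which every swap of the word satisfies the hypothesis of [edge_gen] and
    stays among the charts that contain the configuration. *)
Fixpoint falling (y : nat -> R) (C s : seq nat) : bool :=
  if s is i :: s' then
    [&& (i < 3)%N, y (nth 0%N C i.+1) < y (nth 0%N C i) & falling y (oswap i C) s']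
  else true.

Lemma wreath_word_edge e C s : isorder C -> good_e e C -> falling (py e) C s ->
  let D := foldl (fun D i => oswap i D) C s in
  [/\ good_e e D, (wreath_word s).1 (p4 (index 0%N C)) = edge C D e &
      (wreath_word s).2 (p4 (index 0%N C)) = p4 (index 0%N D)].
Proof.
elim: s C => [|i s IH] C oC gC.
  by move=> _; split=> //=; [rewrite ffunE edge_refl|rewrite perm1].
rewrite wreath_word_cons => /and3P[i3 yi fs]; have oC' := isorder_oswap i oC.
have gC' : good_e e (oswap i C) by apply: good_oswap => //; rewrite lt_eqF.
have [gD w1 w2] := IH _ oC' gC' fs; rewrite [foldl _ _ _]/=.
have oD : isorder (foldl (fun D i => oswap i D) (oswap i C) s).
  by elim: (s) (oswap i C) oC' => //= j r IHr D oD; apply: IHr; exact: isorder_oswap.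
split=> //; last first.
  by rewrite wreath_mul2 [(wgen i).2]/(taui i) taui_index.
rewrite wreath_mul1 [(wgen i).2]/(taui i) taui_index // w1 ffunE.
rewrite inordK ?index0_order // -(edge_gen oC i3 gC yi).
by apply: edge_trans.
Qed.

(** Both words evaluate to the edge at [estar k] between the same two charts, and an edge does not
    depend on the charts passed on the way. *)
Lemma wgen_br (s r : seq nat) :
  (forall k, (k < 4)%N -> let D := foldl (fun D i => oswap i D) (std k) in D s = D r) ->
  (forall k, (k < 4)%N -> falling (py (estar k)) (std k) s && falling (py (estar k)) (std k) r) ->
  wreath_word s = wreath_word r.
Proof.
move=> Dsr fsr; apply: wreath_ext => k k4; have /andP[fs fr] := fsr k k4.
have oS := std_order k; have gS := estar_good k oS.
have [_] := wreath_word_edge oS gS fs; have [_] := wreath_word_edge oS gS fr.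
by rewrite index_std // (Dsr k k4) => -> -> -> ->.
Qed.

Lemma wgen_br12 : (wgen 0 * wgen 1 * wgen 0 = wgen 1 * wgen 0 * wgen 1)%g.
Proof.
have := @wgen_br [:: 0; 1; 0]%N [:: 1; 0; 1]%N.
rewrite /wreath_word /= !mulg1 !mulgA; apply.
  by case=> [|[|[|[|]]]].
by move=> k; have := @estar_before k; move: (py _) => y; case: k => [|[|[|[|]]]] //= H _; rewrite !H.
Qed.

Lemma wgen_br23 : (wgen 1 * wgen 2 * wgen 1 = wgen 2 * wgen 1 * wgen 2)%g.
Proof.
have := @wgen_br [:: 1; 2; 1]%N [:: 2; 1; 2]%N.
rewrite /wreath_word /= !mulg1 !mulgA; apply.
  by case=> [|[|[|[|]]]].
by move=> k; have := @estar_before k; move: (py _) => y; case: k => [|[|[|[|]]]] //= H _; rewrite !H.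
Qed.

Lemma wgen_br13 : (wgen 0 * wgen 2 = wgen 2 * wgen 0)%g.
Proof.
have := @wgen_br [:: 0; 2]%N [:: 2; 0]%N.
rewrite /wreath_word /= !mulg1; apply.
  by case=> [|[|[|[|]]]].
by move=> k; have := @estar_before k; move: (py _) => y; case: k => [|[|[|[|]]]] //= H _; rewrite !H.
Qed.

Definition psi : BB -> wreath := braid_hom (wgen 0) (wgen 1) (wgen 2).

Lemma psiM : {morph psi : x y / (x * y)%g}.
Proof. exact: braid_homM wgen_br12 wgen_br23 wgen_br13. Qed.

Lemma psi_sigma i : (i < 3)%N -> psi (sigma i) = wgen i.
Proof. by case: i => [|[|[|]]] // _; rewrite /psi ?braid_hom1 ?braid_hom2 ?braid_hom3. Qed.

Lemma psi_posn x : (psi x).2 = posn x.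
Proof.
have psiV := homV psiM; have posnV := homV posnM.
have [p1 p2 p3] := posn_sigma.
elim/BB_ind: x => [|||x y IHx IHy|x IH].
- by rewrite -[sigma1]/(sigma 0) psi_sigma.
- by rewrite -[sigma2]/(sigma 1) psi_sigma.
- by rewrite -[sigma3]/(sigma 2) psi_sigma.
- by rewrite psiM posnM -IHx -IHy.
- by rewrite psiV posnV -IH.
Qed.

(** A cocycle over [posn] rather than a morphism ([evM]); it is multiplicative on the stabilizer of
    k. *)
Definition ev (x : BB) (k : 'I_4) : pi1 := (psi x).1 k.

Lemma evM x y k : ev (x * y)%g k = (ev x k * ev y (posn x k))%g.
Proof. by rewrite /ev psiM wreath_mul1 psi_posn. Qed.

Lemma psi_word s : all (fun i => i < 3)%N s -> psi (word_sigma s) = wreath_word s.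
Proof.
elim: s => [|i s IH] /=; first by rewrite (hom1 psiM).
by move=> /andP[i3 s3]; rewrite psiM psi_sigma // IH.
Qed.

Lemma falling_gallery n e C : isorder C -> good_e e C -> falling (py e) C (gallery n C (ord_e e)).
Proof.
elim: n C => //= n IH C oC gC.
have step i : (i < 3)%N -> descent (ord_e e) C i ->
    falling (py e) C (i :: gallery n (oswap i C) (ord_e e)).
  move=> i3 di; have h := descent_exchanged oC i3 gC di.
  rewrite /= i3 h /=; apply: IH; first exact: isorder_oswap.
  by apply: good_oswap => //; rewrite lt_eqF.
case: ifP => [|_]; first exact: step.
case: ifP => [|_]; first exact: step.
by case: ifP => [|//]; exact: step.
Qed.

Lemma gallery_lt3 n C J : all (fun i => i < 3)%N (gallery n C J).
Proof. by elim: n C => //= n IH C; do 3 (case: ifP => _ /=; first by rewrite IH). Qed.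

Lemma rho_word C J : rho C J = word_sigma (gallery 6 C J).
Proof. by rewrite rhoE word_sigmaE. Qed.

(** Sorting C towards the order by imaginary parts only makes falling swaps, so the braid of the
    sort evaluates to the edge at e. *)
Lemma edge_rho e C : isorder C -> good_e e C ->
  edge C (ord_e e) e = ev (rho C (ord_e e)) (p4 (index 0%N C)) /\
  posn (rho C (ord_e e)) (p4 (index 0%N C)) = p4 (index 0%N (ord_e e)).
Proof.
move=> oC gC; have oJ := ord_e_order e.
rewrite /ev -psi_posn rho_word psi_word ?gallery_lt3 //.
have [_] := wreath_word_edge oC gC (falling_gallery 6 oC gC).
by rewrite gallery_end.
Qed.

(** * From loops to braids *)

Definition lift (x : X) : E := sval (cid (quo_surj x)).

Lemma liftK x : quo (lift x) = x. Proof. exact: svalP (cid (quo_surj x)). Qed.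

(** Independent of the numbering chosen by [lift] ([sorted_trail_quo]). It jumps where the order
    does, and the holonomy compensates the jumps in [hol_transport]. *)
Definition sorted_trail (x : X) : I -> X := trail (ord_e (lift x)) (lift x).

(* The position of the origin in the order by imaginary parts. *)
Definition pos0 (x : X) : 'I_4 := p4 (index 0%N (ord_e (lift x))).

Lemma sorted_trail_quo e : sorted_trail (quo e) = trail (ord_e e) e.
Proof.
rewrite /sorted_trail; have /quo_eqP [s ->] : quo e = quo (lift (quo e)) by rewrite liftK.
have oC := ord_e_order (conf_perm s e).
by rewrite trail_perm // ord_e_perm // good_ord_e.
Qed.

Lemma pos0_quo e : pos0 (quo e) = p4 (index 0%N (ord_e e)).
Proof.
rewrite /pos0; have /quo_eqP [s ->] : quo e = quo (lift (quo e)) by rewrite liftK.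
by rewrite -(ord_e_perm s e) -[0%N in RHS]/(relabel s 0) index_relabel // ord_e_order.
Qed.

Lemma sorted_trail_base x : from_base b (sorted_trail x).
Proof. exact: trail_base (ord_e_order _) (good_ord_e _). Qed.

Lemma sorted_trail_one x : sorted_trail x one = x.
Proof. by rewrite /sorted_trail trail_one ?ord_e_order ?good_ord_e ?liftK. Qed.

Lemma evV x k : ev x^-1%g (posn x k) = (ev x k)^-1%g.
Proof.
apply/esym/mulg1_eq; rewrite -evM mulgV /ev.
by rewrite (hom1 psiM) /= ffunE.
Qed.

Lemma ev_VM x y k : ev (x^-1 * y)%g (posn x k) = ((ev x k)^-1 * ev y k)%g.
Proof. by rewrite evM evV (homV posnM) permK. Qed.

Lemma posn_VM x y k : posn (x^-1 * y)%g (posn x k) = posn y k.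
Proof. by rewrite posn_comp (homV posnM) permK. Qed.

(** Inside the common chart [trail_path] applies. Entering it from the sorted chart at one end and
    leaving it at the other costs two edges, the values of the two factors of [beta]. *)
Lemma chart_transport C (z : I -> E) : isorder C -> continuous z -> (forall t, good_e (z t) C) ->
  let beta := ((rho C (ord_e (z zero)))^-1 * rho C (ord_e (z one)))%g in
  posn beta (pos0 (quo (z zero))) = pos0 (quo (z one)) /\
  diff_class (concat (sorted_trail (quo (z zero))) (fun t => quo (z t)))
    (sorted_trail (quo (z one))) (ev beta (pos0 (quo (z zero)))).
Proof.
move=> oC cz gz beta; have [ev0 pos_0] := edge_rho oC (gz zero).
have [ev1 pos_1] := edge_rho oC (gz one).
have oJ t := ord_e_order (z t); have gJ t := good_ord_e (z t).
rewrite !pos0_quo !sorted_trail_quo -pos_0 -pos_1.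
split; first exact: posn_VM.
have -> : ev beta (posn (rho C (ord_e (z zero))) (p4 (index 0%N C))) =
    (edge (ord_e (z zero)) C (z zero) * edge C (ord_e (z one)) (z one))%g.
  refine (etrans (ev_VM _ _ _) (congr2 _ _ (esym ev1))).
  exact: (etrans (congr1 _ (esym ev0)) (esym (edge_sym oC (oJ zero) (gz zero) (gJ zero)))).
have cq : continuous (fun t => quo (z t)) by exact: (cont_comp cz (@quo_continuous M)).
have b0 D : isorder D -> good_e (z zero) D -> from_base b (concat (trail D (z zero)) (fun t => quo (z t))).
  by move=> oD gD; apply: from_base_concat => //; [exact: trail_base|rewrite trail_one].
apply: diff_trans (edgeP oC (oJ one) (gz one) (gJ one)).
- exact: b0.
- exact: trail_base.
- exact: trail_base.
- by rewrite concat1 trail_one.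
- by rewrite !trail_one.
apply: (diff_homotopic (f := concat (trail (ord_e (z zero)) (z zero)) (fun t => quo (z t)))
  (g := concat (trail C (z zero)) (fun t => quo (z t)))).
- exact: b0.
- exact: b0.
- by rewrite !concat1.
- by apply: homotopic_refl; case: (b0 _ (oJ zero) (gJ zero)).
- exact: trail_path.
apply: diff_concat => //; first exact: trail_base.
- exact: trail_base.
- by rewrite !trail_one.
- by rewrite trail_one.
- exact: edgeP.
Qed.

Lemma horizontal_chart (Y : topologicalType) (f : Y -> X) (A : set Y) (z : Y -> E) C :
  isorder C -> (forall y, A y -> [/\ {for y, continuous z}, good_e (z y) C & quo (z y) = f y]) ->
  horizontal (@quo M) tau f A (fun y => rho C (ord_e (z y))).
Proof.
move=> oC H y0 Ay; have [cz gz qz] := H y0 Ay; exists z; split=> //.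
  by near=> y => /H [].
apply: filterS (near_tau cz oC gz) => y -> _.
by rewrite mulVKg.
Unshelve. all: by end_near. Qed.

Lemma hol_chart C (z : I -> E) : isorder C -> continuous z -> (forall t, good_e (z t) C) ->
  hol (fun t => quo (z t)) = ((rho C (ord_e (z zero)))^-1 * rho C (ord_e (z one)))%g.
Proof.
move=> oC cz gz.
have cq : continuous (fun t => quo (z t)) by exact: (cont_comp cz (@quo_continuous M)).
rewrite -[zero]clampI0 -[one]clampI1.
apply: (@holonomyE _ _ _ _ _ _ tau_charts tau_unique _ (fun t => rho C (ord_e (z (clampI t))))) => //.
apply: (horizontal_chart (z := fun t => z (clampI t))) => // t _; split=> //.
exact: (cont_comp (@clampI_continuous R) cz).
Qed.

Section Transport.
Variable f : I -> X.
Hypothesis cf : continuous f.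

Definition segment (r s : R) (t : I) : X := f (clampI (r + valI t * (s - r))).

Lemma segment_continuous r s : continuous (segment r s).
Proof.
apply: (cont_comp (f := fun t : I => clampI (r + valI t * (s - r)))) => //.
apply: (cont_comp (f := fun t : I => r + valI t * (s - r))); last exact: clampI_continuous.
apply: cont_add; first exact: cst_continuous.
by apply: cont_mul; [exact: valI_continuous|exact: cst_continuous].
Qed.

Lemma segment_zero r s : segment r s zero = f (clampI r).
Proof. by rewrite /segment valI0 mul0r addr0. Qed.

Lemma segment_one r s : segment r s one = f (clampI s).
Proof. by rewrite /segment valI1 mul1r addrC subrK. Qed.

Lemma segment01 : segment 0 1 = f.
Proof. by apply/funext => t; rewrite /segment subr0 mulr1 add0r clampI_val. Qed.

Lemma segment_concat r c s : homotopic (concat (segment r c) (segment c s)) (segment r s).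
Proof.
pose p (t : R) := r + Num.min (2 * t) 1 * (c - r) + Num.max (2 * t - 1) 0 * (s - c).
apply: (@reparam_homotopic _ _ f _ _ p (fun t => r + t * (s - r))) => //.
- apply: cont_add; first apply: cont_add; first exact: cst_continuous.
  + apply: cont_mul; last exact: cst_continuous.
    apply: cont_min; last exact: cst_continuous.
    by apply: cont_mul; [exact: cst_continuous|exact: id_continuous].
  + apply: cont_mul; last exact: cst_continuous.
    by apply: cont_max; [exact: affine_cont|exact: cst_continuous].
- apply: cont_add; first exact: cst_continuous.
  by apply: cont_mul; [exact: id_continuous|exact: cst_continuous].
- by rewrite /p min_l ?max_r; lra.
- by rewrite /p min_r ?max_l; lra.
- move=> t; have t01 := valI_bounds t; rewrite /concat /segment /p.
  have [t1|t1] := leP (valI t) 2^-1.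
    by rewrite min_l ?max_r ?clampIE; [congr (f (clampI _)); ring|lra..].
  by rewrite min_r ?max_l ?clampIE; [congr (f (clampI _)); ring|lra..].
Qed.

(** Both claims are compatible with concatenating segments and hold on segments inside one chart by
    [chart_transport], so [interval_induction] applies. *)
Lemma hol_transport :
  posn (hol f) (pos0 (f zero)) = pos0 (f one) /\
  diff_class (concat (sorted_trail (f zero)) f) (sorted_trail (f one)) (ev (hol f) (pos0 (f zero))).
Proof.
have [g gH] := path_horizontal_exists tau_charts tau_unique cf.
have -> : hol f = ((g 0%R)^-1 * g 1%R)%g by exact: holonomyE gH.
(* Extended by constants beyond [0, 1], since the local step of the induction may leave the
   interval. *)
pose F t := f (clampI t); pose G t := g (cut t).
have cF : continuous F by exact: (cont_comp (@clampI_continuous R) cf).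
have cutK t : clampI (cut t) = clampI t.
  by apply/val_inj; rewrite /= -[LHS]/(cut (cut t)) cutE ?cut_bounds.
have GH : horizontal (@quo M) tau F setT G.
  have h := horizontal_comp (Z := R) (p := cut) (B := setT) cut_continuous _ gH.
  apply: horizontal_congr (h _) => //= [t _|t _]; last exact: cut_bounds.
  by rewrite /F cutK.
suff [beta [GE pE dE]] : exists beta, [/\ G 1%R = (G 0%R * beta)%g,
    posn beta (pos0 (F 0)) = pos0 (F 1) &
    diff_class (concat (sorted_trail (F 0)) (segment 0 1)) (sorted_trail (F 1))
      (ev beta (pos0 (F 0)))].
  move: GE pE dE; rewrite segment01 /F clampI0 clampI1 /G !cutE ?lexx ?ler01 // => ->.
  by rewrite mulKg.
apply: (@interval_induction R (fun r s => exists beta, [/\ G s = (G r * beta)%g,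
    posn beta (pos0 (F r)) = pos0 (F s) &
    diff_class (concat (sorted_trail (F r)) (segment r s)) (sorted_trail (F s))
      (ev beta (pos0 (F r)))])).
  move=> r c s _ _ [x [Gx px_ dx]] [y [Gy py_ dy]]; exists (x * y)%g; split.
  - by rewrite Gy Gx mulgA.
  - by rewrite posn_comp px_.
  rewrite evM px_.
  have bt x' := sorted_trail_base x'.
  have [c1 _] := bt (F r); have sc := segment_continuous.
  have b1 r' s' : from_base b (concat (sorted_trail (F r')) (segment r' s')).
    by apply: from_base_concat => //; rewrite sorted_trail_one segment_zero.
  have e1 : segment r c one = segment c s zero by rewrite segment_one segment_zero.
  have b2 : from_base b (concat (concat (sorted_trail (F r)) (segment r c)) (segment c s)).
    by apply: from_base_concat => //; rewrite concat1.
  have d1 : diff_class (concat (concat (sorted_trail (F r)) (segment r c)) (segment c s))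
      (concat (sorted_trail (F c)) (segment c s)) (ev x (pos0 (F r))).
    apply: diff_concat dx => //; rewrite ?concat1 ?sorted_trail_one ?segment_one //.
    by rewrite segment_zero.
  have d2 := diff_trans b2 (b1 c s) (bt (F s)) _ _ d1 dy.
  apply: diff_homotopic (d2 _ _) => //; rewrite ?concat1 ?segment_one ?sorted_trail_one //.
    apply: (homotopic_trans (g := concat (sorted_trail (F r)) (concat (segment r c) (segment c s)))).
      apply/homotopic_sym/concatA => //; by rewrite sorted_trail_one segment_zero.
    apply: homotopic_concat; last exact: segment_concat.
      by rewrite concat0 sorted_trail_one segment_zero.
    exact: homotopic_refl.
  by apply: homotopic_refl; case: (bt (F s)).
move=> t _; pose e0 := lift (F t); pose C := ord_e e0.
have oC : isorder C by exact: ord_e_order.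
have [V [s [oV Vx Vs]]] := conf_section oC (good_ord_e e0).
rewrite liftK in Vx.
have [e /= e_gt0 eV] : exists2 e : R, 0 < e & ball t e `<=` F @^-1` V.
  by apply/nbhs_ballP; exact: (cF t _ (open_nbhs_nbhs (conj oV Vx))).
exists (e / 2); first by lra.
move=> r q tr rq qt; pose p (x : R) := r + x * (q - r).
have cp : continuous p.
  apply: cont_add; first exact: cst_continuous.
  by apply: cont_mul; [exact: id_continuous|exact: cst_continuous].
have pV x : 0 <= x <= 1 -> V (F (p x)).
  by move=> x01; apply: eV; rewrite /ball /= /p ltr_norml; nra.
pose z (x : I) := s (F (p (valI x))).
have zV x : V (F (p (valI x))) by apply: pV; exact: valI_bounds.
have cz : continuous z.
  move=> x; have [_ cs _] := Vs _ (zV x).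
  apply: (@continuous_comp _ _ _ (fun x => F (p (valI x))) s) => //.
  exact: (cont_comp (cont_comp (@valI_continuous R) cp) cF).
have gz x : good_e (z x) C by have [] := Vs _ (zV x).
have qz : (fun x => quo (z x)) = segment r q.
  by apply/funext => x; have [-> _ _] := Vs _ (zV x).
have qz0 : quo (z zero) = F r by rewrite -[LHS]/((fun x => quo (z x)) zero) qz segment_zero.
have qz1 : quo (z one) = F q by rewrite -[LHS]/((fun x => quo (z x)) one) qz segment_one.
have [pE dE] := chart_transport oC cz gz.
rewrite qz qz0 qz1 in pE dE.
eexists; split; [|exact: pE|exact: dE].
have HV : horizontal (@quo M) tau F (F @^-1` V) (fun x => rho C (ord_e (s (F x)))).
  apply: (horizontal_chart (z := fun x => s (F x))) => // x Vx'.
  have [qs cs gs] := Vs _ Vx'; split=> //.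
  by apply: (@continuous_comp _ _ _ F s) => //; exact: cF.
have GV : horizontal (@quo M) tau F (F @^-1` V) G by apply: horizontal_sub GH.
have p0 : p 0 = r by rewrite /p mul0r addr0.
have p1 : p 1 = q by rewrite /p mul1r addrC subrK.
have z0 : z zero = s (F r) by rewrite /z valI0 p0.
have z1 : z one = s (F q) by rewrite /z valI1 p1.
have := horizontal_segment tau_unique cp pV GV HV; rewrite p0 p1 z0 z1 => h.
by rewrite mulgA h mulgVK.
Qed.

End Transport.

Lemma hol_concat (f g : I -> X) : continuous f -> continuous g -> f one = g zero ->
  hol (concat f g) = (hol f * hol g)%g.
Proof. exact: holonomy_concat tau_charts tau_unique f g. Qed.

Lemma loop_classV (x : pi1) (f : I -> X) : from_base b f -> f one = b ->
  loop_class x f -> loop_class x^-1%g (reverse f).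
Proof.
move=> [cf f0] f1 fx; have [|||y fy] := @loop_class_exists R X b (reverse f).
- exact: reverse_continuous.
- by rewrite reverse0.
- by rewrite reverse1.
suff -> : x^-1%g = y by [].
by apply: mulg1_eq; apply: loop_class_uniq (loop_classM fx fy) (diff_refl (conj cf f0)).
Qed.

Definition loop_of (x : pi1) : {path I from b to b in X} := repr x.

Definition mono (x : pi1) : BB := hol (loop_of x).

Lemma mono_class x f : from_base b f -> f one = b -> loop_class x f -> mono x = hol f.
Proof.
move=> [cf f0] f1 [l [<- lf]]; apply: (holonomy_homotopic tau_charts tau_unique) => //.
  exact: loop_continuous.
by apply: homotopic_trans lf; exact: repr_homotopic.
Qed.

Lemma class_repr x : loop_class x (loop_of x).
Proof. by exists (loop_of x); split; [exact: reprK|exact/homotopic_refl/loop_continuous]. Qed.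

Lemma from_base_repr (x : pi1) : from_base b (loop_of x).
Proof. by split; [exact: loop_continuous|exact: path_zero]. Qed.

Lemma monoM : {morph mono : x y / (x * y)%g}.
Proof.
move=> x y; have xy := loop_classM (class_repr x) (class_repr y).
rewrite (mono_class _ _ xy) ?concat1 ?path_one //.
  apply: hol_concat; [exact: loop_continuous|exact: loop_continuous|].
  by rewrite path_one path_zero.
apply: from_base_concat; [exact: from_base_repr|exact: loop_continuous|].
by rewrite path_one path_zero.
Qed.

Lemma mono_posn x : posn (mono x) (pos0 b) = pos0 b.
Proof.
have := hol_transport (@loop_continuous _ _ _ (loop_of x)).
by rewrite path_zero path_one => -[].
Qed.

Lemma base_class : exists lambda : pi1, loop_class lambda (sorted_trail b).
Proof.
have [c0 c1] := sorted_trail_base b.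
by apply: loop_class_exists => //; exact: sorted_trail_one.
Qed.

(** The sorted trail of b is a loop that may be nontrivial, because stems are arbitrary paths; it
    causes the conjugation in [ev_mono]. *)
Definition base_shift : pi1 := sval (cid base_class).

Lemma ev_mono x : ev (mono x) (pos0 b) = (base_shift * x * base_shift^-1)%g.
Proof.
have := hol_transport (@loop_continuous _ _ _ (loop_of x)).
rewrite path_zero path_one => -[_ h]; apply: loop_class_uniq h _.
have hb : loop_class base_shift (sorted_trail b) := svalP (cid base_class).
apply: loop_classM; first by apply: loop_classM => //; exact: class_repr.
by apply: loop_classV => //; [exact: sorted_trail_base|exact: sorted_trail_one].
Qed.

Lemma mono_inj : injective mono.
Proof.
move=> x y /(congr1 (ev^~ (pos0 b))); rewrite !ev_mono.
by move=> /mulIg /mulgI.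
Qed.

Lemma hol_trail C e r : isorder C -> good_e e C -> rho C (ord_e (ray C e zero)) = r ->
  hol (trail C e) = (hol (stem (index 0%N C)) * (r^-1 * rho C (ord_e e)))%g.
Proof.
move=> oC gC <-; have [cs s0 s1] := stemP (index0_order oC).
have [cr _] := rayP oC gC.
have h := hol_chart oC cr (fun t => ray_good t oC gC).
have r1 := congr1 (fun e => rho C (ord_e e)) (ray_one oC gC).
have <- : hol (fun t => quo (ray C e t)) =
    ((rho C (ord_e (ray C e zero)))^-1 * rho C (ord_e e))%g.
  exact: (etrans h (congr1 (fun x => (rho C (ord_e (ray C e zero)))^-1 * x)%g r1)).
exact: hol_concat cs (quo_ray_continuous oC gC) (trail_joint oC gC).
Qed.

Lemma rho_ray_zero C C' e e' : isorder C -> isorder C' -> good_e e C -> good_e e' C' ->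
  index 0%N C = index 0%N C' -> rho C (ord_e (ray C e zero)) = rho C' (ord_e (ray C' e' zero)).
Proof.
move=> oC oC' gC gC' e0; have [s sC] := relabel_exists oC oC' e0.
have -> : ray C e zero = conf_perm s (ray C' e' zero).
  apply: lab_ext => a al; rewrite !(lab_perm _ s) //.
  have [-> ->] := ray_zero oC gC al; have [-> ->] := ray_zero oC' gC' (relabel_in s al).
  by rewrite -sC vx_relabel.
move: (ray C' e' zero) => v; rewrite -(ord_e_perm s v) -sC.
exact: esym (rho_map (@relabel_inj s) oC (ord_e_order _)).
Qed.

(** The part of the holonomy of a trail that depends on the place of 0 alone ([hol_trail_shift]). *)
Definition shift (k : 'I_4) : BB :=
  (hol (stem k) * (rho (std k) (ord_e (ray (std k) (estar k) zero)))^-1)%g.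

Lemma hol_trail_shift C e (k : 'I_4) : isorder C -> good_e e C -> index 0%N C = k ->
  hol (trail C e) = (shift k * rho C (ord_e e))%g.
Proof.
move=> oC gC e0; have oS := std_order k; have gS := estar_good k oS.
have h : rho C (ord_e (ray C e zero)) = rho (std k) (ord_e (ray (std k) (estar k) zero)).
  by apply: rho_ray_zero => //; rewrite index_std ?e0.
by rewrite (hol_trail oC gC h) e0 mulgA.
Qed.

Lemma posn_shift k : posn (shift k) (pos0 b) = k.
Proof.
have [cs s0 s1] := stemP (ltn_ord k); have oS := std_order k.
have gS := estar_good k oS; have gr := ray_good zero oS gS.
have [] := hol_transport cs; rewrite s0 s1 => hs _.
have [_] := edge_rho oS gr; rewrite index_std // [p4 k]inord_val => hk.
rewrite /shift posn_comp hs (homV posnM) /vtx pos0_quo -hk.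
exact: permK.
Qed.

Lemma rho_oswap C i : isorder C -> (i < 3)%N -> rho C (oswap i C) = sigma i.
Proof.
have H : all (fun C => all (fun i => gallery 6 C (oswap i C) == [:: i]) [:: 0; 1; 2]%N) orders.
  by vm_compute.
rewrite isorder_orders => oC i3; rewrite rho_word.
have iI : i \in [:: 0; 1; 2]%N by case: i i3 => [|[|[|]]].
by have /allP /(_ i iI) /eqP -> := allP H C oC; rewrite /= mulg1.
Qed.

(** In [estar k] all pairs have to be exchanged, so the sort may begin with any swap. *)
Lemma rho_std_estar k i : (k < 4)%N -> (i < 3)%N ->
  rho (std k) (ord_e (estar k)) = (sigma i * rho (oswap i (std k)) (ord_e (estar k)))%g.
Proof.
move=> k4 i3; have oS := std_order k; have oS' := isorder_oswap i oS.
rewrite -(rho_oswap oS i3); apply: rho_aligned => //; first exact: ord_e_order.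
apply/all_pairsP => a c al cl; apply/negP => /and3P[ac ca /ordIm_before/(_ cl)].
have := estar_before al cl ac.
by rewrite /leIm; case: ltgtP.
Qed.

Lemma mono_edge C D e : isorder C -> isorder D -> good_e e C -> good_e e D ->
  mono (edge C D e) = (hol (trail C e) * (hol (trail D e))^-1)%g.
Proof.
move=> oC oD gC gD; have [cC C0] := trail_base oC gC; have [cD D0] := trail_base oD gD.
have cr := reverse_continuous cD.
rewrite (mono_class _ _ (edgeP oC oD gC gD)).
- rewrite -(holonomy_reverse tau_charts tau_unique cD).
  by apply: hol_concat => //; rewrite reverse0 !trail_one.
- by apply: from_base_concat => //; rewrite reverse0 !trail_one.
- by rewrite concat1 reverse1.
Qed.

(** Both sides are cocycles in x, so generators suffice. For these [ev] is an edge at [estar], the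
    difference of two trails whose holonomies end with the same factor [r]. *)
Lemma mono_ev x k : mono (ev x k) = (shift k * x * (shift (posn x k))^-1)%g.
Proof.
have gen i k' : (i < 3)%N -> mono (ev (sigma i) k') =
    (shift k' * sigma i * (shift (posn (sigma i) k'))^-1)%g.
  move=> i3; have oS := std_order k'; have oS' := isorder_oswap i oS.
  have [gS gS'] := (estar_good k' oS, estar_good k' oS').
  rewrite /ev -psi_posn psi_sigma // [(wgen i).2]/(taui i) [(wgen i).1 k']ffunE.
  have tk : index 0%N (oswap i (std k')) = taui i k'.
    have := taui_index i oS; rewrite index_std // [p4 k']inord_val => ->.
    by rewrite inordK ?index0_order.
  have [r [E1 E2]] : exists r, hol (trail (std k') (estar k')) = (shift k' * (sigma i * r))%g /\
      hol (trail (oswap i (std k')) (estar k')) = (shift (taui i k') * r)%g.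
    exists (rho (oswap i (std k')) (ord_e (estar k'))); split; last exact: hol_trail_shift.
    have E := hol_trail_shift (k := k') oS gS (index_std (ltn_ord k')).
    exact: (etrans E (congr1 (fun x => shift k' * x)%g (rho_std_estar (ltn_ord k') i3))).
  by rewrite mono_edge // E1 E2 invgM !mulgA (mulgK r).
elim/BB_ind: x k => [k|k|k|x y IHx IHy k|x IH k].
- exact: (gen 0%N).
- exact: (gen 1%N).
- exact: (gen 2%N).
- rewrite evM monoM IHx IHy (posn_comp x y k).
  move: (shift k) (shift (posn x k)) (shift (posn y _)) => a c d.
  by rewrite !mulgA (mulgVK c).
- have [k' ->] : exists k', k = posn x k' by exists ((posn x)^-1%g k); rewrite permKV.
  rewrite evV (homV monoM) (IH k') (homV posnM) permK.
  move: (shift k') (shift (posn x k')) => a c.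
  by rewrite !invgM invgK !mulgA.
Qed.

Lemma mono_image x : posn x (pos0 b) = pos0 b <-> exists y, mono y = x.
Proof.
split=> [xb|[y <-]]; last exact: mono_posn.
have [d dE] : exists d, shift (pos0 b) = d by exists (shift (pos0 b)).
have db : posn d (pos0 b) = pos0 b by rewrite -dE posn_shift.
(* Chosen so that the conjugation by [shift (pos0 b)] in [mono_ev] gives back x. *)
exists (ev (d^-1 * x * d)%g (pos0 b)).
have dVb : posn d^-1%g (pos0 b) = pos0 b by rewrite -{1}db (homV posnM) permK.
have dxd : posn (d^-1 * x * d)%g (pos0 b) = pos0 b by rewrite !posn_comp dVb xb db.
rewrite mono_ev dxd dE.
by rewrite !mulgA mulgV mul1g mulgK.
Qed.

Theorem derived_config_group :
  group_iso (derived_group pi1) (sdprod_group actL).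
Proof. exact: stabilizer_derived monoM mono_inj mono_image. Qed.

End BasePoint.
End Coordinates.

(** * The twice punctured sphere *)

Section Stereographic.
Local Open Scope ring_scope.
Context (R : realFieldType) (P Q K : R).
Hypotheses (K0 : K != 0) (pole1 : P ^+ 2 + Q ^+ 2 + K ^+ 2 = 1).

Definition height (a b c : R) : R := a * P + b * Q + c * K.
(** First coordinate of the projection from the pole (P, Q, K) onto the plane through 0 orthogonal
    to it. Two coordinates suffice: as K is nonzero, orthogonality to the pole gives the third
    ([unstereo3]). *)
Definition stereo1 (a b c : R) : R := (a - height a b c * P) / (1 - height a b c).
Definition stereo2 (a b c : R) : R := (b - height a b c * Q) / (1 - height a b c).

Definition unstereo3 (u v : R) : R := - (P * u + Q * v) / K.
Definition unstereo_sq (u v : R) : R := u ^+ 2 + v ^+ 2 + unstereo3 u v ^+ 2.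
Definition unstereo (w p u v : R) : R :=
  (2 * w + (unstereo_sq u v - 1) * p) / (unstereo_sq u v + 1).

Lemma unstereo_orth u v : u * P + v * Q + unstereo3 u v * K = 0.
Proof. by rewrite /unstereo3 mulfVK //; ring. Qed.

Lemma unstereo_sq_gt0 u v : 0 < unstereo_sq u v + 1.
Proof. by rewrite ltr_wpDl // !addr_ge0 // sqr_ge0. Qed.

Section Point.
Variables a b c : R.
Hypothesis abc1 : a ^+ 2 + b ^+ 2 + c ^+ 2 = 1.

(** The squared distance to the pole is 2 - 2 [height]. *)
Lemma height_neq1 : ~ (a = P /\ b = Q /\ c = K) -> 1 - height a b c != 0.
Proof.
move=> H; apply/eqP => h; apply: H.
have s : (a - P) ^+ 2 + ((b - Q) ^+ 2 + (c - K) ^+ 2) = 0.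
  have -> : (a - P) ^+ 2 + ((b - Q) ^+ 2 + (c - K) ^+ 2) =
    (a ^+ 2 + b ^+ 2 + c ^+ 2) + (P ^+ 2 + Q ^+ 2 + K ^+ 2) - 2 * height a b c.
    by rewrite /height; ring.
  by rewrite abc1 pole1; move: h; lra.
move/eqP: s; rewrite !paddr_eq0 ?addr_ge0 ?sqr_ge0 // !sqrf_eq0 !subr_eq0.
by move=> /and3P[/eqP-> /eqP-> /eqP->].
Qed.

Hypothesis h1 : 1 - height a b c != 0.
Let d := height a b c.

Lemma unstereo3_stereo : unstereo3 (stereo1 a b c) (stereo2 a b c) = (c - d * K) / (1 - d).
Proof.
apply: (mulIf K0); rewrite /unstereo3 mulfVK // /stereo1 /stereo2 -/d.
apply: (mulIf h1); rewrite -/d.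
have -> : (c - d * K) / (1 - d) * K * (1 - d) = (c - d * K) * K by field.
have -> : - (P * ((a - d * P) / (1 - d)) + Q * ((b - d * Q) / (1 - d))) * (1 - d) =
  d * (P ^+ 2 + Q ^+ 2 + K ^+ 2) - d * K ^+ 2 - (a * P + b * Q) by field.
by rewrite pole1 /d /height; ring.
Qed.

Lemma unstereo_sq_stereo : unstereo_sq (stereo1 a b c) (stereo2 a b c) = (1 + d) / (1 - d).
Proof.
rewrite /unstereo_sq unstereo3_stereo /stereo1 /stereo2 -/d.
have -> : ((a - d * P) / (1 - d)) ^+ 2 + ((b - d * Q) / (1 - d)) ^+ 2 + ((c - d * K) / (1 - d)) ^+ 2
  = ((a ^+ 2 + b ^+ 2 + c ^+ 2) - 2 * d * height a b c + d ^+ 2 * (P ^+ 2 + Q ^+ 2 + K ^+ 2))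
    / (1 - d) ^+ 2 by rewrite /height; field.
by rewrite abc1 pole1 -/d; field.
Qed.

Lemma unstereoK x p : unstereo ((x - d * p) / (1 - d)) p (stereo1 a b c) (stereo2 a b c) = x.
Proof.
rewrite /unstereo unstereo_sq_stereo; field.
rewrite h1 /=; have -> : 1 + d + (1 - d) = 2 by ring.
by rewrite pnatr_eq0.
Qed.

End Point.

Section Plane.
Variables u v : R.
Let n := unstereo_sq u v.
Let A := unstereo u P u v.
Let B := unstereo v Q u v.
Let C := unstereo (unstereo3 u v) K u v.

Let n1 : n + 1 != 0. Proof. by rewrite gt_eqF // unstereo_sq_gt0. Qed.

Lemma unstereo_sphere : A ^+ 2 + B ^+ 2 + C ^+ 2 = 1.
Proof.
rewrite /A /B /C /unstereo -/n; set w := unstereo3 u v.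
have -> : ((2 * u + (n - 1) * P) / (n + 1)) ^+ 2 + ((2 * v + (n - 1) * Q) / (n + 1)) ^+ 2 +
  ((2 * w + (n - 1) * K) / (n + 1)) ^+ 2 =
  (4 * (u ^+ 2 + v ^+ 2 + w ^+ 2) + 4 * (n - 1) * (u * P + v * Q + w * K) +
    (n - 1) ^+ 2 * (P ^+ 2 + Q ^+ 2 + K ^+ 2)) / (n + 1) ^+ 2 by field.
by rewrite unstereo_orth pole1 -/(unstereo_sq u v) -/n; field.
Qed.

Lemma height_unstereo : height A B C = (n - 1) / (n + 1).
Proof.
rewrite /height /A /B /C /unstereo -/n; set w := unstereo3 u v.
have -> : (2 * u + (n - 1) * P) / (n + 1) * P + (2 * v + (n - 1) * Q) / (n + 1) * Q +
   (2 * w + (n - 1) * K) / (n + 1) * K =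
  (2 * (u * P + v * Q + w * K) + (n - 1) * (P ^+ 2 + Q ^+ 2 + K ^+ 2)) / (n + 1) by field.
by rewrite unstereo_orth pole1; field.
Qed.

Lemma stereo1K : stereo1 A B C = u.
Proof.
rewrite /stereo1 height_unstereo /A /unstereo -/n; field.
rewrite n1 ?andbT /=; have -> : n + 1 - (n - 1) = 2 by ring.
by rewrite pnatr_eq0.
Qed.

Lemma stereo2K : stereo2 A B C = v.
Proof.
rewrite /stereo2 height_unstereo /B /unstereo -/n; field.
rewrite n1 ?andbT /=; have -> : n + 1 - (n - 1) = 2 by ring.
by rewrite pnatr_eq0.
Qed.

Lemma unstereo_pole : ~ (A = P /\ B = Q /\ C = K).
Proof.
case=> aP [bQ cK]; have := height_unstereo.
rewrite /height aP bQ cK -!expr2 pole1 => /(congr1 (fun x => x * (n + 1))).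
by rewrite mulfVK //; lra.
Qed.

End Plane.

End Stereographic.

Section Sphere.
Local Open Scope ring_scope.
Context (R : realType).
Implicit Types (y : sphere2 R) (i : 'I_3).

Definition coord y i : R := (val y : 'rV[R]_3) ord0 i.

Lemma coord_sphere y : \sum_i coord y i ^+ 2 = 1.
Proof. exact: (set_mem (valP y)). Qed.

Lemma sphere_ext y y' : (forall i, coord y i = coord y' i) -> y = y'.
Proof. by move=> H; apply/val_inj/rowP. Qed.

Lemma sphere_coord_continuous i : continuous (coord^~ i).
Proof.
apply: (cont_comp (f := fun y => val y) (g := fun v : 'rV[R]_3 => v ord0 i)).
  exact: set_val_continuous.
exact: coord_continuous.
Qed.

Lemma sphere_build (Y : topologicalType) (f : 'I_3 -> Y -> R) :
  (forall i, continuous (f i)) -> (forall t, \sum_i f i t ^+ 2 = 1) ->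
  exists F : Y -> sphere2 R, continuous F /\ forall t i, coord (F t) i = f i t.
Proof.
move=> cf f1; pose r (t : Y) : 'rV[R]_3 := \row_i f i t.
have rP t : [set v : 'rV[R]_3 | \sum_i v ord0 i ^+ 2 = 1] (r t).
  by rewrite /= -[RHS](f1 t); apply: eq_bigr => i _; rewrite mxE.
exists (fun t => exist _ (r t) (mem_set (rP t))); split; last by move=> t i; rewrite /coord mxE.
apply: into_set_continuous => /=.
(* Expanded on unit rows, the map is a sum of scalings, whose continuity is available. *)
have -> : r = fun t => \sum_i f i t *: (delta_mx 0 i : 'rV[R]_3).
  apply/funext => t; apply/rowP => j; rewrite mxE summxE (bigD1 j) //= !mxE !eqxx mulr1.
  by rewrite big1 ?addr0 // => i ij; rewrite !mxE /= [j == i]eq_sym (negbTE ij) mulr0.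
move=> t.
have c i : {for t, continuous (fun t => f i t *: (delta_mx 0 i : 'rV[R]_3))}.
  by apply: continuousZr_tmp; exact: cf.
under eq_fun do rewrite !big_ord_recl big_ord0 addr0.
exact: continuousD (c _) (continuousD (c _) (c _)).
Qed.

(** A nonzero coordinate is put last to serve as K; naming the axes i, j, k spares a separate chart
    for each of them. *)
Lemma coord_frame y : exists i j k, [/\ coord y k != 0, [/\ i != j, i != k & j != k],
  forall l, [\/ l = i, l = j | l = k] & forall F : 'I_3 -> R, \sum_l F l = F i + F j + F k].
Proof.
pose o0 : 'I_3 := inord 0; pose o1 : 'I_3 := inord 1; pose o2 : 'I_3 := inord 2.
have [n01 n02 n12] : [/\ o0 != o1, o0 != o2 & o1 != o2].
  by split; rewrite -val_eqE /= !inordK.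
have all3 l : [\/ l = o0, l = o1 | l = o2].
  by case: l => [[|[|[|l]]] l3] //; [apply: Or31|apply: Or32|apply: Or33]; apply/val_inj; rewrite /= inordK.
have sum3 (F : 'I_3 -> R) : \sum_l F l = F o0 + F o1 + F o2.
  rewrite !big_ord_recl big_ord0 addr0 addrA; congr (F _ + F _ + F _);
    by apply/val_inj; rewrite /= inordK.
have [k yk] : exists k, coord y k != 0.
  apply/existsP; apply: contraT; rewrite negb_exists => /forallP H.
  have := coord_sphere y; rewrite big1 => [/eqP|i _]; first by rewrite eq_sym oner_eq0.
  by have := H i; rewrite negbK => /eqP ->; rewrite expr0n.
case: (all3 k) => kE; rewrite kE in yk.
- exists o1, o2, o0; split; [by []|by split=> //; rewrite eq_sym| |by move=> F; rewrite sum3; ring].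
  move=> l; case: (all3 l); [apply: Or33|apply: Or31|apply: Or32].
- exists o0, o2, o1; split; [by []|by split=> //; rewrite eq_sym| |by move=> F; rewrite sum3; ring].
  move=> l; case: (all3 l); [apply: Or31|apply: Or33|apply: Or32].
- by exists o0, o1, o2.
Qed.

Section Chart.
Variables (p y0 : sphere2 R).
Hypothesis py0 : p != y0.
Variables i j k : 'I_3.
Hypotheses (pk : coord p k != 0) (ij : i != j) (ik : i != k) (jk : j != k).
Hypothesis all3 : forall l, [\/ l = i, l = j | l = k].
Hypothesis sum3 : forall F : 'I_3 -> R, \sum_l F l = F i + F j + F k.
Local Notation P := (coord p i).
Local Notation Q := (coord p j).
Local Notation K := (coord p k).
Local Notation M := (punctured_sphere2 p y0).

Let pole1 : P ^+ 2 + Q ^+ 2 + K ^+ 2 = 1.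
Proof. by rewrite -[RHS](coord_sphere p) sum3. Qed.

Let norm1 y : coord y i ^+ 2 + coord y j ^+ 2 + coord y k ^+ 2 = 1.
Proof. by rewrite -[RHS](coord_sphere y) sum3. Qed.

Let ext3 y y' : coord y i = coord y' i -> coord y j = coord y' j -> coord y k = coord y' k -> y = y'.
Proof. by move=> hi hj hk; apply: sphere_ext => l; case: (all3 l) => ->. Qed.

Definition sphere_height y : R := height P Q K (coord y i) (coord y j) (coord y k).
Definition plane1 y : R := stereo1 P Q K (coord y i) (coord y j) (coord y k).
Definition plane2 y : R := stereo2 P Q K (coord y i) (coord y j) (coord y k).

Lemma sphere_height_neq1 y : y != p -> 1 - sphere_height y != 0.
Proof.
move=> yp; apply: height_neq1 => //; case=> hi [hj hk].
by rewrite (ext3 hi hj hk) eqxx in yp.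
Qed.

Lemma plane_inj y y' : y != p -> y' != p -> plane1 y = plane1 y' -> plane2 y = plane2 y' -> y = y'.
Proof.
move=> /sphere_height_neq1 h /sphere_height_neq1 h' e1 e2.
have plane3E x : 1 - sphere_height x != 0 ->
    [/\ unstereo P Q K (plane1 x) P (plane1 x) (plane2 x) = coord x i,
        unstereo P Q K (plane2 x) Q (plane1 x) (plane2 x) = coord x j &
        unstereo P Q K (unstereo3 P Q K (plane1 x) (plane2 x)) K (plane1 x) (plane2 x) = coord x k].
  move=> hx; have U := unstereoK pk pole1 (norm1 x) hx.
  split; [exact: (U _ P)|exact: (U _ Q)|].
  by rewrite (unstereo3_stereo pk pole1 hx); exact: (U _ K).
have [ei' ej' ek'] := plane3E y' h'; have [ei ej ek] := plane3E y h.
by apply: ext3; [rewrite -ei -ei'|rewrite -ej -ej'|rewrite -ek -ek']; rewrite e1 e2.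
Qed.

Lemma punctureP (m : M) : val m != p /\ val m != y0.
Proof.
have := set_mem (valP m); rewrite /= => H.
by split; apply/eqP => e; apply: H; [left|right].
Qed.

Definition plane_x (m : M) : R := plane1 (val m) - plane1 y0.
Definition plane_y (m : M) : R := plane2 (val m) - plane2 y0.

Let cM l : continuous (fun m : M => coord (val m) l).
Proof.
apply: (cont_comp (f := fun m : M => val m) (g := coord^~ l)); first exact: set_val_continuous.
exact: sphere_coord_continuous.
Qed.

Let c_height : continuous (fun m : M => sphere_height (val m)).
Proof.
have c l : continuous (fun m : M => coord (val m) l * coord p l).
  by apply: cont_mul; [exact: cM|exact: cst_continuous].
exact: cont_add (cont_add (c i) (c j)) (c k).
Qed.

Let c_quot (r : R) l : continuous (fun m : M =>
  (coord (val m) l - sphere_height (val m) * r) / (1 - sphere_height (val m))).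
Proof.
apply: cont_mul.
  by apply: cont_sub; [exact: cM|apply: cont_mul; [exact: c_height|exact: cst_continuous]].
have c1 : continuous (fun m : M => 1 - sphere_height (val m)).
  by apply: cont_sub; [exact: cst_continuous|exact: c_height].
move=> m; apply: (continuousV _ (c1 m)).
by apply: sphere_height_neq1; case: (punctureP m).
Qed.

Lemma plane_x_continuous : continuous plane_x.
Proof. by apply: cont_sub; [exact: c_quot|exact: cst_continuous]. Qed.

Lemma plane_y_continuous : continuous plane_y.
Proof. by apply: cont_sub; [exact: c_quot|exact: cst_continuous]. Qed.

Lemma plane_xy_inj m m' : plane_x m = plane_x m' -> plane_y m = plane_y m' -> m = m'.
Proof.
move=> /addIr e1 /addIr e2; apply/val_inj.
by apply: plane_inj e1 e2; case: (punctureP m); case: (punctureP m').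
Qed.

Lemma plane_xy_neq0 m : ~~ ((plane_x m == 0) && (plane_y m == 0)).
Proof.
apply/negP; rewrite !subr_eq0 => /andP[/eqP e1 /eqP e2].
have [mp my] := punctureP m; have py : y0 != p by rewrite eq_sym.
by rewrite (plane_inj mp py e1 e2) eqxx in my.
Qed.

Lemma plane_xy_lift (Y : topologicalType) (f g : Y -> R) :
  continuous f -> continuous g -> (forall t, ~~ ((f t == 0) && (g t == 0))) ->
  exists F : Y -> M, continuous F /\ forall t, plane_x (F t) = f t /\ plane_y (F t) = g t.
Proof.
move=> cf cg fg0.
pose u t := f t + plane1 y0; pose v t := g t + plane2 y0.
have cu : continuous u by apply: cont_add => //; exact: cst_continuous.
have cv : continuous v by apply: cont_add => //; exact: cst_continuous.
have cc (r : R) : continuous (fun _ : Y => r) by exact: cst_continuous.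
have cw : continuous (fun t => unstereo3 P Q K (u t) (v t)).
  apply: cont_mul => //; have h : continuous (fun t => 0 - (P * u t + Q * v t)).
    by apply: cont_sub => //; apply: cont_add; apply: cont_mul.
  by under eq_fun do rewrite -sub0r.
have cn : continuous (fun t => unstereo_sq P Q K (u t) (v t)).
  have cs (h : Y -> R) : continuous h -> continuous (fun t => h t ^+ 2).
    by move=> ch; under eq_fun do rewrite expr2; exact: cont_mul.
  by apply: cont_add; [apply: cont_add|]; exact: cs.
have cU (w : Y -> R) (r : R) : continuous w -> continuous (fun t => unstereo P Q K (w t) r (u t) (v t)).
  move=> cw'; apply: cont_mul.
    by apply: cont_add; apply: cont_mul => //; apply: cont_sub.
  have c1 : continuous (fun t => unstereo_sq P Q K (u t) (v t) + 1) by exact: cont_add.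
  move=> t; apply: (continuousV _ (c1 t)).
  by rewrite gt_eqF // unstereo_sq_gt0.
pose h l t := if l == i then unstereo P Q K (u t) P (u t) (v t)
  else if l == j then unstereo P Q K (v t) Q (u t) (v t)
  else unstereo P Q K (unstereo3 P Q K (u t) (v t)) K (u t) (v t).
have hi : h i = fun t => unstereo P Q K (u t) P (u t) (v t).
  by apply/funext => t; rewrite /h eqxx.
have hj : h j = fun t => unstereo P Q K (v t) Q (u t) (v t).
  by apply/funext => t; rewrite /h eq_sym (negbTE ij) eqxx.
have hk : h k = fun t => unstereo P Q K (unstereo3 P Q K (u t) (v t)) K (u t) (v t).
  by apply/funext => t; rewrite /h ![k == _]eq_sym (negbTE ik) (negbTE jk).
have [l|t|F [cF FE]] := sphere_build (f := h).
- by case: (all3 l) => ->; rewrite (hi, hj, hk); exact: cU.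
- by rewrite sum3 hi hj hk; exact: unstereo_sphere.
have P1 t : plane1 (F t) = u t by rewrite /plane1 !FE hi hj hk; exact: stereo1K.
have P2 t : plane2 (F t) = v t by rewrite /plane2 !FE hi hj hk; exact: stereo2K.
(* The inverse projection never attains the pole, and the value y0 would make both f and g
   vanish. *)
have FM t : (~` [set p; y0]) (F t).
  case=> e.
    apply: (unstereo_pole pk pole1 (u := u t) (v := v t)).
    by rewrite -[X in X = _ /\ _](congr1 (fun f => f t) hi) -[X in _ /\ (X = _ /\ _)](congr1 (fun f => f t) hj)
      -[X in _ /\ (_ /\ X = _)](congr1 (fun f => f t) hk) -!FE e.
  have := P1 t; have := P2 t; rewrite e => /esym/eqP; rewrite -subr_eq0 addrK => h2.
  move=> /esym/eqP; rewrite -subr_eq0 addrK => h1.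
  by have := fg0 t; rewrite h1 h2.
exists (fun t => exist _ (F t) (mem_set (FM t))); split.
  by apply: into_set_continuous.
by move=> t; rewrite /plane_x /plane_y /= P1 P2 /u /v !addrK.
Qed.

End Chart.
End Sphere.

Theorem proposition42 (R : realType) (x1 x2 : sphere2 R) (x12 : x1 != x2)
    (b : unordered_config 3 (punctured_sphere2 x1 x2)) :
  [/\ freely_generates alphaL,
      free_of_infinite_rank L,
      forall j : int, gen_set (range alpha_ix) (R_ j) /\
                      gen_set (range alpha_ix) (S_ j)
    & exists phi : group_action F2 L,
      [/\ forall (i : 'I_4) (j : int),
            val (phi gen_u (alphaL (i, j))) = alpha_conj t_ R_ i.+2 j,
          forall (i : 'I_4) (j : int),
            val (phi gen_v (alphaL (i, j))) = alpha_conj w_ S_ i.+2 j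
        & group_iso (derived_group (braid_group R b)) (sdprod_group phi)]].
Proof.
split.
- exact: alphaL_free.
- split; first by exists (range alphaL); exact: L_free_basis.
  exact: L_infinite_rank.
- by move=> j; split; apply: tele_prod_gen; [rewrite (@deg_t 0)|rewrite (@deg_w 0)]; rewrite ?deg_z.
exists actL; split; [exact: actL_u|exact: actL_v|].
have [i [j [k [pk [ij ik jk] all3 sum3]]]] := coord_frame x1.
exact: (derived_config_group
  (plane_x_continuous all3 sum3) (plane_y_continuous all3 sum3)
  (plane_xy_inj pk all3 sum3) (plane_xy_neq0 x12 pk all3 sum3)
  (@plane_xy_lift _ _ _ _ _ _ pk ij ik jk all3 sum3) b).
Qed.
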